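(* Let $\alpha=\{z_1,z_2,z_3,z_4,z_5\}\subseteq\widehat{\mathbb{C}}$ be a set of five distinct points. 1. If there is a linear fractional transformation $\psi$ with $\psi(\alpha)=\{1,w,w^2,w^3,w^4\}$, $w=e^{\frac{2\pi}5i}$, then $\mathcal{A}_\alpha=\psi^{-1}\langle z\mapsto e^{\frac{2\pi}5i}z,\ z\mapsto\frac1z\rangle\psi\simeq D_5$, and its multiplicity vector is $(0,1,0,0)$. 2. If there is a linear fractional transformation $\psi$ with $\psi(\alpha)=\{0,1,i,-1,-i\}$, then $\mathcal{A}_\alpha=\psi^{-1}\langle z\mapsto iz\rangle\psi\simeq\mathbb{Z}_4$, and its multiplicity vector is $(1,1,0,0)$. 3. If there is a linear fractional transformation $\psi$ with $\psi(\alpha)=\{0,\infty,1,w,w^2\}$, $w=e^{\frac{2\pi}3i}$, then $\mathcal{A}_\alpha=\psi^{-1}\langle z\mapsto e^{\frac{2\pi}3i}z,\ z\mapsto\frac1z\rangle\psi\simeq D_3$, and its multiplicity vector is $(1,0,0)$. 4. If there is a linear fractional transformation $\psi$ with $\psi(\alpha)=\{0,1,-1,a,-a\}$, $a\neq0,\pm1$, then: (a) if $a=\pm(\sqrt5+2)$ or $\pm(\sqrt5-2)$, there is a linear fractional transformation $\phi$ with $\phi(\alpha)=\{1,w,w^2,w^3,w^4\}$, $w=e^{\frac{2\pi}5i}$ (so case 1 applies); (b) if $a=\pm i$, then $\psi(\alpha)=\{0,1,i,-1,-i\}$ (so case 2 applies); (c) if $a=\pm\sqrt3i$ or $\pm\frac1{\sqrt3}i$,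 there is a linear fractional transformation $\phi$ with $\phi(\alpha)=\{0,\infty,1,w,w^2\}$, $w=e^{\frac{2\pi}3i}$ (so case 3 applies); (d) otherwise, $\mathcal{A}_\alpha=\psi^{-1}\langle z\mapsto-z\rangle\psi\simeq\mathbb{Z}_2$, and its multiplicity vector is $(1,1)$. 5. Otherwise (no $\psi$ as in 1–4 exists), $\mathcal{A}_\alpha=\{\mathrm{Id}\}$.
   Context: $\widehat{\mathbb{C}}=\mathbb{C}\cup\{\infty\}$. LFT means linear fractional transformation. $\mathcal{A}_\alpha$ is the group of LFTs preserving the set $\alpha$; $D_k$ is the dihedral group of order $2k$. Two subsets of $\widehat{\mathbb{C}}$ are equivalent if an LFT carries one onto the other. Let $n=5$. $K_n=\{\boldsymbol\lambda=(\lambda^1,\dots,\lambda^{n-3})\in\mathbb{C}^{n-3}\mid \lambda^i\neq 0,1,\ \lambda^i\neq\lambda^j \text{ for } i\neq j\}$. For $\boldsymbol\lambda\in K_n$ put $z^{\boldsymbol\lambda}_1=0$, $z^{\boldsymbol\lambda}_2=1$, $z^{\boldsymbol\lambda}_3=\infty$, $z^{\boldsymbol\lambda}_{i+3}=\lambda^i$, $[\boldsymbol\lambda]=\{z^{\boldsymbol\lambda}_1,\dots,z^{\boldsymbol\lambda}_n\}$. For $\sigma\in S_n$, $f^{\boldsymbol\lambda}_\sigma$ is the unique LFT sending $z^{\boldsymbol\lambda}_{\sigma^{-1}(1)},z^{\boldsymbol\lambda}_{\sigma^{-1}(2)},z^{\boldsymbol\lambda}_{\sigma^{-1}(3)}$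 to $0,1,\infty$, and $g_\sigma(\boldsymbol\lambda)=(f^{\boldsymbol\lambda}_\sigma(z^{\boldsymbol\lambda}_{\sigma^{-1}(4)}),\dots,f^{\boldsymbol\lambda}_\sigma(z^{\boldsymbol\lambda}_{\sigma^{-1}(n)}))$. $G=\{g_\sigma\}$ is a group under composition, $G_{\boldsymbol\lambda}$ the stabilizer of $\boldsymbol\lambda$, and $\Phi_{\boldsymbol\lambda}:G_{\boldsymbol\lambda}\to\mathcal{A}_{[\boldsymbol\lambda]}$, $g_\sigma\mapsto f^{\boldsymbol\lambda}_\sigma$, is an isomorphism. $X_{\boldsymbol\lambda}$ is the representation of $G_{\boldsymbol\lambda}$ sending $g_\sigma$ to its Jacobian matrix at $\boldsymbol\lambda$. The multiplicity vector attached to $\alpha$ is that of any $\boldsymbol\lambda\in K_n$ with $[\boldsymbol\lambda]$ equivalent to $\alpha$; it is $(a_1,a_2,\dots)$ where $X_{\boldsymbol\lambda}\cong\bigoplus_ja_jX^{(j)}$ and the irreducible representations $X^{(j)}$ of $G_{\boldsymbol\lambda}$ are ordered as follows. (i) $G_{\boldsymbol\lambda}\simeq D_p$, $p$ odd: for $1\le l\le\frac{p-1}2$, $X^{(l)}$ is two-dimensional with character $2\cos\frac{2kl\pi}p$ on elements whose image under $\Phi_{\boldsymbol\lambda}$ is conjugate to a rotation of $\frac{2k\pi}p$ ($1\le k\le\frac{p-1}2$) and $0$ on elements of order two; $X^{(\frac{p+1}2)}$ is trivial; $X^{(\frac{p+3}2)}$ is one-dimensional with value $-1$ on elements of order two and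 $1$ elsewhere. (ii) $G_{\boldsymbol\lambda}\simeq\mathbb{Z}_p$ with $[\boldsymbol\lambda]$ equivalent to the union of $\{0\}$ and orbits in $\mathbb{C}^*$ of $\langle z\mapsto wz\rangle$, $w=e^{2\pi i/p}$: let $a$ be the index fixed by all $\sigma$ with $g_\sigma\in G_{\boldsymbol\lambda}$, $\psi$ an LFT with $\psi(z^{\boldsymbol\lambda}_a)=0$ and $\psi\Phi_{\boldsymbol\lambda}(G_{\boldsymbol\lambda})\psi^{-1}=\langle z\mapsto wz\rangle$, and $\rho\in G_{\boldsymbol\lambda}$ the element with $\psi\Phi_{\boldsymbol\lambda}(\rho)\psi^{-1}(z)=wz$; $X^{(l)}$ ($1\le l\le p$) is the one-dimensional representation with $X^{(l)}(\rho^k)=w^{kl}$. *)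

(* Defs.v *)
From HB Require Import structures.
From mathcomp Require Import all_boot all_order all_algebra.
From mathcomp Require Import all_fingroup all_solvable all_character.
From mathcomp Require Import complex.
From mathcomp Require Import all_classical all_reals all_analysis.
From mathcomp Require Import ring.

Set Implicit Arguments.
Unset Strict Implicit.
Unset Printing Implicit Defensive.

Import Order.TTheory GRing.Theory Num.Theory.
Import numFieldNormedType.Exports.

Local Open Scope classical_set_scope.
Local Open Scope ring_scope.

(* [None] is the point at infinity. *)
Notation sphere R := (option R[i]).

Section LFT.
Variable R : realType.
Local Notation C := R[i].
Local Notation S2 := (sphere R).

Definition lft (a b c d : C) (z : S2) : S2 :=
  match z with
  | Some z => if c * z + d == 0 then None else Some ((a * z + b) / (c * z + d))
  | None => if c == 0 then None else Some (a / c)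
  end.

Definition is_lft (f : S2 -> S2) : Prop :=
  exists a b c d : C, a * d - b * c != 0 /\ f = lft a b c d.

(* The two-sided inverse of a bijection. *)
Definition linv (f : S2 -> S2) : S2 -> S2 :=
  xget (id : S2 -> S2) [set g | cancel f g /\ cancel g f].

Definition equivalent (A B : set S2) : Prop :=
  exists psi, is_lft psi /\ psi @` A = B.

Definition autgrp (A : set S2) : set (S2 -> S2) :=
  [set f | is_lft f /\ f @` A = A].

(* [lft_gen gens] is the subgroup generated by a set [gens] of bijections. *)
Inductive lft_gen (gens : set (S2 -> S2)) : (S2 -> S2) -> Prop :=
| lft_gen_id : lft_gen gens id
| lft_gen_mem f of gens f : lft_gen gens f
| lft_gen_comp f g of lft_gen gens f & lft_gen gens g :
    lft_gen gens (f \o g)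
| lft_gen_inv f of lft_gen gens f : lft_gen gens (linv f).

(* psi^-1 H psi *)
Definition lft_conj (psi : S2 -> S2) (H : set (S2 -> S2)) : set (S2 -> S2) :=
  [set linv psi \o h \o psi | h in H].

(* The group [A] of bijections, under composition, is isomorphic to [H]. *)
Definition iso_fingroup (A : set (S2 -> S2)) (gT : finGroupType)
    (H : {group gT}) : Prop :=
  exists h : gT -> S2 -> S2,
    [/\ {in H &, injective h},
        h @` [set x | x \in H] = A
      & {in H &, forall x y, h (x * y)%g = h x \o h y}].

Definition cis (t : R) : C := Complex (cos t) (sin t).

(* e^(2 pi i / p) *)
Definition omega (p : nat) : C := cis (2 * pi / p%:R).

(* z |-> w z, used with w != 0 *)
Definition scaling (w : C) : S2 -> S2 := lft w 0 0 1.

(* z |-> 1 / z *)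
Definition inversion : S2 -> S2 := lft 0 1 1 0.

Definition hx (z : S2) : C := odflt 1 z.
Definition hy (z : S2) : C := if z is Some _ then 1 else 0.
Definition hproj (x y : C) : S2 := if y == 0 then None else Some (x / y).

Lemma lftE a b c d z :
  lft a b c d z = hproj (a * hx z + b * hy z) (c * hx z + d * hy z).
Proof. by case: z => [z|] /=; rewrite /hproj !(mulr1, mulr0, addr0). Qed.

Lemma hprojP x y : (x != 0) || (y != 0) ->
  exists2 k, k != 0 & x = k * hx (hproj x y) /\ y = k * hy (hproj x y).
Proof.
rewrite /hproj; have [-> /=|y0 _] := eqVneq y 0.
  by rewrite orbF => x0; exists x => //; rewrite mulr1 mulr0.
by exists y => //=; rewrite mulr1 mulrCA divff ?mulr1.
Qed.

Lemma hprojZ k x y : k != 0 -> hproj (k * x) (k * y) = hproj x y.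
Proof.
move=> k0; rewrite /hproj mulf_eq0 (negPf k0) /=; case: eqP => // /eqP y0.
by rewrite -mulf_div divff // mul1r.
Qed.

Lemma h_neq0 z : (hx z != 0) || (hy z != 0).
Proof. by case: z => [z|] /=; rewrite oner_eq0 ?orbT. Qed.

Lemma lft_comp a b c d a' b' c' d' : a' * d' - b' * c' != 0 ->
  lft a b c d \o lft a' b' c' d' =
  lft (a * a' + b * c') (a * b' + b * d') (c * a' + d * c') (c * b' + d * d').
Proof.
move=> D; apply: funext => z /=; rewrite !lftE.
set x := a' * _ + _; set y := c' * _ + _.
have xy0 : (x != 0) || (y != 0).
  apply/negPn; rewrite negb_or !negbK; apply/negP => /andP[/eqP x0 /eqP y0].
  have ex : (a' * d' - b' * c') * hx z = 0.
    transitivity (d' * x - b' * y); last by rewrite x0 y0; ring.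
    by rewrite /x /y; ring.
  have ey : (a' * d' - b' * c') * hy z = 0.
    transitivity (a' * y - c' * x); last by rewrite x0 y0; ring.
    by rewrite /x /y; ring.
  move: (h_neq0 z) ex ey => + /eqP + /eqP.
  by rewrite !mulf_eq0 (negPf D) /= => /orP[] /negPf->.
have [k k0 [xE yE]] := hprojP xy0.
rewrite -(hprojZ _ _ k0) !mulrDr ![k * (_ * _)]mulrCA -xE -yE /x /y.
by congr hproj; ring.
Qed.

Lemma lft_scal k z : k != 0 -> lft k 0 0 k z = z.
Proof.
move=> k0; rewrite lftE !mul0r addr0 add0r hprojZ // /hproj.
by case: z => [z|] /=; rewrite ?eqxx // oner_eq0 divr1.
Qed.

Lemma lftK a b c d : a * d - b * c != 0 ->
  cancel (lft a b c d) (lft d (- b) (- c) a).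
Proof.
move=> D z; rewrite -[LHS]/((lft d (- b) (- c) a \o lft a b c d) z) lft_comp //.
rewrite -[RHS](lft_scal _ D); congr (lft _ _ _ _ z); ring.
Qed.

Lemma is_lft_comp f g : is_lft f -> is_lft g -> is_lft (f \o g).
Proof.
move=> [a [b [c [d [D ->]]]]] [a' [b' [c' [d' [D' ->]]]]]; rewrite lft_comp //.
do 4!eexists; split; last by [].
have -> : forall x, x = (a * d - b * c) * (a' * d' - b' * c') -> x != 0.
  by move=> x ->; rewrite mulf_neq0.
by [].
by ring.
Qed.

Lemma is_lft_id : is_lft id.
Proof.
exists 1, 0, 0, 1; split; first by rewrite mulr1 mulr0 subr0 oner_eq0.
by apply: funext => z; rewrite lft_scal ?oner_eq0.
Qed.

Lemma is_lft_inv f : is_lft f ->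
  exists g, [/\ is_lft g, cancel f g & cancel g f].
Proof.
move=> [a [b [c [d [D ->]]]]].
have D' : d * a - - b * - c != 0 by rewrite mulrNN mulrC.
exists (lft d (- b) (- c) a); split; first by exists d, (- b), (- c), a.
  exact: lftK.
by have := lftK D'; rewrite !opprK.
Qed.

Lemma is_lft_linv f : is_lft f -> [/\ is_lft (linv f), cancel f (linv f) & cancel (linv f) f].
Proof.
move=> /is_lft_inv[g [Lg fK gK]].
have [/= fK' gK'] : [set g | cancel f g /\ cancel g f] (linv f).
  by apply: (xgetPex (id : S2 -> S2)); exists g.
suff -> : linv f = g by [].
by apply: funext => z; rewrite -{1}(gK z) fK'.
Qed.

Lemma is_lft_to01oo (p q r : S2) : p != q -> p != r -> q != r ->
  exists f, [/\ is_lft f, f p = Some 0, f q = Some 1 & f r = None].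
Proof.
pose D (u v : S2) : C := hx u * hy v - hx v * hy u.
have D0 u v : u != v -> D u v != 0.
  rewrite /D; case: u v => [u|] [v|] //=; rewrite ?(mulr1, mul1r, mulr0, mul0r).
  - by move=> uv; rewrite subr_eq0; apply: contra uv => /eqP->.
  - by rewrite sub0r oppr_eq0 oner_eq0.
  - by rewrite subr0 oner_eq0.
move=> /D0 pq /D0 pr /D0 qr.
have qp : D q p != 0 by rewrite -oppr_eq0 opprB.
exists (lft (D q r * hy p) (- D q r * hx p) (D q p * hy r) (- D q p * hx r)).
split.
- do 4!eexists; split; last by [].
  rewrite (_ : _ - _ = D q r * D q p * D p r); last by rewrite /D; ring.
  by rewrite !mulf_neq0.
- rewrite lftE /hproj.
  rewrite (_ : D q p * _ * _ + _ = D q p * D p r); last by rewrite /D; ring.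
  rewrite (_ : D q r * _ * _ + _ = 0); last by rewrite /D; ring.
  by rewrite mulf_eq0 (negPf qp) (negPf pr) mul0r.
- rewrite lftE /hproj.
  rewrite (_ : D q p * _ * _ + _ = D q r * D q p); last by rewrite /D; ring.
  rewrite (_ : D q r * _ * _ + _ = D q r * D q p); last by rewrite /D; ring.
  by rewrite mulf_eq0 (negPf qp) (negPf qr) divff // mulf_neq0.
- rewrite lftE /hproj.
  rewrite (_ : D q p * _ * _ + _ = 0); last by rewrite /D; ring.
  by rewrite eqxx.
Qed.

Lemma lft_fix01oo f : is_lft f ->
  f (Some 0) = Some 0 -> f (Some 1) = Some 1 -> f None = None -> f = id.
Proof.
move=> [a [b [c [d [D ->]]]]] /=; rewrite !mulr0 !mulr1 !add0r.
have [d0|d0] := eqVneq d 0; first by [].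
move=> [/eqP]; rewrite mulf_eq0 invr_eq0 (negPf d0) orbF => /eqP b0.
have [c0|c0] := eqVneq c 0; last by [].
rewrite b0 c0 add0r addr0 (negPf d0) => -[/eqP].
rewrite -subr_eq0 -[1](divff d0) -mulrBl mulf_eq0 invr_eq0 (negPf d0) orbF.
by rewrite subr_eq0 => /eqP-> _; apply: funext => z; rewrite lft_scal.
Qed.

Lemma is_lft_uniq (p q r : S2) f g : is_lft f -> is_lft g ->
  f p = Some 0 -> f q = Some 1 -> f r = None ->
  g p = Some 0 -> g q = Some 1 -> g r = None -> f = g.
Proof.
move=> Lf /is_lft_inv[h [Lh gK hK]] fp fq fr gp gq gr.
have fh : f \o h = id.
  apply: lft_fix01oo; first exact: is_lft_comp.
  - by rewrite -gp /= gK fp gp.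
  - by rewrite -gq /= gK fq gq.
  - by rewrite -gr /= gK fr gr.
by apply: funext => z; rewrite -[z in LHS]gK -[LHS]/((f \o h) (g z)) fh.
Qed.

End LFT.

Section Moduli.
Variable R : realType.
Local Notation C := R[i].
Local Notation S2 := (sphere R).

Definition K5 : set 'rV[C]_2 :=
  [set l | (forall i, l 0 i != 0 /\ l 0 i != 1) /\
           (forall i j, i != j -> l 0 i != l 0 j)].

(* z_(i+1)^l, the indices being numbered from 0. *)
Definition zpt (l : 'rV[C]_2) (i : 'I_5) : S2 :=
  nth None [:: Some 0; Some 1; None; Some (l 0 0); Some (l 0 1)] i.

Definition zset (l : 'rV[C]_2) : set S2 := range (zpt l).

(* In {perm 'I_5}, [(s * t) i] is [t (s i)]. *)
Definition flft (l : 'rV[C]_2) (s : {perm 'I_5}) : S2 -> S2 :=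
  xget (id : S2 -> S2) [set f | [/\ is_lft f,
    f (zpt l ((s^-1)%g (inord 0))) = Some 0,
    f (zpt l ((s^-1)%g (inord 1))) = Some 1 &
    f (zpt l ((s^-1)%g (inord 2))) = None]].

(* The map g_s of K5 to itself, extended by the identity outside the open set
   K5 so that composition of the [gmap s] is composition of the maps on K5. On
   K5 the value [flft l s _] is finite and [odflt] only removes [Some]. *)
Definition gmap (s : {perm 'I_5}) (l : 'rV[C]_2) : 'rV[C]_2 :=
  if pselect (K5 l) then
    \row_(j < 2) odflt 0 (flft l s (zpt l ((s^-1)%g (inord (3 + j)))))
  else l.

Lemma zpt_inj l : K5 l -> injective (zpt l).
Proof.
move=> [l01 lD].
have lD01 : l 0 0 != l 0 1 by apply: lD.
have [/eqP a0 /eqP a1] := l01 0; have [/eqP b0 /eqP b1] := l01 1.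
move/eqP in lD01.
have e01 : (0 : C) <> 1 by move/eqP; rewrite eq_sym oner_eq0.
move=> [[|[|[|[|[|//]]]]] Hi] [[|[|[|[|[|//]]]]] Hj];
  rewrite /zpt /= => E; apply/val_inj => //=; exfalso;
  try discriminate E; move: (congr1 (odflt 0) E) => {}E; simpl in E; first
  [ exact: e01 | exact: (e01 (esym E)) | exact: (a0 E) | exact: (a0 (esym E))
  | exact: (a1 E) | exact: (a1 (esym E)) | exact: (b0 E) | exact: (b0 (esym E))
  | exact: (b1 E) | exact: (b1 (esym E)) | exact: (lD01 E) | exact: (lD01 (esym E))].
Qed.

Lemma flftP l s : K5 l -> [/\ is_lft (flft l s),
    flft l s (zpt l ((s^-1)%g (inord 0))) = Some 0,
    flft l s (zpt l ((s^-1)%g (inord 1))) = Some 1 &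
    flft l s (zpt l ((s^-1)%g (inord 2))) = None].
Proof.
move=> Kl.
have ne (i j : nat) : (i < 5)%N -> (j < 5)%N -> i != j ->
    zpt l ((s^-1)%g (inord i)) != zpt l ((s^-1)%g (inord j)).
  move=> i5 j5; apply: contra_neq => /(zpt_inj Kl)/perm_inj/(congr1 val).
  by rewrite /= !inordK.
have [f [Lf f0 f1 f2]] := is_lft_to01oo (ne 0 1 isT isT isT)
  (ne 0 2 isT isT isT) (ne 1 2 isT isT isT).
pose P := [set f | [/\ is_lft f,
    f (zpt l ((s^-1)%g (inord 0))) = Some 0,
    f (zpt l ((s^-1)%g (inord 1))) = Some 1 &
    f (zpt l ((s^-1)%g (inord 2))) = None]].
by have /= := @xgetPex _ (id : S2 -> S2) P (ex_intro _ f (And4 Lf f0 f1 f2)).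
Qed.

Lemma is_lft_inj (f : S2 -> S2) : is_lft f -> injective f.
Proof. by case/is_lft_inv => g [_ fK _]; exact: can_inj fK. Qed.

Lemma zpt_gmap l s j : K5 l -> zpt (gmap s l) j = flft l s (zpt l ((s^-1)%g j)).
Proof.
move=> Kl; have [Lf f0 f1 f2] := flftP s Kl.
have fin (k : nat) : (k < 2)%N ->
    Some (odflt 0 (flft l s (zpt l ((s^-1)%g (inord (3 + k)))))) =
    flft l s (zpt l ((s^-1)%g (inord (3 + k)))).
  move=> k2; case E: (flft l s _) => [//|]; exfalso.
  move: E; rewrite -f2 => /(is_lft_inj Lf)/(zpt_inj Kl)/perm_inj.
  by move/(congr1 (@nat_of_ord 5)); rewrite !inordK // (ltn_add2l 3 k 2).
case: j => [[|[|[|[|[|//]]]]] Hj]; rewrite [LHS]/zpt [LHS]/= /gmap.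
- by rewrite -f0; congr (flft l s (zpt l (_ _))); apply/val_inj; rewrite /= inordK.
- by rewrite -f1; congr (flft l s (zpt l (_ _))); apply/val_inj; rewrite /= inordK.
- by rewrite -f2; congr (flft l s (zpt l (_ _))); apply/val_inj; rewrite /= inordK.
- case: pselect => [Kl'|//]; rewrite [X in Some X]mxE fin //.
  by congr (flft l s (zpt l (_ _))); apply/val_inj; rewrite /= inordK.
- case: pselect => [Kl'|//]; rewrite [X in Some X]mxE fin //.
  by congr (flft l s (zpt l (_ _))); apply/val_inj; rewrite /= inordK.
Qed.

Lemma zpt_injK l : injective (zpt l) -> K5 l.
Proof.
move=> inj.
have ne (i j : 'I_5) : val i != val j -> zpt l i != zpt l j.
  by move=> ij; apply: contra_neq ij => /inj->.
have Hl (k : nat) : (k < 2)%N -> (3 + k < 5)%N by move=> k2; rewrite (ltn_add2l 3 k 2).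
have zl (k : 'I_2) : zpt l (inord (3 + k)) = Some (l 0 k).
  rewrite /zpt inordK ?Hl //; case: k => [[|[|//]] k2] /=;
  by congr (Some (l 0 _)); apply/val_inj.
have z0 : zpt l (inord 0) = Some 0 by rewrite /zpt inordK.
have z1 : zpt l (inord 1) = Some 1 by rewrite /zpt inordK.
have Some_neq (x y : C) : Some x != Some y -> x != y.
  by apply: contra_neq => ->.
split=> [i|i j ij].
  split; apply: Some_neq; rewrite -zl; [rewrite -z0|rewrite -z1];
  by apply: ne; rewrite /= !inordK ?Hl.
apply: Some_neq; rewrite -!zl; apply: ne; rewrite /= !inordK ?Hl //.
Qed.

Lemma gmap_K5 l s : K5 l -> K5 (gmap s l).
Proof.
move=> Kl; apply: zpt_injK => i j; rewrite !zpt_gmap //.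
have [Lf _ _ _] := flftP s Kl.
by move=> /(is_lft_inj Lf)/(zpt_inj Kl)/perm_inj.
Qed.

Lemma gmap_out l s : ~ K5 l -> gmap s l = l.
Proof. by rewrite /gmap; case: pselect. Qed.

Lemma zpt_eq l l' : zpt l =1 zpt l' -> l = l'.
Proof.
move=> E; apply/rowP => -[[|[|//]] k2].
  have [] : Some (l 0 0) = Some (l' 0 0) := E (Ordinal (isT : 3 < 5)%N).
  by congr (l _ _ = l' _ _); apply/val_inj.
have [] : Some (l 0 1) = Some (l' 0 1) := E (Ordinal (isT : 4 < 5)%N).
by congr (l _ _ = l' _ _); apply/val_inj.
Qed.

Lemma flftM l s t : K5 l -> flft (gmap t l) s \o flft l t = flft l (t * s)%g.
Proof.
move=> Kl; have [Lf f0 f1 f2] := flftP t Kl.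
have [Lg g0 g1 g2] := flftP s (gmap_K5 t Kl).
have [Lh h0 h1 h2] := flftP (t * s)%g Kl.
rewrite !invMg !permM in h0 h1 h2.
apply: (is_lft_uniq (is_lft_comp Lg Lf) Lh _ _ _ h0 h1 h2) => /=.
- by rewrite -zpt_gmap.
- by rewrite -zpt_gmap.
- by rewrite -zpt_gmap.
Qed.

Lemma gmapM s t : gmap s \o gmap t = gmap (t * s)%g.
Proof.
apply: funext => l /=; have [Kl|Kl] := pselect (K5 l); last first.
  by rewrite !gmap_out // gmap_out.
apply: zpt_eq => j; rewrite !zpt_gmap //; last exact: gmap_K5.
by rewrite -flftM //= invMg permM.
Qed.

Lemma gmap1 : gmap 1%g = id.
Proof.
apply: funext => l; have [Kl|Kl] := pselect (K5 l); last by rewrite gmap_out.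
have [Lf f0 f1 f2] := flftP 1%g Kl.
rewrite invg1 !perm1 in f0 f1 f2.
have f_id : flft l 1%g = id.
  by apply: lft_fix01oo => //; [move: f0|move: f1|move: f2]; rewrite /zpt inordK.
by apply: zpt_eq => j; rewrite zpt_gmap // f_id invg1 perm1.
Qed.

End Moduli.

(* The group G = {g_s}, with x * y the composite map x \o y. *)
Definition Gtype (R : realType) : Type := seq_sub (codom (@gmap R)).
HB.instance Definition _ (R : realType) := Finite.on (Gtype R).

Section Group.
Variable R : realType.
Local Notation C := R[i].
Local Notation S2 := (sphere R).
Implicit Types x y : Gtype R.

Definition Gfun x : 'rV[C]_2 -> 'rV[C]_2 := ssval x.

Definition Gof (s : {perm 'I_5}) : Gtype R :=
  SeqSub (codom_f (@gmap R) s).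

(* Some s such that x = g_s. *)
Definition Gperm x : {perm 'I_5} := iinv (ssvalP x).

Lemma GpermK : cancel Gperm Gof.
Proof. by move=> x; apply: val_inj; rewrite /= /Gperm f_iinv. Qed.

Definition Gmul x y : Gtype R := Gof (Gperm y * Gperm x)%g.
Definition Gone : Gtype R := Gof 1%g.
Definition Ginv x : Gtype R := Gof (Gperm x)^-1%g.

Lemma GfunM x y : Gfun (Gmul x y) = Gfun x \o Gfun y.
Proof. by rewrite -[in RHS](GpermK x) -[in RHS](GpermK y) /= -gmapM. Qed.

Lemma Gfun1 : Gfun Gone = id. Proof. exact: gmap1. Qed.

Lemma Gfun_inj : injective Gfun. Proof. exact: val_inj. Qed.

Lemma GmulA : associative Gmul.
Proof. by move=> x y z; apply: Gfun_inj; rewrite !GfunM. Qed.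

Lemma Gmul1 : left_id Gone Gmul.
Proof. by move=> x; apply: Gfun_inj; rewrite GfunM Gfun1. Qed.

Lemma GmulV : left_inverse Gone Ginv Gmul.
Proof.
move=> x; apply: Gfun_inj; rewrite GfunM Gfun1 -{2}(GpermK x) /=.
by rewrite /Ginv /Gfun /= gmapM mulgV gmap1.
Qed.

End Group.

HB.instance Definition _ (R : realType) :=
  Finite_isGroup.Build (Gtype R) (@GmulA R) (@Gmul1 R) (@GmulV R).

Section Multiplicity.
Variable R : realType.
Local Notation C := R[i].
Local Notation S2 := (sphere R).
Implicit Type l : 'rV[C]_2.

Definition stab l : {set Gtype R} := [set x | Gfun x l == l]%SET.

Lemma stab_group_set l : group_set (stab l).
Proof.
apply/group_setP; split=> [|x y]; first by rewrite inE Gfun1.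
rewrite !inE => /eqP xl /eqP yl.
by rewrite -[(x * y)%g]/(Gmul x y) GfunM /= yl xl.
Qed.
Canonical stab_group l := Group (stab_group_set l).

Definition Phi l (x : Gtype R) : S2 -> S2 := flft l (Gperm x).

(* [jacobian] represents the differential acting on row vectors; the
   transpose is the matrix (d g_i / d l_j)_(i, j). *)
Definition Xmx l (x : Gtype R) : 'M[C]_2 := (jacobian (Gfun x) l)^T.

(* The map [Xmx l] is a representation of the stabilizer, isomorphic to
   the direct sum of a_j copies of X j, for j = 1, ..., size a. *)
Definition decomposes l (X : nat -> representation C (stab_group l))
    (a : seq nat) : Prop :=
  exists rX : mx_representation C (stab_group l) 2,
    {in stab_group l, rX =1 Xmx l} /\
    mx_rsim rX (\big[dadd_grepr/grepr0]_(j < size a)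
                  muln_grepr (X j.+1) (nth 0%N a j)).

Definition rotation (p k : nat) : S2 -> S2 :=
  scaling (cis (2 * pi * k%:R / p%:R)).

(* Case of a stabilizer isomorphic to the dihedral group of order 2p, p odd. *)
Definition mult_dihedral (p : nat) l (a : seq nat) : Prop :=
  [/\ odd p, (1 < p)%N,
      stab_group l \isog [set: dihedral_gtype p.*2]%G,
      size a = (p + 3)./2
    & exists X : nat -> representation C (stab_group l),
      [/\ forall j, (1 <= j <= (p + 3)./2)%N -> mx_irreducible (X j),
          forall j, (1 <= j <= (p - 1)./2)%N ->
            rdegree (X j) = 2%N /\
            forall x, x \in stab_group l ->
              (forall k psi, (1 <= k <= (p - 1)./2)%N -> is_lft psi ->
                 psi \o Phi l x \o linv psi = rotation p k ->
                 \tr (X j x) =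
                   (2 * cos (2 * k%:R * j%:R * pi / p%:R))%:C%C) /\
              (#[x]%g = 2%N -> \tr (X j x) = 0),
          rdegree (X ((p + 1)./2)) = 1%N /\
            (forall x, x \in stab_group l -> X ((p + 1)./2) x = 1%:M),
          rdegree (X ((p + 3)./2)) = 1%N /\
            (forall x, x \in stab_group l ->
               X ((p + 3)./2) x = (if #[x]%g == 2%N then -1 else 1)%:M)
        & decomposes X a]].

Definition cyclic_data (p : nat) l (i : 'I_5) (psi : S2 -> S2)
    (rho : Gtype R) : Prop :=
  [/\ forall s : {perm 'I_5}, gmap s l = l -> s i = i,
      is_lft psi,
      psi (zpt l i) = Some 0,
      [set psi \o Phi l x \o linv psi | x in [set x | x \in stab_group l]]
        = lft_gen [set scaling (omega R p)]
    & rho \in stab_group l /\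
      psi \o Phi l rho \o linv psi = scaling (omega R p)].

(* Case of a cyclic stabilizer of order p, the set [zset l] being equivalent
   to the union of {0} and of the orbits of the points of B in C^*. *)
Definition mult_cyclic (p : nat) l (a : seq nat) : Prop :=
  [/\ (1 < p)%N,
      stab_group l \isog Zp p,
      exists2 B : set C, ~ B 0 &
        equivalent (zset l)
          (Some 0 |` [set Some (omega R p ^+ k * b) | k in setT & b in B]),
      size a = p
    & (exists i psi rho, cyclic_data p l i psi rho) /\
      forall i psi rho, cyclic_data p l i psi rho ->
      exists X : nat -> representation C (stab_group l),
      [/\ forall j, (1 <= j <= p)%N -> mx_irreducible (X j),
          forall j, (1 <= j <= p)%N ->
            rdegree (X j) = 1%N /\
            forall k : nat, X j (rho ^+ k)%g = (omega R p ^+ (k * j))%:M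
        & decomposes X a]].

(* [a] is the multiplicity vector attached to the set A, where
   [mult l a] says that it is that of the point l of K5. *)
Definition mult_of (mult : 'rV[C]_2 -> seq nat -> Prop) (A : set S2)
    (a : seq nat) : Prop :=
  (exists2 l, K5 l & equivalent (zset l) A) /\
  forall l, K5 l -> equivalent (zset l) A -> mult l a.

End Multiplicity.

(* Main.v *)
Require Import Defs.
From mathcomp Require Import all_boot all_order all_algebra.
From mathcomp Require Import all_fingroup all_solvable all_character.
From mathcomp Require Import complex.
From mathcomp Require Import all_classical all_reals all_analysis.
From mathcomp Require Import ring.

Set Implicit Arguments.
Unset Strict Implicit.
Unset Printing Implicit Defensive.

Import Order.TTheory GRing.Theory Num.Theory.
Import numFieldNormedType.Exports.

Local Open Scope classical_set_scope.
Local Open Scope ring_scope.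

(** Everything rests on the configurations [symset a], that is
    [{0, 1, -1, a, -a}], which are invariant under the half-turn [z |-> - z]. If an
    automorphism [f] fixes [0], the sum of the reciprocals of the other four
    points forces it to be linear ([sym_fix0]), hence a half-turn, or a
    quarter-turn when [a ^+ 2 = - 1]. If [f] moves [0], the conjugate of the
    half-turn by [f] is a second involution, which fixes another point of the
    configuration, and its existence is one polynomial equation in [a]
    ([sym_move0]): either [a] solves [golden_eq], or [a ^+ 2] is [- 3] or
    [- 1 / 3].

    Seen from the point [1] in the coordinate [cayley], where the inversion
    [z |-> 1 / z] becomes the half-turn, the regular pentagon is [symset a] for a
    solution of [golden_eq], and the triangle with the two poles is [symset a]
    with [3 * a ^+ 2 = - 1]. The other solutions only differ from these by the sign of
    [a] or by [a |-> 1 / a], which do not change the configuration up to a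
    scaling. This settles the special values of [a] ([golden_pentagon],
    [equianharmonic_triangle]) and, as the stabilizer of the point [1] is then
    known, the automorphism groups of the pentagon and the triangle
    ([dihedral_model]). A non-trivial automorphism of any five points has a power
    that acts as a double transposition, a three-cycle or a five-cycle; in each
    case the configuration is one of the above ([automorphism_shape]).

    For the multiplicities, a point [l] of K5 is the list of cross-ratios
    ([modulus]) of any configuration obtained from [zset l] by an LFT, and the
    maps [gmap s] relabel the points of the configuration. The permutation is
    determined by the map ([gmap_inj]), so that [Phi l] is an isomorphism from
    the stabilizer to the automorphism group. Tangent vectors at [l] are
    represented by deformations of a model configuration
    ([deform]). An automorphism that carries one deformation to another one, up
    to a change of speed, gives the value of its differential on the
    corresponding tangent vectors ([tangent_jacobian], [Xmx_velocity]), without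
    any computation of a Jacobian matrix. Suitable deformations are
    eigenvectors of the rotations: moving the origin, with eigenvalue the
    multiplier [u] of the rotation; moving [z] in the direction of [z ^+ 3], with
    eigenvalue [u ^- 2]; and, in the presence of the inversion, the pair of
    deformations [rot_field j] and [rot_field (p - j)], with eigenvalues [u ^- j]
    and [u ^+ j], which the inversion exchanges up to sign. Here [j] is [2] for
    the pentagon and [1] for the triangle. That these tangent vectors do not
    vanish is checked on the derivative of one cross-ratio ([velocity_neq0]). *)

(** * Cross-ratios and linear fractional transformations *)

Arguments scaling : simpl never.
Arguments inversion : simpl never.

Section Sphere.
Variable R : realType.
Local Notation C := R[i].
Local Notation S2 := (sphere R).
Implicit Types (u v p q r x y : S2) (f g : S2 -> S2) (A B M : set S2).

(** The determinant of homogeneous coordinate vectors of the two points. *)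
Definition wedge u v : C := hx u * hy v - hx v * hy u.

Lemma wedge_eq0 u v : (wedge u v == 0) = (u == v).
Proof.
rewrite /wedge; case: u v => [u|] [v|] /=; rewrite ?(mulr1, mul1r, mulr0).
- by rewrite subr_eq0; apply/eqP/eqP => [->|[]].
- by rewrite sub0r oppr_eq0 oner_eq0.
- by rewrite subr0 oner_eq0.
- by rewrite subrr !eqxx.
Qed.

(** The cross-ratio normalised so that it is the image of [x] under the LFT
    sending [p], [q], [r] to [0], [1], [oo]. *)
Definition cr p q r x : C := (wedge q r * wedge x p) / (wedge q p * wedge x r).

Lemma cr_std (t : C) : cr (Some 0) (Some 1) None (Some t) = t.
Proof. by rewrite /cr /wedge /= !(mulr1, mulr0, sub0r, subr0, mul1r, mulN1r) divrNN divr1. Qed.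

(** Rescaling the homogeneous vectors does not matter: each of the four points
    occurs once above and once below the bar. *)
Lemma cr_hproj (p q r x p' q' r' x' : C) :
  (p != 0) || (p' != 0) -> (q != 0) || (q' != 0) ->
  (r != 0) || (r' != 0) -> (x != 0) || (x' != 0) ->
  cr (hproj p p') (hproj q q') (hproj r r') (hproj x x') =
  ((q * r' - r * q') * (x * p' - p * x')) / ((q * p' - p * q') * (x * r' - r * x')).
Proof.
move=> /hprojP[kp kp0 []] + + /hprojP[kq kq0 []] + + /hprojP[kr kr0 []] + +
  /hprojP[kx kx0 []].
rewrite /cr /wedge.
set P := hproj p p'; set Q := hproj q q'; set S := hproj r r'; set X := hproj x x'.
move=> -> -> -> -> -> -> -> ->.
set a := hx P; set a' := hy P; set b := hx Q; set b' := hy Q.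
set c := hx S; set c' := hy S; set d := hx X; set d' := hy X.
rewrite [RHS](_ : _ = ((kp * kq * kr * kx) * ((b * c' - c * b') * (d * a' - a * d'))) /
   ((kp * kq * kr * kx) * ((b * a' - a * b') * (d * c' - c * d')))); last first.
  by congr (_ / _); ring.
have k0 : kp * kq * kr * kx != 0 by rewrite !mulf_neq0.
by rewrite -[RHS]mulf_div divff // mul1r.
Qed.

Lemma lft_vec_neq0 (a b c d : C) u : a * d - b * c != 0 ->
  (a * hx u + b * hy u != 0) || (c * hx u + d * hy u != 0).
Proof.
move=> D; apply/negPn; rewrite negb_or !negbK; apply/negP => /andP[/eqP x0 /eqP y0].
have ex : (a * d - b * c) * hx u = 0.
  transitivity (d * (a * hx u + b * hy u) - b * (c * hx u + d * hy u)); first by ring.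
  by rewrite x0 y0; ring.
have ey : (a * d - b * c) * hy u = 0.
  transitivity (a * (c * hx u + d * hy u) - c * (a * hx u + b * hy u)); first by ring.
  by rewrite x0 y0; ring.
move: (h_neq0 u) ex ey => + /eqP + /eqP.
by rewrite !mulf_eq0 (negPf D) /= => /orP[] /negPf->.
Qed.

Lemma cr_lft f p q r x : is_lft f -> cr (f p) (f q) (f r) (f x) = cr p q r x.
Proof.
move=> [a [b [c [d [D ->]]]]]; rewrite !lftE cr_hproj ?lft_vec_neq0 // /cr /wedge.
set D' := a * d - b * c in D *.
rewrite [LHS](_ : _ = (D' ^+ 2 * ((hx q * hy r - hx r * hy q) *
   (hx x * hy p - hx p * hy x))) / (D' ^+ 2 * ((hx q * hy p - hx p * hy q) *
   (hx x * hy r - hx r * hy x)))); last by congr (_ / _); rewrite /D'; ring.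
by rewrite -[LHS]mulf_div divff ?mul1r // expf_neq0.
Qed.

Lemma lft_cr f p q r x : is_lft f -> f p = Some 0 -> f q = Some 1 ->
  f r = None -> x != r -> f x = Some (cr p q r x).
Proof.
move=> Lf fp fq fr xr; rewrite -(cr_lft _ _ _ _ Lf) fp fq fr.
case E: (f x) => [t|]; first by rewrite cr_std.
by move: xr; rewrite -(inj_eq (is_lft_inj Lf)) E fr eqxx.
Qed.

Lemma lft_eq3 f g p q r : is_lft f -> is_lft g -> p != q -> p != r -> q != r ->
  f p = g p -> f q = g q -> f r = g r -> f = g.
Proof.
move=> Lf Lg pq pr qr ep eq er.
have inj := is_lft_inj Lf.
have [h [Lh h0 h1 h2]] : exists h,
    [/\ is_lft h, h (f p) = Some 0, h (f q) = Some 1 & h (f r) = None].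
  by apply: is_lft_to01oo; rewrite inj_eq.
have E : h \o f = h \o g.
  apply: (@is_lft_uniq _ p q r) => //=; try exact: is_lft_comp.
  - by rewrite -ep.
  - by rewrite -eq.
  - by rewrite -er.
apply: funext => z; apply: (is_lft_inj Lh); exact: (congr1 (@^~ z) E).
Qed.

Lemma lft_id3 f p q r : is_lft f -> p != q -> p != r -> q != r ->
  f p = p -> f q = q -> f r = r -> f = id.
Proof. by move=> Lf pq pr qr ? ? ?; apply: (lft_eq3 Lf (is_lft_id R) pq pr qr). Qed.

Lemma scaling_Some (k z : C) : scaling k (Some z) = Some (k * z).
Proof.
by rewrite /scaling [LHS]/= mul0r add0r addr0 (negPf (oner_neq0 _)) divr1.
Qed.

Lemma scaling_None (k : C) : scaling k None = None :> S2.
Proof. by rewrite /scaling /= eqxx. Qed.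

Lemma inversion_Some (z : C) :
  inversion (Some z) = if z == 0 then None else Some z^-1.
Proof. by rewrite /inversion /= mul1r addr0 mul0r add0r div1r. Qed.

Lemma inversion_None : @inversion R None = Some 0.
Proof. by rewrite /inversion /= (negPf (oner_neq0 _)) mul0r. Qed.

Lemma is_lft_scaling (k : C) : k != 0 -> is_lft (scaling k).
Proof. by move=> k0; exists k, 0, 0, 1; split=> //; rewrite mulr1 mulr0 subr0. Qed.

Lemma is_lft_inversion : is_lft (@inversion R).
Proof.
by exists 0, 1, 1, 0; split=> //; rewrite mulr1 mulr0 sub0r oppr_eq0 oner_eq0.
Qed.

Lemma scalingM (k l : C) : scaling k \o scaling l = scaling (k * l).
Proof.
by apply: funext => -[z|] /=; rewrite !(scaling_None, scaling_Some) ?mulrA.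
Qed.

Lemma scaling1 : scaling (1 : C) = id.
Proof. by apply: funext => -[z|]; rewrite ?scaling_None ?scaling_Some ?mul1r. Qed.

Lemma scaling_inj (k l : C) : scaling k = scaling l -> k = l.
Proof.
by move/(congr1 (@^~ (Some 1))); rewrite !scaling_Some !mulr1 => -[].
Qed.

Lemma inversionK : involutive (@inversion R).
Proof.
move=> [z|]; last by rewrite inversion_None inversion_Some eqxx.
rewrite inversion_Some; case: eqVneq => [->|z0]; first exact: inversion_None.
by rewrite inversion_Some invr_eq0 (negPf z0) invrK.
Qed.

Lemma inversion_scaling (k : C) : k != 0 ->
  @inversion R \o scaling k = scaling k^-1 \o @inversion R.
Proof.
move=> k0; apply: funext => -[z|] /=; last by
  rewrite scaling_None inversion_None scaling_Some mulr0.
rewrite scaling_Some !inversion_Some mulf_eq0 (negPf k0) /=.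
by case: eqVneq => [_|z0]; rewrite ?scaling_None ?scaling_Some ?invfM.
Qed.

(** [f] agrees with a scaling at [0], [oo] and [1]. *)
Lemma lft_0oo f : is_lft f -> f (Some 0) = Some 0 -> f None = None ->
  exists2 k, k != 0 & f = scaling k.
Proof.
move=> Lf f0 fo.
case E: (f (Some 1)) => [k|]; last first.
  by have := is_lft_inj Lf (etrans E (esym fo)).
have k0 : k != 0.
  apply/eqP => k0; rewrite k0 -f0 in E.
  by have [/eqP] := is_lft_inj Lf E; rewrite oner_eq0.
exists k => //; apply: (@lft_eq3 _ _ (Some 0) (Some 1) None) => //.
- exact: is_lft_scaling.
- by apply/eqP => -[/eqP]; rewrite eq_sym oner_eq0.
- by rewrite f0 scaling_Some mulr0.
- by rewrite E scaling_Some mulr1.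
- by rewrite fo scaling_None.
Qed.

Lemma autgrp_lft M f : autgrp M f -> is_lft f. Proof. by case. Qed.

Lemma autgrp_comp M f g : autgrp M f -> autgrp M g -> autgrp M (f \o g).
Proof.
move=> [Lf fM] [Lg gM]; split; first exact: is_lft_comp.
by rewrite -image_comp gM.
Qed.

Lemma autgrp_linv M f : autgrp M f -> autgrp M (linv f).
Proof.
move=> [Lf fM]; have [Lg fK gK] := is_lft_linv Lf; split=> //.
rewrite -{1}fM image_comp (_ : _ \o _ = id) ?image_id //.
by apply: funext => z /=; rewrite fK.
Qed.

Lemma autgrp_id M : autgrp M id.
Proof. by split; [exact: is_lft_id|rewrite image_id]. Qed.

Lemma autgrp_mem M f z : autgrp M f -> M z -> M (f z).
Proof. by move=> [_ fM] Mz; rewrite -fM; exists z. Qed.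

Lemma autgrp_gen M (gens : set (S2 -> S2)) :
  gens `<=` autgrp M -> lft_gen gens `<=` autgrp M.
Proof.
move=> gM f; elim=> [|g /gM//|g h _ Mg _ Mh|g _ Mg].
- exact: autgrp_id.
- exact: autgrp_comp.
- exact: autgrp_linv.
Qed.

Lemma autgrp_conj psi A M : is_lft psi -> psi @` A = M ->
  autgrp A = lft_conj psi (autgrp M).
Proof.
move=> Lpsi <-; have [Lphi K K'] := is_lft_linv Lpsi.
have KA : linv psi \o psi = id by apply: funext => z /=; rewrite K.
apply/seteqP; split=> [f [Lf fA]|_ [h [Lh hM] <-]].
  exists (psi \o f \o linv psi).
    split; first by apply: is_lft_comp => //; apply: is_lft_comp.
    rewrite (image_comp psi) (_ : _ \o psi = psi \o f); last first.
      by apply: funext => z; rewrite /= K.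
    by rewrite -(image_comp f psi) fA.
  by apply: funext => z /=; rewrite !K.
split; first by apply: is_lft_comp => //; apply: is_lft_comp.
rewrite -(image_comp psi (linv psi \o h)) -(image_comp h) hM.
by rewrite image_comp KA image_id.
Qed.

Lemma autgrp_conjP psi A M f : is_lft psi -> psi @` A = M ->
  autgrp A f -> autgrp M (psi \o f \o linv psi).
Proof.
move=> Lpsi E; rewrite (autgrp_conj Lpsi E) => -[h Mh <-].
have [_ K K'] := is_lft_linv Lpsi.
by rewrite (_ : _ \o _ = h) //; apply: funext => z /=; rewrite !K'.
Qed.

End Sphere.

(** * Configurations invariant under a half-turn *)

Section Symmetric.
Variable R : realType.
Local Notation C := R[i].
Local Notation S2 := (sphere R).
Implicit Types (a k t : C) (f g : S2 -> S2).

Definition symset a : set S2 :=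
  [set Some 0; Some 1; Some (- 1); Some a; Some (- a)].

Definition generic a := [/\ a <> 0, a <> 1 & a <> - 1].

Lemma symsetP a (z : S2) :
  symset a z <-> exists2 t, t \in [:: 0; 1; - 1; a; - a] & z = Some t.
Proof.
rewrite /symset /=; split.
  by case=> [[[[]|]|]|] ->; [exists 0|exists 1|exists (- 1)|exists a|exists (- a)];
    rewrite // !inE eqxx ?orbT.
move=> [t]; rewrite !inE => /or4P[/eqP->|/eqP->|/eqP->|/orP[]/eqP->] ->; tauto.
Qed.

Lemma mem_symset a t : t \in [:: 0; 1; - 1; a; - a] -> symset a (Some t).
Proof. by move=> ta; apply/symsetP; exists t. Qed.

Lemma eqNr (x : C) : (- x == x) = (x == 0).
Proof. by rewrite eq_sym -subr_eq0 opprK -mulr2n mulrn_eq0. Qed.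

Lemma sym_uniq a : generic a -> uniq [:: 0; 1; - 1; a; - a].
Proof.
move=> [/eqP a0 /eqP a1 /eqP aN1].
have e1 : (1 : C) != 0 by rewrite oner_eq0.
have e2 : (- 1 : C) != 0 by rewrite oppr_eq0.
have e3 : - a != 0 by rewrite oppr_eq0.
have e4 : (- 1 : C) != 1 by rewrite eqNr.
have e5 : - a != 1 by rewrite eqr_oppLR.
have e6 : - a != - 1 by rewrite eqr_opp.
have e7 : - a != a by rewrite eqNr.
by rewrite /= !inE !negb_or; do !(apply/andP; split) => //; rewrite eq_sym.
Qed.

Lemma sym_scaling_N1 a : autgrp (symset a) (scaling (- 1)).
Proof.
have N1 z : symset a z -> symset a (scaling (- 1) z).
  move=> /symsetP[t + ->]; rewrite scaling_Some mulN1r => tS; apply: mem_symset.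
  by move: tS; rewrite !inE => /or4P[/eqP->|/eqP->|/eqP->|/orP[]/eqP->];
    rewrite ?oppr0 ?opprK eqxx ?orbT.
split; first by apply: is_lft_scaling; rewrite oppr_eq0 oner_eq0.
apply/seteqP; split=> [_ [z Sz <-]|z Sz]; first exact: N1.
exists (scaling (- 1) z); first exact: N1.
by rewrite -[LHS]/((scaling (- 1) \o scaling (- 1)) z) scalingM mulrNN mulr1 scaling1.
Qed.

(** The reciprocals of the four non-zero points add up to zero. Since
    [1 / f z] is [(c + d / z) / a], a map permuting these points and fixing
    the origin has [c = 0], that is, it is linear. *)
Lemma sym_fix0 a f : generic a -> autgrp (symset a) f -> f (Some 0) = Some 0 ->
  exists2 k, f = scaling k & k ^+ 2 = 1 \/ (a ^+ 2 = - 1 /\ k ^+ 4 = 1).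
Proof.
move=> ga fS f0; have := sym_uniq ga.
rewrite cons_uniq => /andP[s0 us]; set s := [:: 1; -1; a; - a] in s0 us.
have [[/eqP a0 /eqP a1 /eqP aN1] [Lf _]] := (ga, fS).
have finj := is_lft_inj Lf.
have [A [B [c [d [D fE]]]]] := Lf.
have [B0 d0] : B = 0 /\ d != 0.
  move: f0; rewrite fE /= !mulr0 !add0r; case: eqVneq => // d0 [] /eqP.
  by rewrite mulf_eq0 invr_eq0 (negPf d0) orbF => /eqP.
have A0 : A != 0 by apply: contraNneq D => ->; rewrite B0 !mul0r subrr.
have fs t : t \in s ->
    [/\ c * t + d != 0, f (Some t) = Some (A * t / (c * t + d))
      & A * t / (c * t + d) \in s].
  move=> ts; have t0 : t != 0 by apply: contraNneq s0 => <-.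
  have /symsetP[y] : symset a (f (Some t)).
    by apply: autgrp_mem fS _; apply: mem_symset; rewrite inE ts orbT.
  rewrite inE => /orP[/eqP->|ys].
    by rewrite -f0 => /finj[/eqP]; rewrite (negPf t0).
  rewrite fE /= B0 addr0; case: eqVneq => // ct [E]; split=> //.
  by rewrite E.
pose g t := A * t / (c * t + d).
have ginj : {in s &, injective g}.
  move=> x y /fs[_ fx _] /fs[_ fy _] gxy.
  suff [//] : Some x = Some y :> S2.
  by apply: finj; rewrite fx fy; congr Some.
have ps : perm_eq (map g s) s.
  have ugs : uniq (map g s) by rewrite map_inj_in_uniq.
  have sub : {subset map g s <= s} by move=> _ /mapP[t /fs[_ _ gt] ->].
  by apply: uniq_perm => //; case: (uniq_min_size ugs sub); rewrite ?size_map.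
have sum0 : \sum_(y <- s) y^-1 = 0.
  by rewrite /s !big_cons big_nil; field; rewrite a0.
have c0 : c = 0.
  move: sum0; rewrite -(perm_big _ ps) big_map.
  rewrite (eq_big_seq (fun t => A^-1 * (c + d * t^-1))); last first.
    move=> t ts; have [ct _ _] := fs t ts.
    have t0 : t != 0 by apply: contraNneq s0 => <-.
    by rewrite /g; field; rewrite t0 A0 ct.
  rewrite /s !big_cons big_nil /= invr1 !invrN invr1.
  rewrite (_ : _ + _ = 4 * (A^-1 * c)); last by ring.
  move/eqP; rewrite !mulf_eq0 pnatr_eq0 invr_eq0 (negPf A0) /=.
  by move/eqP.
pose k := A / d.
have fk : f = scaling k.
  by apply: funext => z; rewrite fE B0 c0 /scaling !lftE !mul0r !add0r !addr0
    -[RHS](hprojZ _ _ d0) /k; congr hproj; field.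
exists k => //.
have kz t : t \in s -> k * t \in s.
  by move=> /fs[_]; rewrite fk scaling_Some => -[->].
have k1 : k \in s by rewrite -[k]mulr1 kz // inE eqxx.
have ka : k * a \in s by apply: kz; rewrite !inE eqxx ?orbT.
have aa : a * a \in s -> a ^+ 2 = - 1.
  rewrite !inE -expr2 => /or4P[|/eqP//||].
  - by rewrite sqrf_eq1 (negPf a1) (negPf aN1).
  - rewrite -subr_eq0 (_ : _ - _ = a * (a - 1)); last by rewrite expr2; ring.
    by rewrite mulf_eq0 (negPf a0) subr_eq0 (negPf a1).
  - rewrite -subr_eq0 (_ : _ - _ = a * (a + 1)); last by rewrite expr2; ring.
    by rewrite mulf_eq0 (negPf a0) addr_eq0 (negPf aN1).
move: k1; rewrite !inE => /or4P[/eqP kE|/eqP kE|/eqP kE|/eqP kE].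
- by left; rewrite kE expr1n.
- by left; rewrite kE sqrrN expr1n.
- have a2 : a ^+ 2 = -1 by apply: aa; rewrite -{1}kE.
  by right; split; rewrite // kE (exprM a 2 2) a2 sqrrN expr1n.
- have a2 : a ^+ 2 = -1.
    apply: aa; move: ka; rewrite kE mulNr !inE.
    rewrite ![- _ == _]eqr_oppLR !opprK.
    by case/or4P => ->; rewrite ?orbT.
  by right; split; rewrite // kE (exprM (- a) 2 2) sqrrN a2 sqrrN expr1n.
Qed.

(** The equation whose roots are plus or minus [sqrt 5 + 2] and [sqrt 5 - 2]. *)
Definition golden_eq a := a ^+ 4 - 18 * a ^+ 2 + 1 = 0.

(** Conjugating the half-turn by [f] gives an involution [g] that fixes [1] and
    exchanges [0] with one of the other points. Exchanging [0] with [q] forces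
    trace zero, fixing [1] determines [g] from [q], and the images of the two
    remaining points give an equation for [a]. *)
Lemma sym_move01 a f : generic a -> autgrp (symset a) f -> f (Some 0) = Some 1 ->
  golden_eq a \/ 3 * a ^+ 2 = - 1.
Proof.
move=> ga fS f0; have us := sym_uniq ga.
have [[a0 a1 aN1] [Lf _]] := (ga, fS).
have n01 : (1 : C) <> 0 by move/eqP; rewrite oner_eq0.
have N11 : (-1 : C) <> 1 by move/eqP; rewrite eqNr oner_eq0.
have Na : - a <> a by move/eqP; rewrite eqNr => /eqP.
have [_ K K'] := is_lft_linv Lf.
pose g := f \o scaling (- 1) \o linv f.
have gS : autgrp (symset a) g.
  by apply: autgrp_comp (autgrp_linv fS); apply: autgrp_comp fS (sym_scaling_N1 a).
have gg z : g (g z) = z.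
  rewrite /g /= K -[scaling _ (scaling _ _)]/((scaling (- 1) \o scaling (- 1)) _).
  by rewrite scalingM mulrNN mulr1 scaling1 K'.
have g1 : g (Some 1) = Some 1.
  by rewrite -f0 /g /= K scaling_Some mulr0.
have gfix z : symset a z -> g z = z -> z = Some 1.
  move=> Sz gz; have /symsetP[t _ tE] := autgrp_mem (autgrp_linv fS) Sz.
  have : scaling (- 1) (linv f z) = linv f z by apply: (is_lft_inj Lf); rewrite K'.
  rewrite tE scaling_Some mulN1r => -[/eqP]; rewrite eqNr => /eqP t0.
  by rewrite -(K' z) tE t0.
have [Lg _] := gS; have ginj := is_lft_inj Lg.
have [A [B [c [d [D gE]]]]] := Lg.
have eqn x y : g (Some x) = Some y -> A * x + B = y * (c * x + d).
  rewrite gE /=; case: eqVneq => // cd [<-].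
  by rewrite divfK.
have e1 := eqn _ _ g1.
have d0 q : g (Some 0) = Some q -> d != 0.
  by rewrite gE /= mulr0 add0r; case: eqVneq.
have key q x y : q != 0 -> g (Some 0) = Some q -> g (Some x) = Some y ->
    q - x = y * ((q - 2) * x + 1).
  move=> q0 g0 gx; have := eqn _ _ g0; rewrite !mulr0 !add0r => BE.
  have gq : g (Some q) = Some 0 by rewrite -g0 gg.
  have /eqP := eqn _ _ gq; rewrite mul0r BE [q * d]mulrC -mulrDl mulf_eq0 (negPf q0) orbF addr_eq0 => /eqP AE.
  have cE : c = (q - 2) * d by move: e1; rewrite !mulr1 mul1r AE BE => e1;
    rewrite -[LHS](addrK d) -e1; ring.
  apply: (mulIf (d0 _ g0)).
  by have := eqn _ _ gx; rewrite AE BE cE => e; transitivity (- d * x + q * d); [ring|rewrite e; ring].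
have mem t : t \in [:: 0; 1; -1; a; - a] -> exists2 y,
    g (Some t) = Some y & y \in [:: 0; 1; -1; a; - a].
  move=> /mem_symset/(autgrp_mem gS)/symsetP[y ys gy]; by exists y.
have [q g0 qS] : exists2 q, g (Some 0) = Some q & q \in [:: 0; 1; -1; a; - a].
  by apply: mem; rewrite inE eqxx.
have gq : g (Some q) = Some 0 by rewrite -g0 gg.
have nfix t : t \in [:: 0; 1; -1; a; - a] -> g (Some t) = Some t -> t = 1.
  by move=> /mem_symset tS /(gfix _ tS)[].
move: qS; rewrite !inE => /or4P[/eqP qE|/eqP qE|/eqP qE|/orP[]/eqP qE]; subst q.
- by have := nfix 0; rewrite inE eqxx => /(_ isT g0) e; case: n01.
- by have /Some_inj e := ginj _ _ (etrans g0 (esym g1)); case: n01.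
- have [y gy] := mem a ltac:(by rewrite !inE eqxx ?orbT).
  rewrite !inE => /or4P[/eqP yE|/eqP yE|/eqP yE|/orP[]/eqP yE]; subst y.
  + by have /Some_inj := ginj _ _ (etrans gy (esym gq)).
  + by have /Some_inj := ginj _ _ (etrans gy (esym g1)).
  + by have /Some_inj := ginj _ _ (etrans gy (esym g0)).
  + by have := nfix a ltac:(by rewrite !inE eqxx ?orbT) gy.
  right; have := key _ _ _ _ g0 gy; rewrite oppr_eq0 oner_eq0 => /(_ isT) e.
  rewrite (_ : 3 * a ^+ 2 = - a * ((- 1 - 2) * a + 1) + a); last by ring.
  by rewrite -e; ring.
- have [y gy] := mem (- 1) ltac:(by rewrite !inE eqxx ?orbT).
  rewrite !inE => /or4P[/eqP yE|/eqP yE|/eqP yE|/orP[]/eqP yE]; subst y.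
  + by have /Some_inj/esym := ginj _ _ (etrans gy (esym gq)).
  + by have /Some_inj := ginj _ _ (etrans gy (esym g1)).
  + by have := nfix (- 1) ltac:(by rewrite !inE eqxx ?orbT) gy.
  + by have /Some_inj/eqP := ginj _ _ (etrans gy (esym g0)); rewrite oppr_eq0 => /eqP.
  left; have := key _ _ _ _ g0 gy; move/eqP: a0 => -> /(_ isT) e.
  have e' : a ^+ 2 = 4 * a + 1.
    apply/eqP; rewrite -subr_eq0; apply/eqP; move/eqP: e; rewrite -subr_eq0 => /eqP e.
    by rewrite -[RHS]oppr0 -[in RHS]e; ring.
  rewrite /golden_eq (exprM a 2 2) (_ : _ + _ = (a ^+ 2 - 4 * a - 1) * (a ^+ 2 + 4 * a - 1)); last by ring.
  by rewrite e'; ring.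
- have [y gy] := mem (- 1) ltac:(by rewrite !inE eqxx ?orbT).
  rewrite !inE => /or4P[/eqP yE|/eqP yE|/eqP yE|/orP[]/eqP yE]; subst y.
  + by have /Some_inj/oppr_inj/esym := ginj _ _ (etrans gy (esym gq)).
  + by have /Some_inj := ginj _ _ (etrans gy (esym g1)).
  + by have := nfix (- 1) ltac:(by rewrite !inE eqxx ?orbT) gy.
  2: by have /Some_inj/eqP := ginj _ _ (etrans gy (esym g0)); rewrite oppr_eq0 oner_eq0.
  left; have := key _ _ _ _ g0 gy; move/eqP: a0; rewrite oppr_eq0 => -> /(_ isT) e.
  have e' : a ^+ 2 = - 4 * a + 1.
    apply/eqP; rewrite -subr_eq0; apply/eqP; move/eqP: e; rewrite -subr_eq0 => /eqP e.
    by rewrite -[RHS]oppr0 -[in RHS]e; ring.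
  rewrite /golden_eq (exprM a 2 2) (_ : _ + _ = (a ^+ 2 - 4 * a - 1) * (a ^+ 2 + 4 * a - 1)); last by ring.
  by rewrite e'; ring.
Qed.

Lemma scaling_symset a k : k * a = 1 \/ k * a = - 1 ->
  scaling k @` symset a = symset k.
Proof.
move=> ka; have kaS : k * a \in [:: 0; 1; -1; k; - k] /\ - (k * a) \in [:: 0; 1; -1; k; - k].
  by case: ka => ->; split; rewrite ?opprK !inE eqxx ?orbT.
have [k0 a0] : k != 0 /\ a != 0.
  have : k * a != 0 by case: ka => ->; rewrite ?oppr_eq0 oner_eq0.
  by rewrite mulf_eq0 negb_or => /andP[].
apply/seteqP; split=> [_ [z /symsetP[t tS ->] <-]|z /symsetP[t tS ->]].
  rewrite scaling_Some; apply: mem_symset; rewrite !inE in tS.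
  case/or4P: tS => [/eqP->|/eqP->|/eqP->|/orP[]/eqP->];
    rewrite ?mulr0 ?mulrN ?mulr1; try by rewrite !inE eqxx ?orbT.
  - by case: kaS.
  - by case: kaS.
exists (Some (k^-1 * t)); last by rewrite scaling_Some mulVKf.
apply: mem_symset; move: tS; rewrite !inE.
have kiE : k^-1 = a \/ k^-1 = - a.
  case: ka => ka; [left|right]; apply: (mulfI k0); rewrite mulfV ?ka //.
  by rewrite mulrN ka opprK.
case/or4P => [/eqP->|/eqP->|/eqP->|/orP[]/eqP->].
- by rewrite mulr0 eqxx.
- by rewrite mulr1; case: kiE => ->; rewrite eqxx ?orbT.
- by rewrite mulrN1; case: kiE => ->; rewrite ?opprK eqxx ?orbT.
- by rewrite mulVf // eqxx ?orbT.
- by rewrite mulrN mulVf // eqxx ?orbT.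
Qed.

(** The case where [0] goes to [a] or [- a] reduces to the case where it goes to
    [1] or [- 1] after scaling by [a^-1]. *)
Lemma sym_move0 a f : generic a -> autgrp (symset a) f -> f (Some 0) <> Some 0 ->
  [\/ golden_eq a,
      3 * a ^+ 2 = - 1 /\ (f (Some 0) = Some 1 \/ f (Some 0) = Some (- 1)) |
      a ^+ 2 = - 3 /\ (f (Some 0) = Some a \/ f (Some 0) = Some (- a))].
Proof.
move=> ga fS f0; have [a0 a1 aN1] := ga.
have fN : autgrp (symset a) (scaling (- 1) \o f).
  exact: autgrp_comp (sym_scaling_N1 a) fS.
have S0 : symset a (Some 0) by apply: mem_symset; rewrite inE eqxx.
have /symsetP[t] := autgrp_mem fS S0.
have main b g : generic b -> autgrp (symset b) g ->
    g (Some 0) = Some 1 \/ g (Some 0) = Some (- 1) -> golden_eq b \/ 3 * b ^+ 2 = - 1.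
  move=> gb gS [g1|g1]; first exact: sym_move01 g1.
  apply: (sym_move01 gb (autgrp_comp (sym_scaling_N1 b) gS)).
  by rewrite /= g1 scaling_Some mulrNN mulr1.
rewrite !inE => /or4P[/eqP->|/eqP->|/eqP->|tE] ft //.
- by have [] := main a f ga fS (or_introl ft); [constructor 1|constructor 2; auto].
- by have [] := main a f ga fS (or_intror ft); [constructor 1|constructor 2; auto].
have ft' : f (Some 0) = Some a \/ f (Some 0) = Some (- a).
  by rewrite ft; case/orP: tE => /eqP->; auto.
have ai0 : a^-1 != 0 by rewrite invr_eq0; apply/eqP.
have aE : a^-1 * a = 1 by rewrite mulVf //; apply/eqP.
have gai : generic a^-1.
  by split; [apply/eqP|move/eqP; rewrite invr_eq1 => /eqP|
    move/(congr1 GRing.inv); rewrite invrK invrN invr1].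
have Ls := is_lft_scaling ai0.
have [_ K K'] := is_lft_linv Ls.
have := autgrp_conjP Ls (scaling_symset (or_introl aE)) fS.
set g := _ \o _ => gS.
have li0 : linv (scaling a^-1) (Some 0) = Some 0.
  by apply: (is_lft_inj Ls); rewrite K' scaling_Some mulr0.
have g0 : g (Some 0) = Some 1 \/ g (Some 0) = Some (- 1).
  rewrite /g /= li0; case: ft' => ->; rewrite scaling_Some ?mulrN aE; by auto.
have a0' : a != 0 by apply/eqP.
case: (main _ _ gai gS g0); rewrite /golden_eq => e.
  constructor 1; transitivity (a ^+ 4 * (a^-1 ^+ 4 - 18 * a^-1 ^+ 2 + 1)).
    by field.
  by rewrite e mulr0.
constructor 3; split=> //.
have : 3 * a^-1 ^+ 2 * a ^+ 2 = 3 by field; exact: a0'.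
by rewrite e => <-; ring.
Qed.

End Symmetric.

(** * The pentagon and the triangle *)

Section Models.
Variable R : realType.
Local Notation C := R[i].
Local Notation S2 := (sphere R).
Implicit Types (a t w u : C) (f g : S2 -> S2) (M : set S2).

Lemma cisD (s t : R) : cis s * cis t = cis (s + t).
Proof.
by rewrite /cis cosD sinD; simpc; rewrite [cos s * sin t + _]addrC.
Qed.

Lemma cis0 : cis (0 : R) = 1.
Proof. by rewrite /cis cos0 sin0. Qed.

Lemma cisX (t : R) n : cis t ^+ n = cis (t *+ n).
Proof.
elim: n => [|n IHn]; first by rewrite expr0 mulr0n cis0.
by rewrite exprS IHn cisD mulrS.
Qed.

Lemma cisDN (t : R) : cis t + cis (- t) = ((2 * cos t)%:C)%C.
Proof.
by rewrite /cis cosN sinN; simpc; congr Complex; rewrite mulr_natl mulr2n.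
Qed.

Lemma cisN (t : R) : cis (- t) = (cis t)^-1.
Proof.
have e : cis t * cis (- t) = 1 by rewrite cisD subrr cis0.
have t0 : cis t != 0 by apply: contraTneq (oner_neq0 C) => t0; rewrite -e t0 mul0r eqxx.
by apply: (mulfI t0); rewrite mulfV.
Qed.

Lemma omegaXp p : (0 < p)%N -> omega R p ^+ p = 1.
Proof.
move=> p0; rewrite /omega cisX -[_ *+ p]mulr_natr divfK ?pnatr_eq0 -?lt0n //.
by rewrite /cis mulr_natl cos2pi sin2pi.
Qed.

Lemma omega_neq1 p : (1 < p)%N -> omega R p != 1.
Proof.
move=> p1; apply/eqP => /(congr1 (@complex.Re R)) /= c1.
have p0 : (0 : R) < p%:R by rewrite ltr0n (ltn_trans _ p1).
have : 2 * pi / p%:R = 0 :> R.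
  apply: cos_inj; rewrite ?cos0 // ?in_itv /= ?lexx ?pi_ge0 //.
  rewrite divr_ge0 ?mulr_ge0 ?pi_ge0 ?(ltW p0) //=.
  by rewrite ler_pdivrMr // mulrC ler_wpM2l ?pi_ge0 // ler_nat.
by move/eqP; rewrite !mulf_eq0 invr_eq0 pnatr_eq0 /= !gt_eqF ?pi_gt0.
Qed.

Lemma omega_prim p : prime p -> p.-primitive_root (omega R p).
Proof.
move=> pp; have p1 := prime_gt1 pp.
have [m wm mp] := prim_order_exists (prime_gt0 pp) (omegaXp (prime_gt0 pp)).
have /primeP[_ /(_ m mp)/orP[/eqP m1|/eqP mE]] := pp; last by rewrite -{1}mE.
have := prim_expr_order wm; rewrite m1 expr1 => /eqP.
by rewrite (negPf (omega_neq1 p1)).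
Qed.

Lemma omega2 : omega R 2 = - 1.
Proof.
rewrite /omega (_ : 2 * pi / 2%:R = pi) ?/cis ?cospi ?sinpi; last by field.
by apply/eqP; rewrite eq_complex /= oppr0 !eqxx.
Qed.

Lemma omega4 : omega R 4 = Complex 0 1.
Proof.
rewrite /omega (_ : 2 * pi / 4%:R = pi / 2); last by field.
by rewrite /cis cos_pihalf sin_pihalf.
Qed.

Lemma imaginary_sqr : (Complex 0 1 : C) ^+ 2 = - 1.
Proof. by rewrite -omega2 -omega4 /omega cisX; congr cis; field. Qed.

Lemma autgrp_iter M f n : is_lft f -> (forall z, M z -> M (f z)) ->
  iter n.+1 f =1 id -> autgrp M f.
Proof.
move=> Lf fM fn; split=> //; apply/seteqP; split=> [_ [z Mz <-]|z Mz]; first exact: fM.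
exists (iter n f z); last exact: fn.
by elim: n {fn} => //= n; apply: fM.
Qed.

Lemma scalingX u n : iter n (scaling u) = scaling (u ^+ n) :> (S2 -> S2).
Proof.
elim: n => [|n IHn]; first by rewrite expr0 scaling1.
by rewrite exprS -scalingM -IHn.
Qed.

Lemma lft_gen_iter gens f n : lft_gen gens f -> lft_gen gens (@iter S2 n f).
Proof.
by move=> gf; elim: n => [|n]; [apply: lft_gen_id|apply: lft_gen_comp].
Qed.

(** Composing with a power of the rotation, one may assume that [f] fixes the
    point [1]. In a coordinate [chi] centred at this point the configuration is
    [symset a] and the inversion is the half-turn, so that the automorphisms
    fixing [1] are those found in [sym_fix0]. *)
Lemma dihedral_model p w M chi a f : w ^+ p = 1 -> (0 < p)%N ->
  autgrp M (scaling w) -> is_lft chi -> chi @` M = symset a ->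
  chi (Some 1) = Some 0 ->
  chi \o @inversion R = scaling (- 1) \o chi -> generic a -> a ^+ 2 <> - 1 ->
  autgrp M f -> (exists k, f (Some 1) = Some (w ^+ k)) ->
  exists k, f = iter k (scaling w) \/ f = iter k (scaling w) \o @inversion R.
Proof.
move=> wp p0 Mw Lchi chiM chi1 chiV ga aI Mf [k f1]; exists k.
pose m := (p.-1 * k)%N.
have km : w ^+ m * w ^+ k = 1.
  by rewrite -exprD /m -[in X in (_ + X)%N](mul1n k) -mulnDl addn1 prednK //
    exprM wp expr1n.
have mk : w ^+ k * w ^+ m = 1 by rewrite mulrC.
pose g := iter m (scaling w) \o f.
have fE : f = iter k (scaling w) \o g.
  apply: funext => z /=; rewrite -[RHS]/((iter k (scaling w) \o (iter m (scaling w))) (f z)).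
  by rewrite !scalingX scalingM mk scaling1.
have Mg : autgrp M g.
  apply: autgrp_comp Mf; elim: m {km mk g fE} => [|n IHn]; first exact: autgrp_id.
  exact: (autgrp_comp Mw IHn).
have g1 : g (Some 1) = Some 1 by rewrite /g /= f1 scalingX scaling_Some km.
have [_ K K'] := is_lft_linv Lchi.
have chi0 : linv chi (Some 0) = Some 1 by rewrite -chi1 K.
have gE : chi \o g = (chi \o g \o linv chi) \o chi by apply: funext => z /=; rewrite K.
have [|c] := sym_fix0 ga (autgrp_conjP Lchi chiM Mg); first by rewrite /= chi0 g1 chi1.
move=> gc [c2|[]//]; rewrite gc in gE.
have /orP[/eqP c1|/eqP c1] : (c == 1) || (c == - 1) by rewrite -sqrf_eq1 c2.
  left; rewrite fE; rewrite c1 scaling1 in gE.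
  suff -> : g = id by [].
  by apply: funext => z; apply: (is_lft_inj Lchi); apply: (congr1 (@^~ z) gE).
right; rewrite fE; rewrite c1 -chiV in gE; congr (_ \o _).
by apply: funext => z; apply: (is_lft_inj Lchi); apply: (congr1 (@^~ z) gE).
Qed.

Lemma dihedral_gens w M :
  autgrp M (scaling w) -> autgrp M (@inversion R) ->
  (forall f, autgrp M f -> exists k,
     f = iter k (scaling w) \/ f = iter k (scaling w) \o @inversion R) ->
  autgrp M = lft_gen [set scaling w; @inversion R].
Proof.
move=> Mw MV Mf; apply/seteqP; split; last first.
  by apply: autgrp_gen => f [] ->.
have gw : lft_gen [set scaling w; @inversion R] (scaling w).
  by apply: lft_gen_mem; left.
move=> f /Mf[k [] ->]; first exact: lft_gen_iter.
by apply: lft_gen_comp; [exact: lft_gen_iter|apply: lft_gen_mem; right].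
Qed.

(** The multiple of the Cayley transform [z |-> (z - 1) / (z + 1)] that sends [1]
    to [0] and [w] to [1]; the inversion becomes a half-turn in this coordinate. *)
Definition cayley w : S2 -> S2 := lft (w + 1) (- (w + 1)) (w - 1) (w - 1).

Section Cayley.
Variable w : C.
Hypotheses (w1 : w != 1) (wN1 : w != - 1).

Let wm : w - 1 != 0. Proof. by rewrite subr_eq0. Qed.
Let wp : w + 1 != 0. Proof. by rewrite addr_eq0. Qed.

Lemma is_lft_cayley : is_lft (cayley w).
Proof.
exists (w + 1), (- (w + 1)), (w - 1), (w - 1); split=> //.
rewrite (_ : _ - _ = 2 * ((w + 1) * (w - 1))); last by ring.
by rewrite !mulf_neq0 // pnatr_eq0.
Qed.

Lemma cayley_Some t : t != - 1 ->
  cayley w (Some t) = Some ((w + 1) * (t - 1) / ((w - 1) * (t + 1))).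
Proof.
move=> tN1; rewrite /cayley /=.
rewrite (_ : (w - 1) * t + _ = (w - 1) * (t + 1)); last by ring.
rewrite mulf_eq0 (negPf wm) addr_eq0 (negPf tN1) /=.
by congr Some; congr (_ / _); ring.
Qed.

Lemma cayley_None : cayley w None = Some ((w + 1) / (w - 1)).
Proof. by rewrite /cayley /= (negPf wm). Qed.

Lemma cayley1 : cayley w (Some 1) = Some 0.
Proof. by rewrite cayley_Some ?[1 == _]eq_sym ?eqNr ?oner_eq0 // subrr mulr0 mul0r. Qed.

Lemma cayley_w : cayley w (Some w) = Some 1.
Proof. by rewrite cayley_Some // [X in X / _]mulrC divff // mulf_neq0. Qed.

Lemma cayley_inversion : cayley w \o @inversion R = scaling (- 1) \o cayley w.
Proof.
rewrite /cayley /inversion /scaling !lft_comp.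
- by congr lft; ring.
- rewrite (_ : _ - _ = 2 * ((w + 1) * (w - 1))); last by ring.
  by rewrite !mulf_neq0 // pnatr_eq0.
- by rewrite mulr0 mulr1 sub0r oppr_eq0 oner_eq0.
Qed.

Lemma cayleyV t : t != 0 -> cayley w (Some t^-1) = scaling (- 1) (cayley w (Some t)).
Proof.
move=> t0; have := congr1 (@^~ (Some t)) cayley_inversion.
by rewrite /= inversion_Some (negPf t0).
Qed.

End Cayley.

Local Notation w5 := (omega R 5).
Local Notation w3 := (omega R 3).

Definition pentagon : set S2 :=
  [set Some 1; Some w5; Some (w5 ^+ 2); Some (w5 ^+ 3); Some (w5 ^+ 4)].
Definition triangle : set S2 :=
  [set Some 0; None; Some 1; Some w3; Some (w3 ^+ 2)].

Lemma omega_neqN1 p : odd p -> omega R p != - 1.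
Proof.
move=> op; apply/eqP => e; have := omegaXp (odd_gt0 op).
rewrite e -signr_odd op expr1 => /eqP.
by rewrite eqNr oner_eq0.
Qed.

Lemma sum_roots (w : C) n : w ^+ n = 1 -> w != 1 -> \sum_(i < n) w ^+ i = 0.
Proof.
move=> wn w1; have := subrX1 w n; rewrite wn subrr => /esym/eqP.
by rewrite mulf_eq0 subr_eq0 (negPf w1) => /eqP.
Qed.

Lemma w5_sum : 1 + w5 + w5 ^+ 2 + w5 ^+ 3 + w5 ^+ 4 = 0.
Proof.
have := sum_roots (omegaXp (isT : 0 < 5)%N) (omega_neq1 (isT : 1 < 5)%N).
by rewrite !big_ord_recr big_ord0 /= add0r expr0 expr1.
Qed.

Lemma w3_sum : 1 + w3 + w3 ^+ 2 = 0.
Proof.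
have := sum_roots (omegaXp (isT : 0 < 3)%N) (omega_neq1 (isT : 1 < 3)%N).
by rewrite !big_ord_recr big_ord0 /= add0r expr0 expr1.
Qed.

Lemma omega_neq0 p : (0 < p)%N -> omega R p != 0.
Proof.
move=> p0; apply: contraTneq (oner_neq0 C) => e.
by rewrite -(omegaXp p0) e expr0n -leqn0 leqNgt p0 eqxx.
Qed.

Lemma image_set5 (f : S2 -> S2) (a b c d e : S2) :
  f @` [set a; b; c; d; e] = [set f a; f b; f c; f d; f e].
Proof. by rewrite !image_setU !image_set1. Qed.

(** The image of the square of [w5] under [cayley w5]. *)
Definition golden_point : C := (w5 + 1) ^+ 2 / (w5 ^+ 2 + 1).

Lemma w5_neq (i j : nat) : (i < 5)%N -> (j < 5)%N -> i != j -> w5 ^+ i != w5 ^+ j.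
Proof.
move=> i5 j5; apply: contraNneq => /eqP.
by rewrite (eq_prim_root_expr (omega_prim (isT : prime 5))) !modn_small.
Qed.

Lemma w5sq_neqN1 : w5 ^+ 2 != - 1.
Proof.
apply/eqP => e; have := w5_neq (isT : 4 < 5)%N (isT : 0 < 5)%N isT.
by rewrite (exprM _ 2 2) e sqrrN expr1n eqxx.
Qed.

Lemma cayley_pentagon : cayley w5 @` pentagon = symset golden_point.
Proof.
have w1 := omega_neq1 (isT : 1 < 5)%N; have wN1 := omega_neqN1 (isT : odd 5).
have w0 := omega_neq0 (isT : 0 < 5)%N.
have e4 : w5 ^+ 4 = w5^-1 by apply: (mulfI w0); rewrite -exprS omegaXp ?mulfV.
have e3 : w5 ^+ 3 = (w5 ^+ 2)^-1.
  by apply: (mulfI (expf_neq0 2 w0)); rewrite -exprD omegaXp ?mulfV ?expf_neq0.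
have h2 : cayley w5 (Some (w5 ^+ 2)) = Some golden_point.
  rewrite cayley_Some ?w5sq_neqN1 // /golden_point; congr Some; field.
  by rewrite subr_eq0 w1 addr_eq0 w5sq_neqN1.
rewrite image_set5 cayley1 // cayley_w // e3 e4 !cayleyV ?expf_neq0 //.
rewrite h2 cayley_w // !scaling_Some mulr1 mulN1r.
by apply/seteqP; split => z; rewrite /symset /=; tauto.
Qed.

Lemma golden_eq_point : golden_eq golden_point.
Proof.
have d0 : w5 ^+ 2 + 1 != 0 by rewrite addr_eq0 w5sq_neqN1.
rewrite /golden_eq /golden_point; transitivity
  (((w5 + 1) ^+ 8 - 18 * (w5 + 1) ^+ 4 * (w5 ^+ 2 + 1) ^+ 2 + (w5 ^+ 2 + 1) ^+ 4)
    / (w5 ^+ 2 + 1) ^+ 4).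
  by field.
(* the numerator is a multiple of the fifth cyclotomic polynomial *)
rewrite (_ : _ + _ = - 16 * (1 + 3 * w5 + 3 * w5 ^+ 2 + 3 * w5 ^+ 3 + w5 ^+ 4) *
  (1 + w5 + w5 ^+ 2 + w5 ^+ 3 + w5 ^+ 4)); last by ring.
by rewrite w5_sum mulr0 mul0r.
Qed.

End Models.

(** * Automorphism groups of the model configurations *)

Section ModelGroups.
Variable R : realType.
Local Notation C := R[i].
Local Notation S2 := (sphere R).
Local Notation w5 := (omega R 5).
Local Notation w3 := (omega R 3).
Local Notation I := (Complex 0 1 : C).
Implicit Types (a b t w u : C) (f g : S2 -> S2) (M : set S2).

Lemma golden_sqr a c : golden_eq a -> a ^+ 2 = c -> c ^+ 2 - 18 * c + 1 = 0.
Proof. by rewrite /golden_eq => <- <-; rewrite -exprM. Qed.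

Lemma natr_pm_neq0 (x : C) (n : nat) : x = n.+1%:R \/ x = - n.+1%:R -> x <> 0.
Proof. by case=> -> /eqP; rewrite ?oppr_eq0 pnatr_eq0. Qed.

Lemma golden_generic a : golden_eq a -> generic a /\ a ^+ 2 <> - 1.
Proof.
move=> ga; have gs c := @golden_sqr a c ga; split; first split=> aE.
- by apply: (@natr_pm_neq0 _ 0 _ (gs 0 _)); [left; ring|rewrite aE; ring].
- by apply: (@natr_pm_neq0 _ 15 _ (gs 1 _)); [right; ring|rewrite aE; ring].
- by apply: (@natr_pm_neq0 _ 15 _ (gs 1 _)); [right; ring|rewrite aE; ring].
- by move=> /gs; apply: (@natr_pm_neq0 _ 19); left; ring.
Qed.

(** The image of [oo] under [cayley w3]; that of [0] is its opposite. *)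
Definition triangle_point : C := (w3 + 1) / (w3 - 1).

Let w31 : w3 != 1. Proof. exact: omega_neq1. Qed.

Lemma triangle_point_sqr : 3 * triangle_point ^+ 2 = - 1.
Proof.
have d0 : w3 - 1 != 0 by rewrite subr_eq0.
apply: (mulIf (expf_neq0 2 d0)).
transitivity (3 * (w3 + 1) ^+ 2); first by rewrite /triangle_point; field.
apply/eqP; rewrite -subr_eq0; apply/eqP.
transitivity (4 * (1 + w3 + w3 ^+ 2)); last by rewrite w3_sum mulr0.
by ring.
Qed.

Lemma equianharmonic_sqr a (c : C) : 3 * a ^+ 2 = - 1 -> a ^+ 2 = c -> 3 * c + 1 = 0.
Proof. by move=> e <-; rewrite e addNr. Qed.

Lemma equianharmonic_generic a : 3 * a ^+ 2 = - 1 -> 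
  [/\ generic a, a ^+ 2 <> - 1, ~ golden_eq a & a ^+ 2 <> - 3].
Proof.
move=> ga; have gs c := @equianharmonic_sqr a c ga; split; first split=> aE.
- by apply: (@natr_pm_neq0 _ 0 _ (gs 0 _)); [left; ring|rewrite aE; ring].
- by apply: (@natr_pm_neq0 _ 3 _ (gs 1 _)); [left; ring|rewrite aE; ring].
- by apply: (@natr_pm_neq0 _ 3 _ (gs 1 _)); [left; ring|rewrite aE; ring].
- by move=> /gs; apply: (@natr_pm_neq0 _ 1); right; ring.
- move=> e; apply: (@natr_pm_neq0 (9 * (a ^+ 4 - 18 * a ^+ 2 + 1)) 63); last by rewrite e mulr0.
  left; transitivity ((3 * a ^+ 2) ^+ 2 - 54 * (3 * a ^+ 2) + 9); first by ring.
  by rewrite ga; ring.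
- by move=> /gs; apply: (@natr_pm_neq0 _ 7); right; ring.
Qed.

Lemma cayley_triangle : cayley w3 @` @triangle R = symset triangle_point.
Proof.
have wN1 := omega_neqN1 R (isT : odd 3).
have w0 := omega_neq0 R (isT : 0 < 3)%N.
have e2 : w3 ^+ 2 = w3^-1 by apply: (mulfI w0); rewrite -exprS omegaXp ?mulfV.
have c0 : cayley w3 (Some 0) = Some (- triangle_point).
  rewrite cayley_Some // ?[0 == _]eq_sym ?oppr_eq0 ?oner_eq0 //.
  by congr Some; rewrite /triangle_point; field; rewrite subr_eq0.
rewrite image_set5 cayley1 // cayley_w // e2 cayleyV // cayley_w // c0 cayley_None //.
rewrite scaling_Some mulr1.
by apply/seteqP; split => z; rewrite /symset /=; tauto.
Qed.

Lemma autgrp_involution M f : is_lft f -> (forall z, M z -> M (f z)) ->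
  involutive f -> autgrp M f.
Proof. by move=> Lf Mf ff; apply: (@autgrp_iter _ _ _ 1) => // z /=; rewrite ff. Qed.

Lemma autgrp_scaling M p u : (0 < p)%N -> u ^+ p = 1 ->
  (forall z, M z -> M (scaling u z)) -> autgrp M (scaling u).
Proof.
move=> p0 up Mu; apply: (@autgrp_iter _ _ _ p.-1) => //.
  apply: is_lft_scaling; apply: contraTneq (oner_neq0 C) => u0.
  by rewrite -up u0 expr0n -leqn0 leqNgt p0 eqxx.
by move=> z; rewrite prednK // scalingX up scaling1.
Qed.

Lemma inv_root w (i j : nat) : w ^+ (i + j) = 1 ->
  inversion (Some (w ^+ i)) = Some (w ^+ j).
Proof.
move=> e; have w0 : w ^+ i != 0.
  by apply: contraTneq (oner_neq0 C) => w0; rewrite -e exprD w0 mul0r eqxx.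
rewrite inversion_Some (negPf w0); congr Some; apply: (mulfI w0).
by rewrite mulfV // -exprD.
Qed.

Let w5p : w5 ^+ 5 = 1. Proof. exact: omegaXp. Qed.
Let w3p : w3 ^+ 3 = 1. Proof. exact: omegaXp. Qed.

Lemma pentagon_rotation : autgrp (@pentagon R) (scaling w5).
Proof.
apply: (autgrp_scaling (isT : 0 < 5)%N w5p) => z.
rewrite /pentagon /=; case=> [[[[]|]|]|] ->; rewrite scaling_Some -?exprS ?mulr1 ?w5p; tauto.
Qed.

Lemma pentagon_inversion : autgrp (@pentagon R) (@inversion R).
Proof.
apply: (autgrp_involution (is_lft_inversion R) _ (@inversionK R)) => z.
have w5e : w5 = w5 ^+ 1 by [].
rewrite /pentagon /=; case=> [[[[]|]|]|] ->.
- by rewrite (inv_root (expr0 w5 : w5 ^+ (0 + 0) = 1)); tauto.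
- by rewrite (inv_root (w5p : w5 ^+ (1 + 4) = 1)); tauto.
- by rewrite (inv_root (w5p : w5 ^+ (2 + 3) = 1)); tauto.
- by rewrite (inv_root (w5p : w5 ^+ (3 + 2) = 1)); tauto.
- by rewrite (inv_root (w5p : w5 ^+ (4 + 1) = 1)); tauto.
Qed.

Lemma triangle_rotation : autgrp (@triangle R) (scaling w3).
Proof.
apply: (autgrp_scaling (isT : 0 < 3)%N w3p) => z.
rewrite /triangle /=; case=> [[[[]|]|]|] ->;
  rewrite ?scaling_None ?scaling_Some -?exprS ?mulr1 ?mulr0 ?w3p; tauto.
Qed.

Lemma triangle_inversion : autgrp (@triangle R) (@inversion R).
Proof.
apply: (autgrp_involution (is_lft_inversion R) _ (@inversionK R)) => z.
rewrite /triangle /=; case=> [[[[]|]|]|] ->.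
- by rewrite inversion_Some eqxx; tauto.
- by rewrite inversion_None; tauto.
- by rewrite (inv_root (expr0 w3 : w3 ^+ (0 + 0) = 1)); tauto.
- by rewrite (inv_root (w3p : w3 ^+ (1 + 2) = 1)); tauto.
- by rewrite (inv_root (w3p : w3 ^+ (2 + 1) = 1)); tauto.
Qed.

Lemma pentagonP z : @pentagon R z -> exists2 k, (k < 5)%N & z = Some (w5 ^+ k).
Proof.
by rewrite /pentagon /=; case=> [[[[]|]|]|] ->; [exists 0%N|exists 1%N|exists 2%N|exists 3%N|exists 4%N].
Qed.

Lemma autgrp_pentagon f : autgrp (@pentagon R) f -> exists k,
  f = iter k (scaling w5) \/ f = iter k (scaling w5) \o @inversion R.
Proof.
have w1 := omega_neq1 R (isT : 1 < 5)%N; have wN1 := omega_neqN1 R (isT : odd 5).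
have [ga aI] := golden_generic (golden_eq_point R).
move=> Mf; apply: (dihedral_model w5p _ pentagon_rotation (is_lft_cayley w1 wN1)
  (cayley_pentagon R) (cayley1 w1) (cayley_inversion w1 wN1) ga aI Mf) => //.
have [|k _ fk] := @pentagonP (f (Some 1)); last by exists k.
by apply: autgrp_mem Mf _; rewrite /pentagon /=; tauto.
Qed.

(** The poles [0] and [oo] are not images of [1]: in the coordinate [cayley w3]
    they are [- triangle_point] and [triangle_point], and the equation satisfied
    by [triangle_point] leaves only [1] and [- 1] as possible images of the
    origin. *)
Lemma autgrp_triangle f : autgrp (@triangle R) f -> exists k,
  f = iter k (scaling w3) \/ f = iter k (scaling w3) \o @inversion R.
Proof.
have w1 := w31; have wN1 := omega_neqN1 R (isT : odd 3).
have [ga aI nga na3] := equianharmonic_generic triangle_point_sqr.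
have Lchi := is_lft_cayley w1 wN1; have chiM := cayley_triangle.
move=> Mf; apply: (dihedral_model w3p _ triangle_rotation Lchi
  chiM (cayley1 w1) (cayley_inversion w1 wN1) ga aI Mf) => //.
have Mf1 : @triangle R (f (Some 1)).
  by apply: autgrp_mem Mf _; rewrite /triangle /=; tauto.
suff f1 : f (Some 1) <> Some 0 /\ f (Some 1) <> None.
  case: f1 => f0 f1; move: Mf1; rewrite /triangle /=; case=> [[[[]|]|]|] //.
  - by exists 0%N.
  - by exists 1%N.
  - by exists 2%N.
have [_ K K'] := is_lft_linv Lchi.
have chi0 : linv (cayley w3) (Some 0) = Some 1 by rewrite -(cayley1 w1) K.
have main y : y = triangle_point \/ y = - triangle_point -> cayley w3 (f (Some 1)) <> Some y.
  move=> yE chif; have [a0 a1 aN1] := ga.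
  have [|//|[_]|[]//] := sym_move0 ga (autgrp_conjP Lchi chiM Mf).
    rewrite /= chi0 chif; case: yE => -> /Some_inj => [//|/eqP].
    by rewrite oppr_eq0 => /eqP.
  rewrite /= chi0 chif; case: yE => -> [] /Some_inj // /eqP; rewrite ?eqr_oppLR ?opprK => /eqP //.
split=> f1.
  apply: (main (- triangle_point)); first by right.
  rewrite f1 cayley_Some // ?[0 == _]eq_sym ?oppr_eq0 ?oner_eq0 //.
  by congr Some; rewrite /triangle_point; field; rewrite subr_eq0.
by apply: (main triangle_point); [left|rewrite f1 cayley_None].
Qed.

Lemma symset_sqr a b : a ^+ 2 = b ^+ 2 -> symset a = symset b.
Proof.
move/eqP; rewrite eqf_sqr => /orP[]/eqP -> //.
by rewrite /symset opprK; apply/seteqP; split => z /=; tauto.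
Qed.

Lemma equivalent_trans (A B D : set S2) : equivalent A B -> equivalent B D -> equivalent A D.
Proof.
move=> [f [Lf <-]] [g [Lg <-]]; exists (g \o f).
by split; [exact: is_lft_comp|rewrite image_comp].
Qed.

Lemma equivalent_sym (A B : set S2) : equivalent A B -> equivalent B A.
Proof.
move=> [f [Lf <-]]; have [Lg K K'] := is_lft_linv Lf.
exists (linv f); split=> //; rewrite image_comp (_ : linv f \o f = id) ?image_id //.
by apply: funext => z /=; rewrite K.
Qed.

Lemma equivalent_symV a : a != 0 -> equivalent (symset a) (symset a^-1).
Proof.
move=> a0; exists (scaling a^-1); split; first by apply: is_lft_scaling; rewrite invr_eq0.
by apply: scaling_symset; left; rewrite mulVf.
Qed.

(** The squares of the roots of [golden_eq] are two inverse numbers, so that all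
    roots are obtained from one of them by signs and inversion. *)
Lemma golden_pentagon a : golden_eq a -> equivalent (symset a) (@pentagon R).
Proof.
move=> ga; have w1 := omega_neq1 R (isT : 1 < 5)%N; have wN1 := omega_neqN1 R (isT : odd 5).
have g5 := golden_eq_point R; have [[/eqP a50 _ _] _] := golden_generic g5.
have e5 : equivalent (symset (golden_point R)) (@pentagon R).
  apply: equivalent_sym; exists (cayley w5); split; first exact: is_lft_cayley.
  exact: cayley_pentagon.
have : (a ^+ 2 - golden_point R ^+ 2) * (a ^+ 2 - (golden_point R)^-1 ^+ 2) = 0.
  have e (b : C) : golden_eq b -> b ^+ 2 * (18 - b ^+ 2) = 1.
    by rewrite /golden_eq => e; rewrite -[RHS]subr0 -[in RHS]e; ring.
  have -> : (golden_point R)^-1 ^+ 2 = 18 - golden_point R ^+ 2.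
    by rewrite exprVn; apply: (mulfI (expf_neq0 2 a50)); rewrite e // mulfV ?expf_neq0.
  have e0 : golden_point R ^+ 2 * (18 - golden_point R ^+ 2) - a ^+ 2 * (18 - a ^+ 2) = 0.
    by rewrite !e // subrr.
  by rewrite -e0; ring.
move/eqP; rewrite mulf_eq0 !subr_eq0 => /orP[]/eqP/symset_sqr -> //.
exact: equivalent_trans (equivalent_sym (equivalent_symV a50)) e5.
Qed.

(** The two equations are exchanged by [a |-> a^-1]. *)
Lemma equianharmonic_triangle a : 3 * a ^+ 2 = - 1 \/ a ^+ 2 = - 3 ->
  equivalent (symset a) (@triangle R).
Proof.
have w1 := w31; have wN1 := omega_neqN1 R (isT : odd 3).
have [[/eqP a30 _ _] _ _ _] := equianharmonic_generic triangle_point_sqr.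
have e3 : equivalent (symset triangle_point) (@triangle R).
  apply: equivalent_sym; exists (cayley w3); split; first exact: is_lft_cayley.
  exact: cayley_triangle.
have n3 : (3 : C) != 0 by rewrite pnatr_eq0.
case=> aE.
  by rewrite (symset_sqr (_ : _ = triangle_point ^+ 2)) //; apply: (mulfI n3); rewrite aE triangle_point_sqr.
apply: equivalent_trans e3; apply: equivalent_sym.
rewrite (symset_sqr (_ : a ^+ 2 = triangle_point^-1 ^+ 2)); first exact: equivalent_symV.
rewrite exprVn; apply: (mulIf (expf_neq0 2 a30)); rewrite mulVf ?expf_neq0 //.
by rewrite aE mulNr triangle_point_sqr opprK.
Qed.

Lemma autgrp_sym a f : generic a -> ~ golden_eq a -> 3 * a ^+ 2 <> - 1 ->
  a ^+ 2 <> - 3 -> autgrp (symset a) f ->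
  exists2 u, f = scaling u & u ^+ 2 = 1 \/ (a ^+ 2 = - 1 /\ u ^+ 4 = 1).
Proof.
move=> ga n1 n2 n3 fS; apply: sym_fix0 => //.
by apply: contrapT => f0; case: (sym_move0 ga fS f0) => // -[].
Qed.

Lemma autgrp_half_turn a f : generic a -> ~ golden_eq a -> 3 * a ^+ 2 <> - 1 ->
  a ^+ 2 <> - 3 -> a ^+ 2 <> - 1 -> autgrp (symset a) f ->
  exists2 u, f = scaling u & u ^+ 2 = 1.
Proof.
move=> ga n1 n2 n3 n4 fS; have [u fu [u2|[]//]] := autgrp_sym ga n1 n2 n3 fS.
by exists u.
Qed.

Lemma generic_I : generic I.
Proof. by split=> /(congr1 (@complex.Im R))/eqP; rewrite /= ?oppr0 oner_eq0. Qed.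

Lemma autgrp_square f : autgrp (symset I) f -> exists2 u, f = scaling u & u ^+ 4 = 1.
Proof.
have e := imaginary_sqr R.
move=> fS; have [|||u fu uE] := autgrp_sym generic_I _ _ _ fS.
- rewrite /golden_eq (exprM _ 2 2) e; apply: (@natr_pm_neq0 _ 19); left; ring.
- rewrite e => /eqP; rewrite -subr_eq0 => /eqP; apply: (@natr_pm_neq0 _ 1); right; ring.
- rewrite e => /eqP; rewrite -subr_eq0 => /eqP; apply: (@natr_pm_neq0 _ 1); left; ring.
exists u => //; case: uE => [u2|[]//].
by rewrite (exprM _ 2 2) u2 expr1n.
Qed.

Lemma square_rotation : autgrp (symset I) (scaling I).
Proof.
have e : I * I = - 1 by rewrite -imaginary_sqr.
apply: (@autgrp_scaling _ 4) => //; first by rewrite (exprM _ 2 2) imaginary_sqr sqrrN expr1n.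
move=> z; rewrite /symset /=; case=> [[[[]|]|]|] ->;
  rewrite scaling_Some ?mulr0 ?mulr1 ?mulrN ?mulr1 ?e ?opprK; tauto.
Qed.

Lemma cyclic_gens M u : (forall f, autgrp M f -> exists k, f = scaling (u ^+ k)) ->
  autgrp M (scaling u) -> autgrp M = lft_gen [set scaling u].
Proof.
move=> Mf Mu; apply/seteqP; split; last by apply: autgrp_gen => f ->.
by move=> f /Mf[k ->]; rewrite -scalingX; apply/lft_gen_iter/lft_gen_mem.
Qed.

Lemma root4 u : u ^+ 4 = 1 -> exists k, u = I ^+ k.
Proof.
move/eqP; rewrite (exprM _ 2 2) sqrf_eq1 -imaginary_sqr eqf_sqr sqrf_eq1.
have e := imaginary_sqr R.
case/orP => /orP[] /eqP ->; [exists 0%N|exists 2%N|exists 1%N|exists 3%N] => //.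
by rewrite exprS e mulrN1.
Qed.

End ModelGroups.

(** * Relabelling five points *)

Section Moduli.
Variable R : realType.
Local Notation C := R[i].
Local Notation S2 := (sphere R).
Implicit Types (f g : S2 -> S2) (c : 'I_5 -> S2) (l : 'rV[C]_2) (s t : {perm 'I_5}).

(** The point of K5 equivalent to five labelled points. *)
Definition modulus c : 'rV[C]_2 :=
  \row_(j < 2) cr (c (inord 0)) (c (inord 1)) (c (inord 2)) (c (inord (3 + j))).

Lemma ord5_cases (P : 'I_5 -> Prop) :
  P (inord 0) -> P (inord 1) -> P (inord 2) ->
  (forall j : 'I_2, P (inord (3 + j))) -> forall i, P i.
Proof.
move=> P0 P1 P2 P3 i.
have E k : (k < 5)%N -> val i = k -> i = inord k.
  by move=> k5 ik; apply: val_inj; rewrite /= inordK.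
case: i E => [[|[|[|[|[|//]]]]] Hi] E.
- by rewrite (E 0%N).
- by rewrite (E 1%N).
- by rewrite (E 2%N).
- by rewrite (E 3%N) //; apply: (P3 0).
- by rewrite (E 4%N) //; apply: (P3 1).
Qed.

Lemma zpt_inord l (j : 'I_2) : zpt l (inord (3 + j)) = Some (l 0 j).
Proof.
by rewrite /zpt inordK; case: j => [[|[|//]] k2] //=; congr (Some (l 0 _)); apply/val_inj.
Qed.

Lemma zpt0 l : zpt l (inord 0) = Some 0. Proof. by rewrite /zpt inordK. Qed.
Lemma zpt1 l : zpt l (inord 1) = Some 1. Proof. by rewrite /zpt inordK. Qed.
Lemma zpt2 l : zpt l (inord 2) = None. Proof. by rewrite /zpt inordK. Qed.

Lemma modulus_zpt l : modulus (zpt l) = l.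
Proof.
by apply/rowP => j; rewrite mxE zpt0 zpt1 zpt2 zpt_inord cr_std.
Qed.

Lemma modulus_lft f c : is_lft f -> modulus (f \o c) = modulus c.
Proof. by move=> Lf; apply/rowP => j; rewrite !mxE /= cr_lft. Qed.

Lemma inord5_inj (i j : nat) : (i < 5)%N -> (j < 5)%N -> i != j ->
  (inord i : 'I_5) != inord j.
Proof. by move=> i5 j5; apply: contra => /eqP/(congr1 val) /=; rewrite !inordK // => ->. Qed.

(** The LFT normalising the first three points sends the other two to their
    cross-ratios with them. *)
Lemma modulus_normal c : injective c ->
  exists2 f, is_lft f & zpt (modulus c) = f \o c.
Proof.
move=> cinj.
have ne (i j : nat) : (i < 5)%N -> (j < 5)%N -> i != j -> c (inord i) != c (inord j).
  by move=> i5 j5 ij; rewrite (inj_eq cinj) inord5_inj.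
have [f [Lf f0 f1 f2]] := is_lft_to01oo (ne 0 1 isT isT isT)%N
  (ne 0 2 isT isT isT)%N (ne 1 2 isT isT isT)%N.
exists f => //; apply: funext; apply: ord5_cases => [|||j] /=.
- by rewrite zpt0.
- by rewrite zpt1.
- by rewrite zpt2.
rewrite zpt_inord mxE (lft_cr Lf f0 f1 f2) //; apply: ne => //.
  by rewrite (ltn_add2l 3 j 2).
Qed.

Lemma modulus_K5 c : injective c -> K5 (modulus c).
Proof.
move=> cinj; have [f Lf fE] := modulus_normal cinj.
by apply: zpt_injK; rewrite fE; apply: inj_comp => //; apply: is_lft_inj.
Qed.

(** The normalising LFT in the definition of [gmap] does not change
    cross-ratios. *)
Lemma gmapE l s : K5 l -> gmap s l = modulus (zpt l \o (s^-1)%g).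
Proof.
move=> Kl; have [Lf _ _ _] := flftP s Kl.
rewrite -[LHS]modulus_zpt -[RHS](modulus_lft _ Lf); congr modulus.
by apply: funext => j; rewrite zpt_gmap.
Qed.

Lemma gmap_modulus c s : injective c -> gmap s (modulus c) = modulus (c \o (s^-1)%g).
Proof.
move=> cinj; rewrite gmapE; last exact: modulus_K5.
have [f Lf ->] := modulus_normal cinj.
by rewrite -[RHS](modulus_lft _ Lf).
Qed.

Lemma flft_zpt l s j : K5 l -> gmap s l = l -> flft l s (zpt l j) = zpt l (s j).
Proof. by move=> Kl sl; rewrite -[in RHS]sl zpt_gmap // permK. Qed.

(** Conversely, every LFT that permutes the points [zpt l] arises from the
    stabilizer. *)
Lemma flft_uniq l s f : K5 l -> is_lft f -> (forall j, f (zpt l j) = zpt l (s j)) ->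
  gmap s l = l /\ flft l s = f.
Proof.
move=> Kl Lf fs; have fsV j : f (zpt l ((s^-1)%g j)) = zpt l j by rewrite fs permKV.
have [Lg g0 g1 g2] := flftP s Kl.
have E : flft l s = f.
  by apply: (is_lft_uniq Lg Lf g0 g1 g2); rewrite fsV ?zpt0 ?zpt1 ?zpt2.
by split=> //; apply: zpt_eq => j; rewrite zpt_gmap // E.
Qed.

Lemma autgrp_range c g s : is_lft g -> (forall j, g (c j) = c (s j)) ->
  autgrp (range c) g.
Proof.
move=> Lg gs; split=> //; apply/seteqP; split=> [_ [_ [j _ <-] <-]|_ [j _ <-]].
  by rewrite gs; exists (s j).
by exists (c ((s^-1)%g j)); [exists ((s^-1)%g j)|rewrite gs permKV].
Qed.

Lemma autgrp_perm c f : injective c -> autgrp (range c) f ->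
  exists s, forall j, f (c j) = c (s j).
Proof.
move=> cinj fc; have ex j : exists i, f (c j) = c i.
  have [|i _ ij] := autgrp_mem (z := c j) fc; first by exists j.
  by exists i.
pose h j := xget j [set i | f (c j) = c i].
have hE j : f (c j) = c (h j).
  by rewrite /h; case: xgetP => // /(_ _) no; have [i /no] := ex j.
have hinj : injective h.
  move=> i j hij; apply/cinj/(is_lft_inj (autgrp_lft fc)).
  by rewrite !hE hij.
by exists (perm hinj) => j; rewrite permE.
Qed.

Lemma range_nth5 (a b c d e : S2) :
  range (fun i : 'I_5 => nth None [:: a; b; c; d; e] i) = [set a; b; c; d; e].
Proof.
apply/seteqP; split=> [_ [[[|[|[|[|[|//]]]]] Hi] _ <-] /=|z /=]; try tauto.
have E k (H : (k < 5)%N) : nth None [:: a; b; c; d; e] (inord k : 'I_5) = nth None [:: a; b; c; d; e] k.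
  by rewrite inordK.
by case=> [[[[]|]|]|] ->; [exists (inord 0)|exists (inord 1)|exists (inord 2)|
  exists (inord 3)|exists (inord 4)]; rewrite ?E.
Qed.

Lemma nth5_inj (u : seq S2) : size u = 5%N -> uniq u ->
  injective (fun i : 'I_5 => nth None u i).
Proof.
move=> su uu i j /eqP; rewrite nth_uniq ?su //.
by move=> /eqP/val_inj.
Qed.

(** The number [2] is not one of the special values of [a]. *)
Lemma half_turn2 f : autgrp (symset (2 : C)) f -> f = id \/ f = scaling (- 1).
Proof.
have n (x : C) (k : nat) : x = k.+1%:R \/ x = - k.+1%:R -> x <> 0 by apply: natr_pm_neq0.
have n' (x y : C) (k : nat) : x - y = k.+1%:R \/ x - y = - k.+1%:R -> x <> y.
  by move=> /n xy e; apply: xy; rewrite e subrr.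
move=> fS; have [||||||u fu /eqP] := @autgrp_half_turn R 2 f.
- split; [apply: (n' _ _ 1)|apply: (n' _ _ 0)|apply: (n' _ _ 2)]; left; ring.
- by apply: (n _ 54); right; ring.
- by apply: (n' _ _ 12); left; ring.
- by apply: (n' _ _ 6); left; ring.
- by apply: (n' _ _ 4); left; ring.
- exact: fS.
by rewrite sqrf_eq1 => /orP[]/eqP uE; [left|right]; rewrite fu uE ?scaling1.
Qed.

(** The LFT [flft] is conjugated by the one that normalises [c]. *)
Lemma gmap_fix_range c s : injective c -> gmap s (modulus c) = modulus c ->
  exists2 g, autgrp (range c) g & forall j, g (c j) = c (s j).
Proof.
move=> cinj sc; have Kl := modulus_K5 cinj.
have [h Lh hE] := modulus_normal cinj.
have [Lk K K'] := is_lft_linv Lh; have [Lf _ _ _] := flftP s Kl.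
pose g := linv h \o flft (modulus c) s \o h.
have gE j : g (c j) = c (s j).
  rewrite /g /= -[h (c j)]/((h \o c) j) -hE flft_zpt // hE /=.
  by rewrite K.
by exists g => //; apply: autgrp_range gE; do !apply: is_lft_comp => //.
Qed.

(** A permutation acting trivially on K5 induces the identity or the half-turn
    on every labelling of [symset 2]. Two labellings for which the half-turn
    induces distinct permutations leave only the identity. *)
Lemma gmap_eq_id s : @gmap R s = id -> s = 1%g.
Proof.
move=> sid.
have ga : generic (2 : C).
  have n (x : C) (k : nat) : x = k.+1%:R \/ x = - k.+1%:R -> x <> 0 by apply: natr_pm_neq0.
  by split=> /eqP; rewrite -subr_eq0 => /eqP; [apply: (n _ 1)|apply: (n _ 0)|apply: (n _ 2)]; left; ring.
have key (v : seq C) : size v = 5%N -> perm_eq v [:: 0; 1; - 1; 2; - 2] ->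
  s = 1%g \/ forall i : 'I_5, nth 0 v (s i) = - nth 0 v i.
  move=> sv pv; pose c (i : 'I_5) := nth None (map Some v) i.
  have cE (i : 'I_5) : c i = Some (nth 0 v i) by rewrite /c (nth_map 0) ?sv.
  have uv : uniq v by rewrite (perm_uniq pv) sym_uniq.
  have cinj : injective c.
    by apply: nth5_inj; rewrite ?size_map // map_inj_uniq // => x y /Some_inj.
  have rc : range c = symset 2.
    apply/seteqP; split=> [_ [i _ <-]|z /symsetP[t tS ->]].
      by rewrite cE; apply: mem_symset; rewrite -(perm_mem pv) mem_nth ?sv.
    have := tS; rewrite -(perm_mem pv) => tv.
    have i5 : (index t v < 5)%N by rewrite -sv index_mem.
    by exists (Ordinal i5) => //; rewrite cE /= nth_index.
  have [|g] := @gmap_fix_range c s cinj; first by rewrite sid.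
  rewrite rc => /half_turn2[]-> gs.
    by left; apply/permP => i; rewrite perm1; apply: cinj; rewrite -gs.
  by right=> i; have := gs i; rewrite !cE scaling_Some mulN1r => /Some_inj.
have [//|k1] := key [:: 0; 1; - 1; 2; - 2] erefl (perm_refl _).
have [|//|k2] := key [:: 0; 1; 2; - 1; - 2] erefl.
  rewrite !perm_cons; apply/permPl.
  exact: (perm_catCA [:: 2] [:: - 1] [:: - 2]).
have := sym_uniq ga; set v := [:: 0; 1; -1; 2; -2] in k1 * => uv.
set v' := [:: 0; 1; 2; -1; -2] in k2.
have : nth 0 v (s (inord 1)) = nth 0 v' (s (inord 1)).
  by rewrite k1 k2 /= inordK.
have := k1 (inord 1); rewrite [in RHS]inordK //= => e1.
have s2 : s (inord 1) = inord 2.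
  apply/val_inj; rewrite /= inordK //; apply/eqP; rewrite -(nth_uniq 0 _ _ uv) //.
  by rewrite e1.
rewrite s2 inordK //= => /eqP.
rewrite -subr_eq0 (_ : - 1 - 2 = - 3%:R :> C); last by ring.
by rewrite oppr_eq0 pnatr_eq0.
Qed.

Lemma gmap_inj : injective (@gmap R).
Proof.
move=> s t st; apply/(mulIg t^-1)%g; rewrite mulgV.
apply: gmap_eq_id; rewrite -gmapM st gmapM mulgV.
exact: gmap1.
Qed.

Implicit Types x y : Gtype R.

Lemma Gfun_perm x : gmap (Gperm x) = Gfun x.
Proof. by rewrite -[in RHS](GpermK x). Qed.

(** Injectivity of [gmap] makes the arbitrary choice in [Gperm] harmless. *)
Lemma GofK : cancel (@Gof R) (@Gperm R).
Proof. by move=> s; apply: gmap_inj; rewrite Gfun_perm. Qed.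

Lemma GpermM x y : Gperm (x * y)%g = (Gperm y * Gperm x)%g.
Proof. by rewrite -[(x * y)%g]/(Gmul x y) /Gmul GofK. Qed.

Lemma in_stab l x : (x \in stab_group l) = (gmap (Gperm x) l == l).
Proof. by rewrite inE Gfun_perm. Qed.

Section Stab.
Variables (l : 'rV[C]_2).
Hypothesis Kl : K5 l.

Lemma Phi_zpt x j : x \in stab_group l -> Phi l x (zpt l j) = zpt l (Gperm x j).
Proof. by rewrite in_stab => /eqP xl; apply: flft_zpt. Qed.

Lemma is_lft_Phi x : is_lft (Phi l x).
Proof. by have [] := flftP (Gperm x) Kl. Qed.

Lemma Phi_autgrp x : x \in stab_group l -> autgrp (zset l) (Phi l x).
Proof.
move=> xl; apply: (autgrp_range (s := Gperm x)); first exact: is_lft_Phi.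
by move=> j; apply: Phi_zpt.
Qed.

Lemma Phi_surj f : autgrp (zset l) f -> exists2 x, x \in stab_group l & Phi l x = f.
Proof.
move=> fl; have [s sE] := autgrp_perm (zpt_inj Kl) fl.
have [sl fE] := flft_uniq Kl (autgrp_lft fl) sE.
by exists (Gof R s); rewrite ?in_stab /Phi GofK // sl.
Qed.

Lemma Phi_inj : {in stab_group l &, injective (Phi l)}.
Proof.
move=> x y xl yl xy; rewrite -(GpermK x) -(GpermK y); congr Gof.
by apply/permP => j; apply: (zpt_inj Kl); rewrite -!Phi_zpt // xy.
Qed.

(** Products of permutations compose from left to right and products of elements
    of G from right to left, which is what [GpermM] says. *)
Lemma PhiM : {in stab_group l &, forall x y, Phi l (x * y)%g = Phi l x \o Phi l y}.
Proof.
move=> x y xl yl; rewrite /Phi GpermM -flftM //.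
by move: yl; rewrite in_stab => /eqP ->.
Qed.

Lemma iso_fingroup_stab (gT : finGroupType) (H : {group gT}) A : equivalent (zset l) A ->
  stab_group l \isog H -> iso_fingroup (autgrp A) H.
Proof.
move=> [psi [Lpsi psiA]]; rewrite isog_sym => /isogP[h /injmP hinj him].
have [Lphi K K'] := is_lft_linv Lpsi.
have hin (x : gT) : x \in H -> h x \in stab_group l.
  by move=> xH; rewrite -him mem_morphim.
exists (fun x : gT => psi \o Phi l (h x) \o linv psi); split.
- move=> x y xH yH E; apply: hinj => //; apply: Phi_inj; try exact: hin.
  apply: funext => z; apply: (is_lft_inj Lpsi).
  by have := congr1 (@^~ (psi z)) E; rewrite /= K.
- apply/seteqP; split=> [_ [x xH <-]|f fA].
    by apply: (autgrp_conjP Lpsi psiA); apply: Phi_autgrp; apply: hin.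
  have psiA' : linv psi @` A = zset l.
    rewrite -psiA image_comp (_ : linv psi \o psi = id) ?image_id //.
    by apply: funext => z /=; rewrite K.
  have := autgrp_conjP Lphi psiA' fA; case/Phi_surj => y yl yE.
  move: yl; rewrite -him => /morphimP[x xH _ yx]; exists x => //.
  rewrite -yx yE; apply: funext => z /=; rewrite K'.
  have [_ k k'] := is_lft_linv Lphi.
  by rewrite -[in LHS](K' z) k K'.
move=> x y xH yH; rewrite morphM // PhiM ?hin //.
by apply: funext => z /=; rewrite K.
Qed.

End Stab.

Lemma exists_modulus c : injective c -> exists2 l, K5 l & equivalent (zset l) (range c).
Proof.
move=> cinj; exists (modulus c); first exact: modulus_K5.
have [f Lf fE] := modulus_normal cinj.
apply: equivalent_sym; exists f; split=> //.
by rewrite /zset fE image_comp.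
Qed.

End Moduli.

(** * Configurations with a non-trivial automorphism *)

(** Lists of values of a transposition, a double transposition, a three-cycle and
    a five-cycle. *)
Definition cycle_shapes : seq (seq nat) :=
  [:: [:: 0; 1; 2; 4; 3]; [:: 0; 2; 1; 4; 3]; [:: 0; 1; 3; 4; 2]; [:: 1; 2; 3; 4; 0]]%N.

(** The n-th iterate of the permutation with list of values [L] becomes [u] after
    renaming the points by [v]. *)
Definition has_shape (L : seq nat) (n : nat) (u v : seq nat) :=
  all (fun i => iter n (nth 0%N L) (nth 0%N v i) == nth 0%N v (nth 0%N u i)) (iota 0 5).

(** Powers up to the third suffice: the square of a four-cycle and the cube of a
    permutation of type 3 + 2 have one of the shapes. *)
Lemma has_shape_all : all (fun L => (L == iota 0 5) || has (fun n => has (fun u =>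
    has (has_shape L n u) (permutations (iota 0 5))) cycle_shapes) [:: 1; 2; 3]%N)
  (permutations (iota 0 5)).
Proof. by vm_cast_no_check (erefl true). Qed.

Lemma perm5_power_shape (s : {perm 'I_5}) : s != 1%g ->
  exists (n : nat) (v : 'I_5 -> 'I_5) (u : seq nat),
  [/\ u \in cycle_shapes, injective v &
      forall i, iter n s (v i) = v (inord (nth 0%N u i))].
Proof.
move=> s1; pose L := [seq val (s i) | i <- enum 'I_5].
have szL : size L = 5%N by rewrite size_map size_enum_ord.
have LE (i : 'I_5) : nth 0%N L i = s i.
  by rewrite /L (nth_map ord0) ?size_enum_ord // nth_ord_enum.
have PL : perm_eq L (iota 0 5).
  apply: uniq_perm; last move=> k.
  - by rewrite map_inj_uniq ?enum_uniq // => i j /val_inj/perm_inj.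
  - exact: iota_uniq.
  rewrite -(val_enum_ord 5); apply/mapP/mapP => -[i _ ->]; first by exists (s i); rewrite ?mem_enum.
  by exists ((s^-1)%g i); rewrite ?mem_enum ?permKV.
rewrite -mem_permutations in PL.
have /orP[/eqP L0|] := allP has_shape_all L PL.
  case/eqP: s1; apply/permP => i; apply/val_inj.
  by rewrite perm1; have := LE i; rewrite L0 nth_iota // add0n => /esym.
case/hasP => n _ /hasP[u uS] /hasP[v]; rewrite mem_permutations => vP /allP vE.
have szv : size v = 5%N by rewrite (perm_size vP).
have uv : uniq v by rewrite (perm_uniq vP) iota_uniq.
have v5 i : (i < 5)%N -> (nth 0%N v i < 5)%N.
  by move=> i5; have := mem_nth 0%N (s := v) (n := i); rewrite szv (perm_mem vP) mem_iota; apply.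
have u5 i : (i < 5)%N -> (nth 0%N u i < 5)%N.
  by move: uS; rewrite !inE => /or4P[]/eqP->; case: i => [|[|[|[|[|]]]]].
exists n, (fun i => inord (nth 0%N v i)), u; split=> // [i j /(congr1 val)|i].
  rewrite /= !inordK ?v5 // => /eqP; rewrite nth_uniq ?szv // => /eqP; exact: val_inj.
apply/val_inj; rewrite /= [RHS]inordK ?v5 ?inordK ?u5 //.
have /eqP <- : iter n (nth 0%N L) (nth 0%N v i) == nth 0%N v (nth 0%N u i).
  by apply: vE; rewrite mem_iota /=.
elim: n {vE} => [|n IHn] /=; first by rewrite inordK // v5.
by rewrite -LE IHn.
Qed.

Section Classification.
Variable R : realType.
Local Notation C := R[i].
Local Notation S2 := (sphere R).
Local Notation w3 := (omega R 3).
Implicit Types (f g : S2 -> S2) (p q r : S2).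

(** In a coordinate where the fixed point is [0] and one exchanged pair is
    [1], [- 1], the map agrees with the half-turn at three points. *)
Lemma double_transposition f p q q' r r' : is_lft f ->
  uniq [:: p; q; q'; r; r'] -> f p = p -> f q = q' -> f q' = q -> f r = r' ->
  exists psi a, [/\ is_lft psi, generic a & psi @` [set p; q; q'; r; r'] = symset a].
Proof.
move=> Lf; rewrite /= !inE !negb_or !andbT.
case/and4P => /and4P[pq pq' pr pr'] /and3P[qq' qr qr'] /andP[q'r q'r'] rr' fp fq fq' fr.
have [phi [Lphi phip phiq phiq']] := is_lft_to01oo pq pq' qq'.
pose chi := lft 1 0 (- 1) 2 \o phi.
have Lchi : is_lft chi.
  apply: is_lft_comp => //; exists 1, 0, (- 1), 2; split=> //.
have chip : chi p = Some 0.
  by rewrite /chi /= phip /= !mulr0 !add0r pnatr_eq0 mul0r.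
have chiq : chi q = Some 1.
  rewrite /chi /= phiq /= !mulr1 addr0.
  by rewrite (_ : -1 + 2 = 1); [rewrite oner_eq0 divr1|ring].
have chiq' : chi q' = Some (- 1).
  by rewrite /chi /= phiq' /= oppr_eq0 oner_eq0 invrN invr1 mul1r.
have inj := is_lft_inj Lchi.
have E : chi \o f = scaling (- 1) \o chi.
  apply: (lft_eq3 _ _ pq pq' qq') => /=.
  - exact: is_lft_comp.
  - by apply: is_lft_comp => //; apply: is_lft_scaling; rewrite oppr_eq0 oner_eq0.
  - by rewrite fp chip scaling_Some mulr0.
  - by rewrite fq chiq chiq' scaling_Some mulr1.
  - by rewrite fq' chiq' chiq scaling_Some mulrNN mulr1.
have chir' : chi r' = scaling (- 1) (chi r).
  by rewrite -fr; apply: (congr1 (@^~ r) E).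
case chir : (chi r) => [a|]; last first.
  by move: rr'; rewrite -(inj_eq inj) chir' chir scaling_None eqxx.
rewrite chir scaling_Some mulN1r in chir'.
exists chi, a; split=> //.
  split=> aE; [move: pr|move: qr|move: q'r]; rewrite -(inj_eq inj) chir ?chip ?chiq ?chiq';
  by rewrite aE eqxx.
by rewrite image_set5 chip chiq chiq' chir chir'.
Qed.

(** In a coordinate where the fixed points are [0] and [oo], the map is a scaling
    of order three. *)
Lemma three_cycle f p p' q q' q'' : is_lft f ->
  uniq [:: p; p'; q; q'; q''] -> f p = p -> f p' = p' ->
  f q = q' -> f q' = q'' -> f q'' = q ->
  exists2 psi, is_lft psi & psi @` [set p; p'; q; q'; q''] = @triangle R.
Proof.
move=> Lf; rewrite /= !inE !negb_or !andbT.
case/and4P => /and4P[pp' pq _ _] /and3P[p'q _ _] /andP[qq' _] _ fp fp' fq fq' fq''.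
have [phi [Lphi phip phiq phip']] : exists phi, [/\ is_lft phi, phi p = Some 0,
    phi q = Some 1 & phi p' = None].
  by apply: is_lft_to01oo; rewrite // eq_sym.
have [Lk K K'] := is_lft_linv Lphi.
have lp : linv phi (Some 0) = p by rewrite -phip K.
have lp' : linv phi None = p' by rewrite -phip' K.
have [|||k k0 gE] := @lft_0oo _ (phi \o f \o linv phi).
- by apply: is_lft_comp => //; apply: is_lft_comp.
- by rewrite /= lp fp.
- by rewrite /= lp' fp'.
have phif x : phi (f x) = scaling k (phi x) by rewrite -gE /= K.
have phiq' : phi q' = Some k by rewrite -fq phif phiq scaling_Some mulr1.
have phiq'' : phi q'' = Some (k ^+ 2) by rewrite -fq' phif phiq' scaling_Some.
have k3 : k ^+ 3 = 1.
  by move: phiq; rewrite -fq'' phif phiq'' scaling_Some -exprS => /Some_inj.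
exists phi => //; rewrite image_set5 phip phip' phiq phiq' phiq''.
have [[[|[|[|//]]] i3] kE] := prim_rootP (omega_prim R (isT : prime 3)) k3.
- move: qq'; rewrite -(inj_eq (is_lft_inj Lphi)) phiq phiq' kE.
  by rewrite expr0 eqxx.
- by rewrite kE /= expr1.
have -> : k ^+ 2 = w3.
  by rewrite kE /= -exprM (exprD _ 3 1) omegaXp // mul1r.
by rewrite kE /triangle; apply/seteqP; split=> x /=; tauto.
Qed.

(** Every five-cycle realised by an LFT is inverted by an LFT of order two, so that
    this case reduces to the double transpositions. In the coordinate where the
    cycle is [oo -> 0 -> 1 -> x -> y -> oo], its existence means [y = x + 1] and
    [x * y = x + y]. The reflection is [t |-> y (t - x) / (t - y)]: it exchanges
    [0] with [x] and [oo] with [y], and the two relations say that it fixes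
    [1]. *)
Lemma five_cycle f p0 p1 p2 p3 p4 : is_lft f ->
  uniq [:: p0; p1; p2; p3; p4] -> f p0 = p1 -> f p1 = p2 -> f p2 = p3 ->
  f p3 = p4 -> f p4 = p0 ->
  exists psi a, [/\ is_lft psi, generic a &
     psi @` [set p0; p1; p2; p3; p4] = symset a].
Proof.
move=> Lf us; have := us; rewrite /= !inE !negb_or !andbT.
case/and4P => /and4P[p01 p02 p03 p04] /and3P[p12 p13 p14] /andP[p23 p24] p34 f0 f1 f2 f3 f4.
have [phi [Lphi phi1 phi2 phi0]] : exists phi, [/\ is_lft phi, phi p1 = Some 0,
    phi p2 = Some 1 & phi p0 = None].
  by apply: is_lft_to01oo; rewrite // eq_sym.
have inj := is_lft_inj Lphi.
case phi3 : (phi p3) => [x|]; last first.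
  by move: p03; rewrite -(inj_eq inj) phi3 phi0 eqxx.
case phi4 : (phi p4) => [y|]; last first.
  by move: p04; rewrite -(inj_eq inj) phi4 phi0 eqxx.
have [_ K K'] := is_lft_linv Lphi.
pose g := phi \o f \o linv phi.
have gphi q : g (phi q) = phi (f q) by rewrite /g /= K.
have [A [B [c [d [D gE]]]]] : is_lft g.
  by apply: is_lft_comp; [apply: is_lft_comp|case: (is_lft_linv Lphi)].
have [c0 A0] : c != 0 /\ A = 0.
  have := gphi p0; rewrite f0 phi0 phi1 gE /=; case: eqVneq => // c0 /Some_inj/eqP.
  by rewrite mulf_eq0 invr_eq0 (negPf c0) orbF => /eqP.
have fin s t : g (Some s) = Some t -> B = t * (c * s + d).
  rewrite gE /= A0 mul0r add0r; case: eqVneq => // cs /Some_inj <-.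
  by rewrite divfK.
have /fin : g (Some 0) = Some 1 by rewrite -phi1 gphi f1.
rewrite mulr0 add0r mul1r => Bd.
have /fin : g (Some 1) = Some x by rewrite -phi2 gphi f2.
rewrite mulr1 Bd => e1.
have /fin : g (Some x) = Some y by rewrite -phi3 gphi f3.
rewrite Bd => e2.
have : g (Some y) = None by rewrite -phi4 gphi f4.
rewrite gE /=; case: eqVneq => // cy _.
have dE : d = - (c * y) by apply/eqP; rewrite -addr_eq0 addrC cy.
have y0 : y != 0.
  by apply: contraNneq p14 => y0; rewrite -(inj_eq inj) phi1 phi4 y0.
have y1 : y != 1.
  by apply: contraNneq p24 => y1; rewrite -(inj_eq inj) phi2 phi4 y1.
have xy : x != y.
  by apply: contraNneq p34 => xy; rewrite -(inj_eq inj) phi3 phi4 xy.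
have E1 : - y = x * (1 - y) by apply: (mulfI c0); move: e1; rewrite dE => e1;
  rewrite mulrN e1; ring.
have E2 : - 1 = x - y by apply: (mulfI c0); apply: (mulfI y0); move: e2; rewrite dE => e2;
  rewrite mulrN1 mulrN [y * c]mulrC e2; ring.
pose h := lft y (- y * x) 1 (- y).
have Lh : is_lft h.
  exists y, (- y * x), 1, (- y); split=> //.
  rewrite (_ : _ - _ = y * (x - y)); last by ring.
  by rewrite mulf_neq0 // subr_eq0.
have h1 : h (Some 1) = Some 1.
  rewrite /h /= !mulr1 subr_eq0 eq_sym (negPf y1); congr Some.
  have y1' : 1 - y != 0 by rewrite subr_eq0 eq_sym.
  apply: (mulIf y1'); rewrite divfK // mul1r.
  have xE : x = y - 1 by rewrite E2; ring.
  rewrite xE in E1 *.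
  transitivity (1 - y - (- y - (y - 1) * (1 - y))); first by ring.
  by rewrite -E1 subrr subr0.
have h0 : h (Some 0) = Some x.
  by rewrite /h /= !mulr0 !add0r oppr_eq0 (negPf y0) mulrAC divff ?mul1r // oppr_eq0.
have hx : h (Some x) = Some 0.
  by rewrite /h /= mul1r subr_eq0 (negPf xy) mulNr subrr mul0r.
have ho : h None = Some y by rewrite /h /= oner_eq0 divr1.
have uh : uniq [:: Some 1; Some 0; Some x; None; Some y].
  rewrite -phi2 -phi1 -phi3 -phi0 -phi4.
  rewrite (map_inj_uniq inj [:: p2; p1; p3; p0; p4]) /= !inE !negb_or.
  by do !(apply/andP; split) => //; rewrite eq_sym.
have [psi [a [Lpsi ga psiE]]] := @double_transposition h (Some 1) (Some 0) (Some x) None (Some y)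
  Lh uh h1 h0 hx ho.
exists (psi \o phi), a; split=> //; first exact: is_lft_comp.
rewrite -image_comp image_set5 phi0 phi1 phi2 phi3 phi4 -psiE; congr (psi @` _).
by apply/seteqP; split=> t /=; tauto.
Qed.

Lemma range_ord5 (c : 'I_5 -> S2) (v : 'I_5 -> 'I_5) : injective v ->
  range c = [set c (v (inord 0)); c (v (inord 1)); c (v (inord 2)); c (v (inord 3));
    c (v (inord 4))].
Proof.
move=> vi; apply/seteqP; split=> [_ [i _ <-]|z /=]; last first.
  by case=> [[[[]|]|]|] ->; eexists.
have [g _ gK] := injF_bij vi; rewrite -(gK i); case: (g i) => -[|[|[|[|[|//]]]]] Hi /=.
- by rewrite (_ : inord 0 = Ordinal Hi); [tauto|apply/val_inj; rewrite /= inordK].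
- by rewrite (_ : inord 1 = Ordinal Hi); [tauto|apply/val_inj; rewrite /= inordK].
- by rewrite (_ : inord 2 = Ordinal Hi); [tauto|apply/val_inj; rewrite /= inordK].
- by rewrite (_ : inord 3 = Ordinal Hi); [tauto|apply/val_inj; rewrite /= inordK].
- by rewrite (_ : inord 4 = Ordinal Hi); [tauto|apply/val_inj; rewrite /= inordK].
Qed.

(** Some power of the permutation of the five points is a transposition, a
    double transposition, a three-cycle or a five-cycle; the first of these
    fixes three points. *)
Lemma automorphism_shape (c : 'I_5 -> S2) f : injective c -> autgrp (range c) f ->
  f <> id ->
  (exists2 psi, is_lft psi & psi @` range c = @triangle R) \/
  (exists psi a, [/\ is_lft psi, generic a & psi @` range c = symset a]).
Proof.
move=> cinj fc fid; have [s sE] := autgrp_perm cinj fc.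
have Lf := autgrp_lft fc.
have s1 : s != 1%g.
  apply/eqP => s1; apply: fid.
  apply: (@lft_id3 _ _ (c (inord 0)) (c (inord 1)) (c (inord 2))) => //;
    by rewrite ?(inj_eq cinj) ?inord5_inj // sE s1 perm1.
have [n [v [u [uS vi vE]]]] := perm5_power_shape s1.
have Lfn : is_lft (iter n f).
  by elim: (n) => [|m IHm]; [apply: is_lft_id|apply: is_lft_comp].
have fnE i : iter n f (c (v i)) = c (v (inord (nth 0%N u i))).
  rewrite -vE; elim: (n) => //= m ->; exact: sE.
have cv_uniq : uniq [:: c (v (inord 0)); c (v (inord 1)); c (v (inord 2));
    c (v (inord 3)); c (v (inord 4))].
  by rewrite /= !inE !negb_or !(inj_eq cinj) !(inj_eq vi) !inord5_inj.
have fn k : (k < 5)%N -> iter n f (c (v (inord k))) = c (v (inord (nth 0%N u k))).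
  by move=> k5; rewrite fnE inordK.
have := (fn 0 isT, fn 1 isT, fn 2 isT, fn 3 isT, fn 4 isT)%N.
rewrite (range_ord5 c vi).
move: uS; rewrite !inE => /or4P[]/eqP-> /= [[[[f0 f1] f2] f3] f4].
- exfalso; suff : inord 3 = inord 4 :> 'I_5 by apply/eqP; rewrite inord5_inj.
  apply/vi/cinj; rewrite -f4.
  rewrite (@lft_id3 _ (iter n f) (c (v (inord 0))) (c (v (inord 1))) (c (v (inord 2)))) //;
  by rewrite (inj_eq cinj) (inj_eq vi) inord5_inj.
- by right; apply: double_transposition Lfn cv_uniq _ _ _ _.
- by left; apply: three_cycle Lfn cv_uniq _ _ _ _ _.
- by right; apply: five_cycle Lfn cv_uniq _ _ _ _ _.
Qed.

End Classification.

(** * Differentials of maps between row vectors *)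

Section Calculus.
Variable K : numFieldType.

(** The differential only depends on the germ of the map. *)
Lemma near_eq_diff (V W : normedModType K) (f g : V -> W) (x : V) :
  f x = g x -> (\forall y \near x, f y = g y) -> differentiable f x ->
  differentiable g x /\ 'd g x = 'd f x :> (V -> W).
Proof.
move=> fgx fg df; have [dc /eqaddoP dE] := (diff_locallyP x f).1 df.
have gE : g \o shift x = cst (g x) + 'd f x +o_ 0 id.
  apply/eqaddoP => e e0; have := dE e e0.
  have fg0 : \forall h \near (0 : V), f (h + x) = g (h + x).
    by move: fg; rewrite (near_shift 0) subr0.
  apply: filter_app; near=> h.
  rewrite !fctE /= -fgx (_ : f (h + x) = g (h + x)) //.
  by near: h.
have dgE := diff_unique dc gE.
by split; [apply/diff_locallyP; rewrite dgE|exact: dgE].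
Unshelve. all: by end_near. Qed.

Lemma differentiable_row (V : normedModType K) n (f : V -> 'rV[K]_n) (x : V) :
  (forall j, differentiable (fun y => f y 0 j : K) x) -> differentiable f x.
Proof.
move=> df.
have -> : f = \sum_(j < n) (fun y => (f y 0 j) *: (delta_mx 0 j : 'rV[K]_n)).
  apply: funext => y; rewrite fct_sumE; exact: row_sum_delta.
by apply: differentiable_sum => j; apply: differentiableZl.
Qed.

Lemma diff_row_coord (V : normedModType K) n (f : V -> 'rV[K]_n) (x v : V) j :
  differentiable f x -> 'd f x v 0 j = 'd (fun y => f y 0 j : K) x v.
Proof.
move=> df.
have @h : {linear 'rV[K]_n -> K}.
  by exists (fun N : 'rV[K]_n => N 0 j); do 2![eexists]; do ?[constructor];
     rewrite ?mxE// => ? *; rewrite ?mxE//; move=> ?; rewrite !mxE.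
have hc : continuous h by exact: coord_continuous.
have dh y : differentiable h y by apply: linear_differentiable.
have hf : (fun y => f y 0 j : K) = h \o f by [].
rewrite hf (@diff_comp K V _ _ f h x df (dh _)) /=.
by rewrite (@diff_lin K _ _ h (f x)).
Qed.

(** The chain rule along the curve [g], whose image under [f] is [h] run at
    speed [k]. *)
Lemma jacobian_curve m n (f : 'rV[K]_m -> 'rV[K]_n) (g : K -> 'rV[K]_m)
    (h : K -> 'rV[K]_n) (k : K) :
  differentiable g 0 -> differentiable h 0 -> differentiable f (g 0) ->
  (\forall t \near (0 : K), f (g t) = h (k * t)) ->
  'd g 0 1 *m jacobian f (g 0) = k *: 'd h 0 1.
Proof.
move=> dg dh df fg; rewrite /jacobian mul_rV_lin1.
have dfg : differentiable (f \o g) 0 by apply: differentiable_comp.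
have fg0 : (f \o g) 0 = (h \o ( *:%R k)) 0.
  by have := nbhs_singleton fg.
have [_ E] := near_eq_diff fg0 fg dfg.
have C1 := congr1 (@^~ 1) (diff_comp dg df).
have dk : differentiable ( *:%R k : K -> K) 0 by exact: ex_diff.
have dhk : differentiable h (k *: (0 : K)) by rewrite scaler0.
have C2 := congr1 (@^~ 1) (diff_comp dk dhk).
rewrite -E [LHS]C2 /= in C1.
rewrite -[LHS]/(('d f (g 0) \o 'd g 0) 1) -[LHS]C1.
have -> : 'd ( *:%R k : K -> K) 0 = *:%R k :> (K -> K) by exact: diff_val.
by rewrite -linearZ scaler0.
Qed.

Lemma is_derive_horner (p : {poly K}) (x : K) :
  is_derive x (1 : K) (horner p : K -> K) p^`().[x].
Proof.
elim/poly_ind: p => [|p c IHp].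
  have -> : horner (0 : {poly K}) = cst 0 by apply: funext => y; rewrite horner0.
  by rewrite deriv0 horner0; exact: is_derive_cst.
have -> : horner (p * 'X + c%:P) = (horner p : K -> K) * id + cst c.
  by apply: funext => y; rewrite !hornerE.
rewrite derivD derivM derivX derivC addr0 mulr1 hornerD hornerMX.
apply: is_derive_eq.
by rewrite addr0 /GRing.scale /= mulr1 addrC mulrC.
Qed.

Lemma diff_ratio (p q : {poly K}) : q.[0] != 0 ->
  differentiable (fun t => p.[t] / q.[t] : K) 0 /\
  'd (fun t => p.[t] / q.[t] : K) 0 1 =
    (p^`().[0] * q.[0] - p.[0] * q^`().[0]) / q.[0] ^+ 2.
Proof.
move=> q0; have [dp pE] := is_derive_horner p 0; have [dq qE] := is_derive_horner q 0.
have -> : (fun t => p.[t] / q.[t]) = (horner p : K -> K) * (fun t => (q.[t])^-1) by [].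
have dV : derivable (fun t => (q.[t])^-1 : K) 0 1 by exact: derivableV.
have D : derivable ((horner p : K -> K) * (fun t => (q.[t])^-1)) 0 1 by exact: derivableM.
have Dd := (derivable1_diffP _ _).1 D.
split; first exact: Dd.
rewrite -(deriveE _ Dd) (deriveM dp dV) (deriveV q0 dq) pE qE.
by rewrite /GRing.scale /=; field.
Qed.

Lemma near_horner_neq0 (p : {poly K}) : p.[0] != 0 ->
  \forall t \near (0 : K), p.[t] != 0.
Proof.
move=> p0; have [dp _] := is_derive_horner p 0.
have cp : {for 0, continuous (horner p : K -> K)}.
  by apply: differentiable_continuous; apply/derivable1_diffP.
exact: (cvgr_neq0 _ cp p0).
Qed.

End Calculus.

(** * Curves in the moduli space *)

(** Under this name [R[i]] is seen as a normed module over itself. *)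
Definition Cfield (R : realType) : numFieldType := R[i].

Section Curves.
Variable R : realType.
Local Notation C := R[i].
Local Notation K := (Cfield R).
Local Notation S2 := (sphere R).
Implicit Types (l : 'rV[K]_2) (s : {perm 'I_5}) (f : S2 -> S2).

Lemma differentiable_hx_zpt l i : differentiable (fun l' : 'rV[K]_2 => hx (zpt l' i) : K) l.
Proof.
elim/ord5_cases: i => [|||j].
- by under eq_fun do rewrite zpt0; exact: differentiable_cst.
- by under eq_fun do rewrite zpt1; exact: differentiable_cst.
- by under eq_fun do rewrite zpt2; exact: differentiable_cst.
- by under eq_fun do rewrite zpt_inord; exact: differentiable_coord.
Qed.

Lemma differentiable_hy_zpt l i : differentiable (fun l' : 'rV[K]_2 => hy (zpt l' i) : K) l.
Proof.
elim/ord5_cases: i => [|||j].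
- by under eq_fun do rewrite zpt0; exact: differentiable_cst.
- by under eq_fun do rewrite zpt1; exact: differentiable_cst.
- by under eq_fun do rewrite zpt2; exact: differentiable_cst.
- by under eq_fun do rewrite zpt_inord; exact: differentiable_cst.
Qed.

Lemma differentiable_wedge_zpt l i j :
  differentiable (fun l' : 'rV[K]_2 => wedge (zpt l' i) (zpt l' j) : K) l.
Proof.
rewrite /wedge; apply: differentiableB; apply: differentiableM;
  by [exact: differentiable_hx_zpt|exact: differentiable_hy_zpt].
Qed.

Lemma K5_wedge l : K5 l <-> forall i j, i != j -> wedge (zpt l i) (zpt l j) != 0.
Proof.
split=> [Kl i j ij|lw]; first by rewrite wedge_eq0 (inj_eq (zpt_inj Kl)).
apply: zpt_injK => i j; apply: contra_eq => /lw.
by rewrite wedge_eq0.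
Qed.

Lemma near_forall_pairs (T : topologicalType) (I : finType) (x : T) (P : I -> I -> T -> Prop) :
  (forall i j, i != j -> \forall y \near x, P i j y) ->
  \forall y \near x, forall i j, i != j -> P i j y.
Proof.
move=> nP.
have H : \forall y \near x, forall ij : I * I, ij.1 != ij.2 -> P ij.1 ij.2 y.
  apply: filter_forall => -[i j] /=; have [-> |ij] := eqVneq i j; first exact: filterE.
  by apply: filterS (nP i j ij) => y.
by apply: filterS H => y H i j; apply: (H (i, j)).
Qed.

Lemma K5_near l : K5 l -> \forall l' \near l, K5 l'.
Proof.
move=> /K5_wedge lw.
have H : \forall l' \near l, forall i j : 'I_5, i != j ->
    wedge (zpt l' i) (zpt l' j) != 0.
  apply: near_forall_pairs => i j ij.
  have := differentiable_continuous (differentiable_wedge_zpt l i j).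
  by move=> /cvgr_neq0; apply; exact: lw.
by apply: filterS H => l' /K5_wedge.
Qed.

(** Near [l], the components of [gmap s] are cross-ratios of the points [zpt l']
    in a permuted order. *)
Lemma differentiable_gmap l s : K5 l -> differentiable (gmap s : 'rV[K]_2 -> 'rV[K]_2) l.
Proof.
move=> Kl; pose t := (s^-1)%g.
have dm : differentiable (fun l' : 'rV[K]_2 => modulus (zpt l' \o t)) l.
  apply: differentiable_row => j.
  under eq_fun do rewrite mxE /cr /=.
  have w i k : i != k -> wedge (zpt l (t i)) (zpt l (t k)) != 0.
    by move=> ik; apply: (K5_wedge l).1; rewrite // (inj_eq perm_inj).
  have ne i k : (i < 5)%N -> (k < 5)%N -> i != k ->
    wedge (zpt l (t (inord i))) (zpt l (t (inord k))) != 0.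
    by move=> i5 k5 ik; apply: w; rewrite inord5_inj.
  apply: differentiableM; first by apply: differentiableM; exact: differentiable_wedge_zpt.
  apply: differentiableV; last first.
    rewrite mulf_neq0 ?ne //; first by rewrite (ltn_add2l 3 j 2).
  by apply: differentiableM; exact: differentiable_wedge_zpt.
apply: (near_eq_diff _ _ dm).1; first by rewrite gmapE.
by apply: filterS (K5_near Kl) => l' Kl'; rewrite gmapE.
Qed.

Implicit Types X Y : 'I_5 -> {poly C}.

Definition hcurve X Y (t : K) : 'I_5 -> S2 := fun i => hproj (X i).[t] (Y i).[t].
Definition hwedge X Y i j : {poly C} := X i * Y j - X j * Y i.
Definition nondegenerate_curve X Y := forall i j, i != j -> (hwedge X Y i j).[0] != 0.

Definition moduli_curve X Y (t : K) : 'rV[K]_2 := modulus (hcurve X Y t).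
Definition tangent X Y : 'rV[K]_2 := 'd (moduli_curve X Y) 0 1.

Lemma hwedge_neq0 X Y i j t : (hwedge X Y i j).[t] != 0 ->
  ((X i).[t] != 0) || ((Y i).[t] != 0).
Proof.
rewrite /hwedge hornerD hornerN !hornerM; apply: contraNT.
rewrite negb_or !negbK => /andP[/eqP-> /eqP->].
by rewrite mul0r mulr0 subrr.
Qed.

Lemma hcurve_inj X Y t : (forall i j, i != j -> (hwedge X Y i j).[t] != 0) ->
  injective (hcurve X Y t).
Proof.
move=> nd i j; apply: contra_eq => ij.
have w0 := nd _ _ ij; have ji : j != i by rewrite eq_sym.
have [k k0 [xi yi]] := hprojP (hwedge_neq0 w0).
have [m m0 [xj yj]] := hprojP (hwedge_neq0 (nd _ _ ji)).
rewrite /hcurve; set p := hproj (X i).[t] _ in xi yi *.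
set q := hproj (X j).[t] _ in xj yj *.
move: w0; rewrite /hwedge hornerD hornerN !hornerM xi yi xj yj.
apply: contraNneq => ->.
by apply/eqP; ring.
Qed.

Lemma near_nondegenerate X Y : nondegenerate_curve X Y ->
  \forall t \near (0 : K), forall i j, i != j -> (hwedge X Y i j).[t] != 0.
Proof.
move=> nd; apply: near_forall_pairs => i j ij; exact: near_horner_neq0 (nd i j ij).
Qed.

Definition cr_num X Y (j : 'I_2) : {poly C} :=
  hwedge X Y (inord 1) (inord 2) * hwedge X Y (inord (3 + j)) (inord 0).
Definition cr_den X Y (j : 'I_2) : {poly C} :=
  hwedge X Y (inord 1) (inord 0) * hwedge X Y (inord (3 + j)) (inord 2).

Lemma moduli_curveE X Y t j : (forall i j, i != j -> (hwedge X Y i j).[t] != 0) ->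
  moduli_curve X Y t 0 j = (cr_num X Y j).[t] / (cr_den X Y j).[t].
Proof.
move=> nd; have ne (i k : nat) : (i < 5)%N -> (k < 5)%N -> i != k ->
    (hwedge X Y (inord i) (inord k)).[t] != 0.
  by move=> i5 k5 ik; apply: nd; rewrite inord5_inj.
have j5 : (3 + j < 5)%N by rewrite (ltn_add2l 3 j 2).
rewrite mxE cr_hproj.
- by rewrite /cr_num /cr_den /hwedge !(hornerD, hornerN, hornerM); congr (_ / _); ring.
- exact: (hwedge_neq0 (ne 0 1 _ _ _)%N).
- exact: (hwedge_neq0 (ne 1 0 _ _ _)%N).
- exact: (hwedge_neq0 (ne 2 0 _ _ _)%N).
- exact: (hwedge_neq0 (ne (3 + j) 0 _ _ _)%N).
Qed.

Lemma cr_den0 X Y j : nondegenerate_curve X Y -> (cr_den X Y j).[0] != 0.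
Proof.
move=> nd; rewrite /cr_den hornerM mulf_neq0 //; apply: nd; apply: inord5_inj => //.
by rewrite (ltn_add2l 3 j 2).
Qed.

(** The coordinates of the curve are rational functions of time. *)
Lemma moduli_curve_diff X Y : nondegenerate_curve X Y ->
  differentiable (moduli_curve X Y) 0 /\
  forall j, tangent X Y 0 j =
    ((cr_num X Y j)^`().[0] * (cr_den X Y j).[0] -
     (cr_num X Y j).[0] * (cr_den X Y j)^`().[0]) / (cr_den X Y j).[0] ^+ 2.
Proof.
move=> nd.
have dj j : differentiable (fun t => moduli_curve X Y t 0 j : K) 0 /\
   'd (fun t => moduli_curve X Y t 0 j : K) 0 1 =
   ((cr_num X Y j)^`().[0] * (cr_den X Y j).[0] -
     (cr_num X Y j).[0] * (cr_den X Y j)^`().[0]) / (cr_den X Y j).[0] ^+ 2.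
  have [dr dE] := diff_ratio (cr_num X Y j) (cr_den0 j nd).
  have [||dm mE] := near_eq_diff (g := fun t => moduli_curve X Y t 0 j : K) _ _ dr.
  - by rewrite moduli_curveE.
  - by apply: filterS (near_nondegenerate nd) => t ndt; rewrite moduli_curveE.
  split; first exact: dm.
  by rewrite mE; exact: dE.
have d : differentiable (moduli_curve X Y) 0.
  by apply: differentiable_row => j; case: (dj j).
split; first exact: d.
by move=> j; have [_ <-] := dj j; rewrite /tangent (diff_row_coord _ j d).
Qed.

(** Cross-ratios are invariant under [f], so that [gmap s] maps one curve of moduli
    to the other one, up to a change of speed. *)
Lemma tangent_jacobian X Y X' Y' f s (k : C) :
  nondegenerate_curve X Y -> nondegenerate_curve X' Y' -> is_lft f ->
  (forall t i, f (hcurve X Y t i) = hcurve X' Y' (k * t) (s i)) ->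
  tangent X Y *m jacobian (gmap s) (moduli_curve X Y 0) = k *: tangent X' Y'.
Proof.
move=> nd nd' Lf fE; apply: jacobian_curve.
- by case: (moduli_curve_diff nd).
- by case: (moduli_curve_diff nd').
- by apply: differentiable_gmap; apply: modulus_K5; apply: hcurve_inj.
apply: filterS (near_nondegenerate nd) => t ndt.
rewrite gmap_modulus; last exact: hcurve_inj.
rewrite -(modulus_lft _ Lf); congr modulus; apply: funext => i /=.
by rewrite fE permKV.
Qed.

(** Relabelling the points acts on tangent vectors by a differential, so that the
    non-vanishing of a tangent vector can be checked for one labelling. *)
Lemma tangent_relabel X Y s : nondegenerate_curve X Y ->
  tangent (X \o s) (Y \o s) = 0 -> tangent X Y = 0.
Proof.
move=> nd t0.
have nds : nondegenerate_curve (X \o s) (Y \o s).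
  by move=> i j ij; apply: nd; rewrite (inj_eq perm_inj).
have := @tangent_jacobian (X \o s) (Y \o s) X Y id s 1 nds nd (is_lft_id R).
rewrite t0 mul0mx scale1r => <- // t i.
by rewrite mul1r.
Qed.

End Curves.

(** * Dihedral groups and their representations *)

Section DihedralGroup.
Variables (F : fieldType) (gT : finGroupType) (G : {group gT}) (p : nat) (w : F).
Variables (u : gT -> F) (e : gT -> bool) (r t : gT).
(* An element of a dihedral group is described by the multiplier u x of its rotation
   part and by the boolean e x telling whether it is a reflection. *)
Hypotheses (podd : odd p) (p1 : (1 < p)%N) (wp : p.-primitive_root w).
Hypotheses
  (uM : {in G &, forall x y, u (x * y)%g = u x * (if e x then (u y)^-1 else u y)})
  (eM : {in G &, forall x y, e (x * y)%g = e x (+) e y})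
  (up : {in G, forall x, u x ^+ p = 1})
  (ue_inj : {in G, forall x, u x = 1 -> e x = false -> x = 1%g})
  (rG : r \in G) (tG : t \in G)
  (ur : u r = w) (er : e r = false) (ut : u t = 1) (et : e t = true).

Lemma dih_e1 : e 1%g = false.
Proof. by have := eM (group1 G) (group1 G); rewrite mulg1; case: (e 1%g). Qed.

Lemma dih_u_neq0 x : x \in G -> u x != 0.
Proof.
move=> xG; apply: contraTneq (oner_neq0 F) => u0.
by rewrite -(up xG) u0 expr0n -leqn0 leqNgt (ltnW p1) eqxx.
Qed.

Lemma dih_u1 : u 1%g = 1.
Proof.
have := uM (group1 G) (group1 G); rewrite mulg1 dih_e1 => /esym/eqP.
rewrite -subr_eq0 -[X in _ - X]mulr1 -mulrBr mulf_eq0 (negPf (dih_u_neq0 _)) //=.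
by rewrite subr_eq0 => /eqP.
Qed.

(** The quotient of two elements with the same data is a rotation of multiplier
    one. *)
Lemma dih_inj : {in G &, forall x y, u x = u y -> e x = e y -> x = y}.
Proof.
move=> x y xG yG uxy exy; have zG : (x * y^-1)%g \in G by rewrite groupM ?groupV.
have xE : x = (x * y^-1 * y)%g by rewrite mulgKV.
have ez : e (x * y^-1)%g = false.
  by have := eM zG yG; rewrite -xE exy; case: (e y); case: (e _).
have uz : u (x * y^-1)%g = 1.
  apply: (mulIf (dih_u_neq0 yG)); rewrite mul1r -uxy.
  by have := uM zG yG; rewrite -xE ez uxy.
by rewrite xE (ue_inj zG uz ez) mul1g.
Qed.

Lemma dih_rX k : [/\ (r ^+ k)%g \in G, u (r ^+ k)%g = w ^+ k & e (r ^+ k)%g = false].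
Proof.
split; first exact: groupX.
  elim: k => [|k IHk]; first by rewrite expg0 dih_u1.
  by rewrite expgS uM ?groupX // er ur IHk exprS.
elim: k => [|k IHk]; first by rewrite expg0 dih_e1.
by rewrite expgS eM ?groupX // er IHk.
Qed.

Let word k (b : bool) : gT := (r ^+ k * (if b then t else 1))%g.

Let wordP k b : [/\ word k b \in G, u (word k b) = w ^+ k & e (word k b) = b].
Proof.
have [rkG urk erk] := dih_rX k.
have bG : (if b then t else 1%g) \in G by case: b.
split; rewrite /word; first by rewrite groupM.
  by rewrite uM // urk erk; case: b {bG}; rewrite ?ut ?dih_u1 mulr1.
by rewrite eM // erk; case: b {bG}; rewrite ?et ?dih_e1.
Qed.

Lemma dih_gen x : x \in G -> exists2 k : 'I_p, x = word k (e x) & u x = w ^+ k.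
Proof.
move=> xG; have [k uk] := prim_rootP wp (up xG).
have [wG uw ew] := wordP k (e x).
by exists k => //; apply: dih_inj; rewrite ?uw ?ew.
Qed.

Lemma dih_card : #|G| = p.*2.
Proof.
pose h (kb : 'I_p * bool) := word kb.1 kb.2.
have hinj : injective h.
  move=> [k b] [k' b'] /= hE.
  have [_ ua ea] := wordP k b; have [_ ub eb] := wordP k' b'.
  rewrite /h /= in hE; rewrite hE in ua ea.
  suff -> : k = k' by rewrite -ea eb.
  apply/val_inj; have /eqP : w ^+ k = w ^+ k' by rewrite -ua -ub.
  by rewrite (eq_prim_root_expr wp) !modn_small // => /eqP.
have -> : #|G| = #|h @: [set: 'I_p * bool]%SET|.
  apply: eq_card => x; apply/idP/imsetP => [/dih_gen[k xE _]|[[k b] _ ->]].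
    by exists (k, e x); [rewrite inE|exact: xE].
  by case: (wordP k b).
by rewrite card_imset // cardsT card_prod card_ord card_bool muln2.
Qed.

Lemma dih_involution x : x \in G -> e x -> (x * x)%g = 1%g.
Proof.
move=> xG ex; apply: ue_inj; rewrite ?groupM ?uM ?eM ?ex //.
by rewrite divff // dih_u_neq0.
Qed.

(** A rotation of order dividing two is trivial, since [p] is odd. *)
Lemma dih_order2 x : x \in G -> (#[x]%g == 2%N) = e x.
Proof.
move=> xG; apply/eqP/idP => [x2|ex].
  apply/negPn/negP => /negPf ex; have := expg_order x; rewrite x2 => xx.
  have u2 : u x ^+ 2 = 1 by rewrite expr2 -[RHS]dih_u1 -xx expgS expg1 uM // ex.
  have ux : u x = 1.
    have := up xG; rewrite -(odd_double_half p) podd add1n exprS -muln2 mulnC exprM u2.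
    by rewrite expr1n mulr1.
  by have := x2; rewrite (ue_inj xG ux ex) order1.
apply: nt_prime_order => //; first by rewrite expgS expg1 dih_involution.
by apply: contraTneq ex => ->; rewrite dih_e1.
Qed.

(** The generators satisfy the relations of the dihedral group, which has the
    same order. *)
Lemma dih_isog : G \isog [set: dihedral_gtype p.*2]%G.
Proof.
apply/(isoGrpP _ (Grp_dihedral p1)); split.
  by rewrite dih_card card_dihedral.
apply/existsP; exists (r, t) => /=; rewrite !xpair_eqE.
have rp : (r ^+ p)%g = 1%g.
  have [rkG urk erk] := dih_rX p.
  by apply: ue_inj => //; rewrite urk prim_expr_order.
have t2 : (t ^+ 2)%g = 1%g by rewrite expgS expg1 dih_involution.
have rt : (r ^ t)%g = (r^-1)%g.
  have tV : (t^-1)%g = t by apply/eqP; rewrite eq_invg_mul dih_involution ?et.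
  have rtrt := @dih_involution (r * t)%g; rewrite groupM // eM // er et in rtrt.
  apply/eqP; rewrite eq_sym eq_invg_mul conjgE tV !mulgA.
  by rewrite -[X in X == _]mulgA -[(_ * t * _)%g]mulgA mulgA rtrt.
rewrite rp t2 rt !eqxx !andbT finset.eqEsubset.
rewrite join_subG !cycle_subG rG tG /=; apply/fintype.subsetP => x /dih_gen[k -> _].
rewrite groupM //; first by rewrite groupX // mem_gen // inE cycle_id.
by case: (e x) => //; rewrite mem_gen // inE cycle_id orbT.
Qed.

Definition mx2 (a b c d : F) : 'M[F]_(1 + 1) := block_mx a%:M b%:M c%:M d%:M.

Lemma mx2M a b c d a' b' c' d' : mx2 a b c d *m mx2 a' b' c' d' =
  mx2 (a * a' + b * c') (a * b' + b * d') (c * a' + d * c') (c * b' + d * d').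
Proof. by rewrite /mx2 mulmx_block -!scalar_mxM -!raddfD. Qed.

Lemma mx2_tr a b c d : \tr (mx2 a b c d) = a + d.
Proof. by rewrite /mx2 mxtrace_block !mxtrace_scalar !mulr1n. Qed.

Definition dih_mx j x : 'M[F]_(1 + 1) :=
  if e x then mx2 0 (u x ^+ j) (u x ^- j) 0 else mx2 (u x ^+ j) 0 0 (u x ^- j).

Lemma dih_mx_repr j : mx_repr G (dih_mx j).
Proof.
split=> [|x y xG yG].
  rewrite /dih_mx dih_e1 dih_u1 expr1n invr1 /mx2.
  by rewrite [RHS]scalar_mx_block raddf0.
rewrite /dih_mx uM // eM //.
case: (e x); case: (e y) => /=; rewrite mx2M !mul0r !mulr0 ?addr0 ?add0r;
  by rewrite ?exprMn ?invfM ?exprVn ?invrK.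
Qed.

Definition dih_rep j : representation F G :=
  Representation (MxRepresentation (dih_mx_repr j)).

Lemma sign_mx_repr : mx_repr G (fun x => (if e x then - 1 else 1)%:M : 'M[F]_1).
Proof.
split=> [|x y xG yG]; first by rewrite dih_e1.
rewrite eM // -scalar_mxM; congr (_%:M).
by case: (e x); case: (e y); rewrite /= ?mulrNN ?mulr1 ?mul1r.
Qed.

Definition sign_rep : representation F G :=
  Representation (MxRepresentation sign_mx_repr).

Lemma triv_mx_repr : mx_repr G (fun _ : gT => 1%:M : 'M[F]_1).
Proof. by split=> // x y _ _; rewrite mulmx1. Qed.

Definition triv_rep : representation F G :=
  Representation (MxRepresentation triv_mx_repr).

(** An invariant subspace contains, with a vector, its components on the two
    distinct eigenlines of the rotation; the involution exchanges these. *)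
Lemma dih_rep_irr j : (w ^+ j) ^+ 2 != 1 -> mx_irreducible (dih_rep j).
Proof.
move=> wj; apply/mx_irrP; split=> // U /mxmoduleP Umod.
have w0 : w ^+ j != 0.
  by apply: contraNneq wj => w0; move: (up rG); rewrite ur => /(congr1 (fun z => z ^+ j));
    rewrite -exprM mulnC exprM w0 expr1n expr0n gtn_eqF ?(ltnW p1) // => /eqP;
    rewrite eq_sym oner_eq0.
have wd : w ^+ j - w ^- j != 0.
  rewrite subr_eq0; apply: contraNneq wj => wE.
  by rewrite expr2 {1}wE mulVf.
case/rowV0Pn => v vU v0.
pose v1 : 'M[F]_1 := lsubmx (v : 'rV_(1 + 1)); pose v2 : 'M[F]_1 := rsubmx (v : 'rV_(1 + 1)).
have vE : v = row_mx v1 v2 by rewrite hsubmxK.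
have stab x z : x \in G -> (z <= U)%MS -> (z *m dih_mx j x <= U)%MS.
  by move=> xG zU; apply: submx_trans (Umod x xG); apply: submxMr.
have tact (z1 z2 : 'M[F]_1) : row_mx z1 z2 *m dih_mx j t = row_mx z2 z1.
  rewrite /dih_mx et ut expr1n invr1 /mx2 mul_row_block raddf0.
  by rewrite !mulmx0 !mulmx1 add0r addr0.
have ract (z1 z2 : 'M[F]_1) : row_mx z1 z2 *m dih_mx j r =
    row_mx (w ^+ j *: z1) (w ^- j *: z2).
  rewrite /dih_mx er ur /mx2 mul_row_block raddf0.
  by rewrite !mulmx0 !mul_mx_scalar add0r addr0.
have c1 : (row_mx v1 0 <= U)%MS.
  have : ((w ^+ j - w ^- j)^-1 *: (v *m dih_mx j r - w ^- j *: v) <= U)%MS.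
    by rewrite scalemx_sub // addmx_sub ?stab // eqmx_opp scalemx_sub.
  rewrite vE ract scale_row_mx opp_row_mx add_row_mx subrr -scalerBl scale_row_mx.
  by rewrite scaler0 scalerA mulVf // scale1r.
have c2 : (row_mx 0 v2 <= U)%MS.
  have -> : row_mx 0 v2 = v - row_mx v1 0.
    by rewrite vE opp_row_mx add_row_mx subrr oppr0 addr0.
  by rewrite addmx_sub // eqmx_opp.
have full (z : 'M[F]_1) : z != 0 -> (row_mx z 0 <= U)%MS -> row_full U.
  move=> z0 zU.
  have z00 : z 0 0 != 0.
    by apply: contraNneq z0 => z00; apply/eqP/matrixP => i i'; rewrite !ord1 z00 mxE.
  have e1 : (row_mx (1%:M : 'M[F]_1) 0 <= U)%MS.
    have -> : row_mx (1%:M : 'M[F]_1) 0 = (z 0 0)^-1 *: row_mx z (0 : 'M[F]_1).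
      rewrite scale_row_mx scaler0; congr row_mx.
      by apply/matrixP => i i'; rewrite !ord1 !mxE eqxx mulVf.
    by rewrite scalemx_sub.
  have e2 : (row_mx (0 : 'M[F]_1) 1%:M <= U)%MS by rewrite -tact stab.
  by rewrite -sub1mx scalar_mx_block /block_mx col_mx_sub e1 e2.
have [v10|v10] := eqVneq v1 0; last exact: full v10 c1.
apply: (full v2); last by rewrite -(tact 0 v2) stab.
by apply: contraNneq v0 => v20; rewrite vE v10 v20 row_mx0.
Qed.

End DihedralGroup.

(** * Direct sums of representations *)

Section DirectSums.
Variables (F : fieldType) (gT : finGroupType) (G : {group gT}).
Implicit Types r : representation F G.

Lemma rsim_dadd0l r : mx_rsim (dadd_grepr (grepr0 (G := G)) r) r.
Proof.
exists (1%:M : 'M[F]_(rdegree r, rdegree r)) => // [|x xG].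
  by rewrite row_free_unit unitmx1.
rewrite mulmx1 mul1mx /=; apply/matrixP => a b; rewrite !mxE.
case: splitP => [[]//|k ak]; rewrite mxE; case: splitP => [[]//|k' bk].
by congr (r x _ _); apply/val_inj.
Qed.

Lemma rsim_dadd0r r : mx_rsim (dadd_grepr r (grepr0 (G := G))) r.
Proof.
exists (col_mx 1%:M 0 : 'M[F]_(rdegree r + 0, rdegree r)) => [||x xG].
  by rewrite /= addn0.
  by apply/row_freeP; exists (row_mx 1%:M 0); rewrite mul_col_row !mulmx1 mul0mx
    [X in _ = X]scalar_mx_block; congr block_mx; apply/matrixP => a [].
by rewrite /= mul_block_col !mulmx1 !mulmx0 ?mul0mx !addr0 mul_col_mx mul1mx mul0mx.
Qed.

Lemma rsim_dadd r1 r2 r1' r2' : mx_rsim r1 r1' -> mx_rsim r2 r2' ->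
  mx_rsim (dadd_grepr r1 r2) (dadd_grepr r1' r2').
Proof.
move=> [B1 e1 f1 h1] [B2 e2 f2 h2].
exists (block_mx B1 0 0 B2); first by rewrite /= e1 e2.
  have /row_freeP[D1 D1E] := f1; have /row_freeP[D2 D2E] := f2.
  apply/row_freeP; exists (block_mx D1 0 0 D2).
  by rewrite mulmx_block !mulmx0 !mul0mx !addr0 add0r D1E D2E -scalar_mx_block.
move=> x xG /=.
by rewrite !mulmx_block !mulmx0 !mul0mx !addr0 !add0r h1 // h2.
Qed.

Lemma rsim_muln0 r : mx_rsim (muln_grepr r 0) (grepr0 (G := G)).
Proof. by rewrite /muln_grepr big_ord0; exact: mx_rsim_refl. Qed.

Lemma rsim_muln1 r : mx_rsim (muln_grepr r 1) r.
Proof. by rewrite /muln_grepr big_ord_recl big_ord0; exact: rsim_dadd0r. Qed.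

Lemma rsim_sum_cons0 (X : nat -> representation F G) (a : seq nat) :
  mx_rsim (\big[dadd_grepr/grepr0]_(j < size (0%N :: a)) muln_grepr (X j.+1) (nth 0%N (0%N :: a) j))
          (\big[dadd_grepr/grepr0]_(j < size a) muln_grepr (X j.+2) (nth 0%N a j)).
Proof.
rewrite big_ord_recl; apply: mx_rsim_trans (rsim_dadd0l _).
by apply: rsim_dadd (mx_rsim_refl _); exact: rsim_muln0.
Qed.

Lemma rsim_sum_cons1 (X : nat -> representation F G) (a : seq nat) r :
  mx_rsim (\big[dadd_grepr/grepr0]_(j < size a) muln_grepr (X j.+2) (nth 0%N a j)) r ->
  mx_rsim (\big[dadd_grepr/grepr0]_(j < size (1%N :: a)) muln_grepr (X j.+1) (nth 0%N (1%N :: a) j))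
    (dadd_grepr (X 1%N) r).
Proof.
by move=> ar; rewrite big_ord_recl; apply: rsim_dadd; [exact: rsim_muln1|].
Qed.

Lemma rsim_sum_nseq0 (X : nat -> representation F G) (n : nat) :
  mx_rsim (\big[dadd_grepr/grepr0]_(j < size (nseq n 0%N)) muln_grepr (X j.+1) (nth 0%N (nseq n 0%N) j))
    (grepr0 (G := G)).
Proof.
elim: n X => [|n IHn] X; first by rewrite big_ord0; exact: mx_rsim_refl.
exact: mx_rsim_trans (rsim_sum_cons0 X _) (IHn (fun j => X j.+1)).
Qed.

(** Shape of the multiplicity vector of an irreducible representation: a single
    [1], in position [m.+1]. *)
Lemma rsim_sum1 (X : nat -> representation F G) (m n : nat) :
  mx_rsim (X m.+1) (\big[dadd_grepr/grepr0]_(j < size (nseq m 0 ++ 1 :: nseq n 0)%N)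
    muln_grepr (X j.+1) (nth 0%N (nseq m 0 ++ 1 :: nseq n 0)%N j)).
Proof.
apply: mx_rsim_sym; elim: m X => [|m IHm] X /=.
  apply: mx_rsim_trans (rsim_dadd0r _); apply: rsim_sum_cons1.
  exact: (rsim_sum_nseq0 (fun j => X j.+1)).
exact: mx_rsim_trans (rsim_sum_cons0 X _) (IHm (fun j => X j.+1)).
Qed.

Lemma rsim_sum11 (X : nat -> representation F G) (n : nat) :
  mx_rsim (dadd_grepr (X 1%N) (X 2%N))
   (\big[dadd_grepr/grepr0]_(j < size [:: 1, 1 & nseq n 0]%N)
    muln_grepr (X j.+1) (nth 0%N [:: 1, 1 & nseq n 0]%N j)).
Proof.
apply: mx_rsim_sym; apply: rsim_sum_cons1.
exact: mx_rsim_sym (rsim_sum1 (fun j => X j.+1) 0 n).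
Qed.

End DirectSums.

(** * Deformations of a configuration *)

Section Deformations.
Variable R : realType.
Local Notation C := R[i].
Local Notation S2 := (sphere R).
Implicit Types (f : S2 -> S2) (c : 'I_5 -> S2) (v : S2 -> C * C).

Definition lin (a b : C) : {poly C} := a%:P + b *: 'X.

Lemma linE a b t : (lin a b).[t] = a + b * t.
Proof. by rewrite /lin !hornerE. Qed.

Lemma lin_deriv a b t : (lin a b)^`().[t] = b.
Proof. by rewrite /lin derivD derivC derivZ derivX !hornerE. Qed.

(** Each point moves along a line in homogeneous coordinates; this treats the point
    at infinity like the other ones. *)
Definition deform v (t : C) (z : S2) : S2 :=
  hproj (hx z + (v z).1 * t) (hy z + (v z).2 * t).

Definition deformX v c i := lin (hx (c i)) (v (c i)).1.
Definition deformY v c i := lin (hy (c i)) (v (c i)).2.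

Lemma hcurveE v c t : hcurve (deformX v c) (deformY v c) t = deform v t \o c.
Proof. by apply: funext => i; rewrite /hcurve /deformX /deformY !linE. Qed.

Lemma deform0 v z : deform v 0 z = z.
Proof.
rewrite /deform !mulr0 !addr0 /hproj; case: z => [z|] /=; last by rewrite eqxx.
by rewrite oner_eq0 divr1.
Qed.

Lemma deform_nondegenerate v c : injective c -> nondegenerate_curve (deformX v c) (deformY v c).
Proof.
move=> ci i j ij; rewrite /hwedge hornerD hornerN !hornerM /deformX /deformY !linE !mulr0 !addr0.
by rewrite -/(wedge (c i) (c j)) wedge_eq0 (inj_eq ci).
Qed.

Definition velocity v c := tangent (deformX v c) (deformY v c).

(** The derivative at time [0] of [wedge] along the deformation. *)
Definition dwedge v (y z : S2) : C :=
  (v y).1 * hy z + hx y * (v z).2 - (v z).1 * hy y - hx z * (v y).2.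

Lemma hwedge_deform v c i j :
  (hwedge (deformX v c) (deformY v c) i j).[0] = wedge (c i) (c j) /\
  (hwedge (deformX v c) (deformY v c) i j)^`().[0] = dwedge v (c i) (c j).
Proof.
rewrite /hwedge derivB !derivM; split; rewrite hornerD hornerN ?hornerM.
  by rewrite !linE !mulr0 !addr0.
rewrite !(hornerD (_ * _)) !hornerM !linE !lin_deriv !mulr0 !addr0 /dwedge.
by ring.
Qed.

(** The assumption is that the numerator of the derivative of the first
    cross-ratio does not vanish. *)
Lemma velocity_neq0 v c (p q r x : S2) : injective c ->
  c (inord 0) = p -> c (inord 1) = q -> c (inord 2) = r -> c (inord 3) = x ->
  (dwedge v q r * wedge x p + wedge q r * dwedge v x p) * (wedge q p * wedge x r)
  - (wedge q r * wedge x p) * (dwedge v q p * wedge x r + wedge q p * dwedge v x r) != 0 ->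
  velocity v c <> 0.
Proof.
move=> ci <- <- <- <- + v0.
have nd := deform_nondegenerate v ci.
have [_ /(_ 0)] := moduli_curve_diff nd; rewrite -/(velocity v c) v0 mxE.
move=> /esym/eqP; rewrite mulf_eq0 invr_eq0 expf_eq0 (negPf (cr_den0 0 nd)) /= orbF.
rewrite /cr_num /cr_den !derivM !(hornerD (_ * _)) !hornerM.
rewrite !(hwedge_deform v c _ _).1 !(hwedge_deform v c _ _).2.
by move=> ->.
Qed.

Lemma range_relabel (c c0 : 'I_5 -> S2) : injective c0 -> range c = range c0 ->
  exists s : {perm 'I_5}, forall i, c (s i) = c0 i.
Proof.
move=> c0i rc; have ex j : exists i, c i = c0 j.
  by have [i _ ij] : range c (c0 j) by [rewrite rc; exists j]; exists i.
pose h j := xget j [set i | c i = c0 j].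
have hE j : c (h j) = c0 j.
  by rewrite /h; case: xgetP => // /(_ _) no; have [i /no] := ex j.
have hinj : injective h by move=> i j hij; apply: c0i; rewrite -!hE hij.
by exists (perm hinj) => j; rewrite permE.
Qed.

Lemma velocity_relabel v c c0 : injective c -> injective c0 -> range c = range c0 ->
  velocity v c0 <> 0 -> velocity v c <> 0.
Proof.
move=> ci c0i rc v0 vc; have [s sE] := range_relabel c0i rc; apply: v0.
apply: (@tangent_relabel _ (deformX v c0) (deformY v c0) (s^-1)%g).
  exact: deform_nondegenerate.
rewrite (_ : deformX v c0 \o _ = deformX v c); last first.
  by apply: funext => i; rewrite /deformX /= -sE permKV.
rewrite (_ : deformY v c0 \o _ = deformY v c) //.
by apply: funext => i; rewrite /deformY /= -sE permKV.
Qed.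

Section Action.
Variables (l : 'rV[C]_2) (psi : S2 -> S2).
Hypotheses (Kl : K5 l) (Lpsi : is_lft psi).
Local Notation G := (stab_group l).
Local Notation c := (psi \o zpt l).

Definition chart_action (x : Gtype R) : S2 -> S2 := psi \o Phi l x \o linv psi.

Lemma chart_inj : injective c.
Proof. exact: inj_comp (is_lft_inj Lpsi) (zpt_inj Kl). Qed.

Lemma range_chart : range c = psi @` zset l.
Proof. by rewrite /zset image_comp. Qed.

Lemma action_chart x i : x \in G -> chart_action x (c i) = c (Gperm x i).
Proof.
have [_ K K'] := is_lft_linv Lpsi.
by move=> xG; rewrite /chart_action /= K Phi_zpt.
Qed.

Lemma is_lft_action x : is_lft (chart_action x).
Proof.
have [Lk _ _] := is_lft_linv Lpsi.
by apply: is_lft_comp => //; apply: is_lft_comp => //; apply: is_lft_Phi.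
Qed.

Lemma action_autgrp x : x \in G -> autgrp (psi @` zset l) (chart_action x).
Proof. by move=> xG; apply: autgrp_conjP => //; apply: Phi_autgrp. Qed.

Lemma action_surj f : autgrp (psi @` zset l) f -> exists2 x, x \in G & chart_action x = f.
Proof.
have [Lk K K'] := is_lft_linv Lpsi.
have E : linv psi @` (psi @` zset l) = zset l.
  rewrite image_comp (_ : linv psi \o psi = id) ?image_id //.
  by apply: funext => z /=; rewrite K.
move=> /(autgrp_conjP Lk E)/(Phi_surj Kl)[x xG xE]; exists x => //.
have [_ k k'] := is_lft_linv Lk.
apply: funext => z; rewrite /chart_action xE /= K'.
by rewrite -[in LHS](K' z) k K'.
Qed.

Lemma action_inj : {in G &, injective chart_action}.
Proof.
have [Lk K K'] := is_lft_linv Lpsi.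
move=> x y xG yG E; apply: (Phi_inj Kl) => //; apply: funext => z.
by apply: (is_lft_inj Lpsi); have := congr1 (@^~ (psi z)) E; rewrite /chart_action /= K.
Qed.

Lemma actionM : {in G &, forall x y, chart_action (x * y)%g = chart_action x \o chart_action y}.
Proof.
have [Lk K K'] := is_lft_linv Lpsi.
by move=> x y xG yG; rewrite /chart_action PhiM //; apply: funext => z /=; rewrite K.
Qed.

(** [Xmx] acts on columns, hence the transposes. *)
Lemma Xmx_velocity x v v' (k : C) : x \in G ->
  (forall t i, chart_action x (deform v t (c i)) = deform v' (k * t) (chart_action x (c i))) ->
  Xmx l x *m (velocity v c)^T = k *: (velocity v' c)^T.
Proof.
move=> xG xv; rewrite /Xmx -trmx_mul -linearZ /=; congr (_^T).
have cl : moduli_curve (deformX v c) (deformY v c) 0 = l.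
  rewrite /moduli_curve hcurveE -[RHS]modulus_zpt -[RHS](modulus_lft _ Lpsi).
  by congr modulus; apply: funext => i /=; rewrite deform0.
rewrite -Gfun_perm -[X in jacobian _ X]cl.
apply: (tangent_jacobian (deform_nondegenerate v chart_inj) (deform_nondegenerate v' chart_inj)
  (is_lft_action x)) => t i.
by rewrite !hcurveE /= -[psi (zpt l _)]/(c _) xv action_chart.
Qed.

End Action.

(** The point [z] moves to [z (1 + t z ^+ m) / (1 - t z ^+ m)]. This form makes the
    effect of the inversion exact, and not only true to first order. *)
Definition rot_field (m : nat) (z : S2) : C * C :=
  if z is Some z then (z ^+ m.+1, - z ^+ m) else (0, 0).
Definition cubic_field (z : S2) : C * C := if z is Some z then (z ^+ 3, 0) else (0, 0).
Definition origin_field (z : S2) : C * C :=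
  if z is Some z then ((z == 0)%:R, 0) else (0, 0).

Lemma scaling_hproj (a x y : C) : scaling a (hproj x y) = hproj (a * x) y.
Proof.
by rewrite /hproj; case: eqP => _; rewrite ?scaling_None ?scaling_Some ?mulrA.
Qed.

Lemma inversion_hproj (x y : C) : (x != 0) || (y != 0) ->
  @inversion R (hproj x y) = hproj y x.
Proof.
rewrite /hproj; case: (eqVneq y 0) => [->|y0] /=.
  by rewrite orbF inversion_None => /negPf->; rewrite mul0r.
move=> _; rewrite inversion_Some mulf_eq0 invr_eq0 (negPf y0) orbF.
by case: eqP => // _; rewrite invf_div.
Qed.

Lemma deform_scaling v v' (k a z t : C) :
  a * (v (Some z)).1 = (v' (Some (a * z))).1 * k ->
  (v (Some z)).2 = (v' (Some (a * z))).2 * k ->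
  scaling a (deform v t (Some z)) = deform v' (k * t) (scaling a (Some z)).
Proof.
move=> e1 e2; rewrite scaling_Some /deform /= scaling_hproj mulrDr !mulrA e1 e2.
by [].
Qed.

Lemma deform_scaling_None v v' (k a t : C) : v None = (0, 0) -> v' None = (0, 0) ->
  scaling a (deform v t None) = deform v' (k * t) (scaling a None).
Proof.
move=> e e'; rewrite scaling_None /deform e e' /= !mul0r !addr0.
by rewrite /hproj eqxx scaling_None.
Qed.

Lemma rot_field_scaling p m (u t : C) (z : S2) : u ^+ p = 1 -> (0 < m < p)%N ->
  scaling u (deform (rot_field m) t z) =
  deform (rot_field m) (u ^+ (p - m) * t) (scaling u z).
Proof.
move=> up /andP[m0 mp]; have um : u ^+ m * u ^+ (p - m) = 1.
  by rewrite -exprD subnKC // ltnW.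
case: z => [z|]; last exact: deform_scaling_None.
apply: deform_scaling => /=; rewrite !exprMn.
  rewrite [u ^+ m.+1]exprS -[LHS]mul1r -um; set U := u ^+ (p - m); set V := z ^+ m.+1.
  by ring.
rewrite -[LHS]mul1r -um; set U := u ^+ (p - m); set V := z ^+ m.
by ring.
Qed.

(** At a p-th root of unity [b], [b ^- m] is [b ^+ (p - m)]: the inversion turns the
    field of index [m] into that of index [p - m], run backwards. *)
Lemma rot_field_inversion p m (t : C) (z : S2) : (0 < m < p)%N ->
  [\/ z = None, z = Some 0 | exists2 b, z = Some b & b ^+ p = 1] ->
  @inversion R (deform (rot_field m) t z) =
  deform (rot_field (p - m)) (- 1 * t) (@inversion R z).
Proof.
move=> /andP[m0 mp]; have pm0 : (0 < p - m)%N by rewrite subn_gt0.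
case=> [->|->|[b -> bp]].
- rewrite inversion_None /deform /= !mul0r !addr0 inversion_hproj ?oner_eq0 //.
  by rewrite !expr0n /= !gtn_eqF // oppr0 !mul0r !addr0.
- rewrite inversion_Some eqxx /deform /= !expr0n /= gtn_eqF // oppr0 !mul0r !addr0.
  by rewrite inversion_hproj ?oner_eq0 ?orbT.
have b0 : b != 0.
  by apply: contraTneq (oner_neq0 C) => b0; rewrite -bp b0 expr0n gtn_eqF ?eqxx // (leq_trans m0 (ltnW mp)).
rewrite inversion_Some (negPf b0) /deform /= inversion_hproj.
  rewrite -(hprojZ _ _ (_ : b^-1 != 0)) ?invr_eq0 //.
  have bm : b^-1 ^+ (p - m) = b ^+ m.
    rewrite exprVn; apply: (mulIf (expf_neq0 (p - m) b0)).
    by rewrite mulVf ?expf_neq0 // -exprD subnKC // ltnW.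
  congr hproj; rewrite ?exprS bm; field; exact: b0.
have [e|] := eqVneq (1 + - b ^+ m * t) 0; last by rewrite orbT.
rewrite orbF; apply: contraTneq (oner_neq0 C) => e'.
have e2 : 1 + b ^+ m * t = 0 by apply: (mulfI b0); rewrite mulr0 -e' exprS; ring.
have : 2%:R = 0 :> C by rewrite -[RHS](addr0 0) -[X in _ = X + _]e -e2; ring.
by move/eqP; rewrite pnatr_eq0.
Qed.

End Deformations.

(** * Multiplicities for cyclic stabilizers *)

Section Decompositions.
Variable R : realType.
Local Notation C := R[i].
Local Notation S2 := (sphere R).

(** [chi] maps the fixed points of one scaling, [0] and [oo], to those of the other
    one. *)
Lemma conj_scaling (chi : S2 -> S2) (a b : C) : is_lft chi -> b != 1 ->
  chi \o scaling a = scaling b \o chi ->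
  (chi (Some 0) = Some 0 /\ a = b) \/ (chi (Some 0) = None /\ a * b = 1).
Proof.
move=> Lchi b1 E; have inj := is_lft_inj Lchi.
have Ez z : chi (scaling a z) = scaling b (chi z) := congr1 (@^~ z) E.
have fixb z : scaling b z = z -> z = Some 0 \/ z = None.
  case: z => [z|]; last by right.
  rewrite scaling_Some => /Some_inj/eqP; rewrite -subr_eq0 -[X in _ - X]mul1r -mulrBl.
  by rewrite mulf_eq0 subr_eq0 (negPf b1) /= => /eqP->; left.
have f0 : chi (Some 0) = Some 0 \/ chi (Some 0) = None.
  by apply: fixb; rewrite -Ez scaling_Some mulr0.
have fo : chi None = Some 0 \/ chi None = None.
  by apply: fixb; rewrite -Ez scaling_None.
case: f0 => f0; [left|right]; split=> //.
  have {}fo : chi None = None by case: fo => // fo; have := inj _ _ (etrans fo (esym f0)).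
  have [k k0 chiE] := lft_0oo Lchi f0 fo.
  move: E; rewrite chiE !scalingM => /scaling_inj; rewrite mulrC => /(mulIf k0).
  by [].
have {}fo : chi None = Some 0 by case: fo => // fo; have := inj _ _ (etrans fo (esym f0)).
have [|||k k0 kE] := @lft_0oo _ (@inversion R \o chi).
- by apply: is_lft_comp => //; apply: is_lft_inversion.
- by rewrite /= f0 inversion_None.
- by rewrite /= fo inversion_Some eqxx.
have b0 : b != 0.
  apply: contraNneq k0 => b0; have := Ez (Some 1).
  have := congr1 (@^~ (Some 1)) kE; rewrite /= scaling_Some mulr1 => k1.
  case chi1 : (chi (Some 1)) => [y|]; last first.
    by have := inj _ _ (etrans chi1 (esym f0)) => /Some_inj/eqP; rewrite oner_eq0.
  rewrite b0 !scaling_Some mul0r mulr1 => chia.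
  by have := inj _ _ (etrans chia (esym fo)).
have : scaling k \o scaling a = scaling b^-1 \o scaling k.
  rewrite -kE; transitivity (@inversion R \o (chi \o scaling a)); first by [].
  by rewrite E; have := inversion_scaling b0 => /(congr1 (fun f => f \o chi)).
rewrite !scalingM => /scaling_inj; rewrite mulrC => /(mulIf k0) ->.
by rewrite mulVf.
Qed.

(** Applying [A - m1] to a linear relation removes its [t1] term. *)
Lemma eigen_unit (F : fieldType) (A : 'M[F]_2) (t1 t2 : 'cV[F]_2) (m1 m2 : F) :
  t1 != 0 -> t2 != 0 -> m1 != m2 -> A *m t1 = m1 *: t1 -> A *m t2 = m2 *: t2 ->
  (row_mx t1 t2 : 'M[_]_(2, 1 + 1)) \in unitmx.
Proof.
move=> t10 t20 m12 E1 E2; rewrite -unitmx_tr -row_free_unit.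
suff main (v : 'rV[F]_(1 + 1)) : v *m col_mx t1^T t2^T = 0 -> v = 0.
  by apply/inj_row_free => v v0; apply: main; rewrite -tr_row_mx.
pose a : 'M[F]_1 := lsubmx v; pose b : 'M[F]_1 := rsubmx v.
have vE : v = row_mx a b by rewrite hsubmxK.
rewrite vE mul_row_col (mx11_scalar a) (mx11_scalar b) !mul_scalar_mx.
set x := a 0 0; set y := b 0 0 => e0.
have e1 : x *: t1 + y *: t2 = 0 by apply: trmx_inj; rewrite linearD !linearZ /= e0 linear0.
have e2 : x *: (m1 *: t1) + y *: (m2 *: t2) = 0.
  by rewrite -E1 -E2 !scalemxAr -mulmxDr e1 mulmx0.
have y0 : y = 0.
  have : (y * (m2 - m1)) *: t2 = 0.
    rewrite -[RHS]e2 -[LHS]addr0 -[X in _ + X](scaler0 _ m1) -[X in _ + m1 *: X]e1.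
    rewrite scalerDr !scalerA addrC -addrA -scalerDl [m1 * x]mulrC; congr (_ + _ *: _).
    by ring.
  move/eqP; rewrite scaler_eq0 (negPf t20) orbF mulf_eq0 subr_eq0 [m2 == m1]eq_sym (negPf m12).
  by rewrite orbF => /eqP.
have x0 : x = 0.
  move: e1; rewrite y0 scale0r addr0 => /eqP.
  by rewrite scaler_eq0 (negPf t10) orbF => /eqP.
by rewrite x0 y0 !raddf0 row_mx0.
Qed.

Lemma mul_row_mx2 (F : fieldType) (A : 'M[F]_2) (t1 t2 : 'cV[F]_2) (a b c d : F) :
  A *m t1 = a *: t1 + c *: t2 -> A *m t2 = b *: t1 + d *: t2 ->
  A *m (row_mx t1 t2 : 'M[F]_(2, 1 + 1)) = (row_mx t1 t2 : 'M[F]_(2, 1 + 1)) *m mx2 a b c d.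
Proof.
move=> E1 E2; rewrite (@mul_mx_row F 2 2 1 1) (@mul_row_block F 2 1 1 1 1) E1 E2.
by rewrite !mul_mx_scalar.
Qed.

(** A change of basis [B] turns the Jacobian matrices into a known
    representation. *)
Lemma decomposes_basis (l : 'rV[C]_2) (X : nat -> representation C (stab_group l))
    (a : seq nat) (r2 : mx_representation C (stab_group l) 2) (B : 'M[C]_2) :
  B \in unitmx -> (forall x, x \in stab_group l -> Xmx l x *m B = B *m r2 x) ->
  mx_rsim r2 (\big[dadd_grepr/grepr0]_(j < size a) muln_grepr (X j.+1) (nth 0%N a j)) ->
  decomposes X a.
Proof.
move=> uB XB r2X; exists (rconj_repr r2 uB); split=> [x xG|].
  by rewrite rconj_mxE -XB // mulmxK.
apply: mx_rsim_trans r2X; exists B => // [|x xG]; first by rewrite row_free_unit.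
by rewrite rconj_mxE mulmxKV.
Qed.

Section Cyclic.
Variables (p : nat) (l : 'rV[C]_2) (a : C) (psi : S2 -> S2).
Local Notation w := (omega R p).
Local Notation G := (stab_group l).
Local Notation c := (psi \o zpt l).
Hypotheses (Kl : K5 l) (Lpsi : is_lft psi) (psiS : psi @` zset l = symset a)
  (ga : generic a) (p1 : (1 < p)%N) (p4 : (p %| 4)%N) (wp : p.-primitive_root w)
  (Mw : autgrp (symset a) (scaling w))
  (Mgen : forall f, autgrp (symset a) f -> exists k, f = scaling (w ^+ k)).

(* the multiplier of the rotation induced by x *)
Let u (x : Gtype R) : C := odflt 1 (chart_action l psi x (Some 1)).

Let uP x : x \in G -> chart_action l psi x = scaling (u x) /\ exists k, u x = w ^+ k.
Proof.
move=> xG; have [|k xE] := Mgen (f := chart_action l psi x).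
  by rewrite -psiS; apply: action_autgrp.
by rewrite /u xE scaling_Some mulr1 /=; split=> //; exists k.
Qed.

Let u_eq x v : chart_action l psi x = scaling v -> u x = v.
Proof. by rewrite /u => ->; rewrite scaling_Some mulr1. Qed.

Let uM : {in G &, forall x y, u (x * y)%g = u x * u y}.
Proof.
move=> x y xG yG; apply: u_eq; rewrite actionM //.
by rewrite (uP xG).1 (uP yG).1 scalingM.
Qed.

Let u1 : u 1%g = 1.
Proof.
have := uM (group1 G) (group1 G); rewrite mulg1 => /esym/eqP.
have [_ [k uk]] := uP (group1 G).
have u0 : u 1%g != 0 by rewrite uk expf_neq0 // (omega_neq0 R (ltnW p1)).
by rewrite -subr_eq0 -[X in _ - X]mulr1 -mulrBr mulf_eq0 (negPf u0) subr_eq0 => /eqP.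
Qed.

Let uX x k : x \in G -> u (x ^+ k)%g = u x ^+ k.
Proof.
move=> xG; elim: k => [|k IHk]; first by rewrite expg0 u1.
by rewrite expgS uM ?groupX // IHk exprS.
Qed.

Let u_inj : {in G &, injective u}.
Proof.
move=> x y xG yG uxy; apply: (action_inj Kl Lpsi) => //.
by rewrite (uP xG).1 (uP yG).1 uxy.
Qed.

Let gen_exists : exists2 r, r \in G & u r = w.
Proof.
have [|r rG rE] := action_surj Kl Lpsi (f := scaling w); first by rewrite psiS.
by exists r => //; apply: u_eq.
Qed.

Lemma cyclic_stab_isog : G \isog Zp p.
Proof.
have [r rG ur] := gen_exists.
have ro : #[r]%g = p.
  apply/eqP; rewrite eqn_dvd; apply/andP; split.
    rewrite order_dvdn; apply/eqP/u_inj; rewrite ?groupX // uX // ur u1.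
    exact: prim_expr_order.
  by rewrite (prim_order_dvd wp) -ur -uX // expg_order u1.
have -> : stab_group l = <[r]>%G.
  apply/group_inj/setP => x; apply/idP/idP => [xG|]; last first.
    by apply: fintype.subsetP; rewrite cycle_subG.
  have [_ [k uk]] := uP xG.
  have -> : x = (r ^+ k)%g by apply: u_inj; rewrite ?groupX // uX // ur.
  exact: mem_cycle.
by rewrite isog_sym; have := Zp_isog r; rewrite ro.
Qed.

Let Xmx1 x : x \in G ->
  Xmx l x *m (velocity (@origin_field R) c)^T = u x *: (velocity (@origin_field R) c)^T.
Proof.
move=> xG; apply: Xmx_velocity => // t i; rewrite (uP xG).1.
have u0 : u x != 0.
  by have [_ [k ->]] := uP xG; rewrite expf_neq0 // (omega_neq0 R (ltnW p1)).
case ci : (c i) => [z|]; last exact: deform_scaling_None.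
apply: deform_scaling; rewrite /= ?mul0r // mulf_eq0 (negPf u0) /=.
by rewrite mulrC.
Qed.

(* The eigenvalue is u x ^- 2, which is u x ^+ 2 because p divides four. *)
Let Xmx2 x : x \in G ->
  Xmx l x *m (velocity (@cubic_field R) c)^T = (u x ^+ 2) *: (velocity (@cubic_field R) c)^T.
Proof.
move=> xG; apply: Xmx_velocity => // t i; rewrite (uP xG).1.
have u4 : u x ^+ 4 = 1.
  have [_ [k ->]] := uP xG; rewrite exprAC.
  have -> : w ^+ 4 = 1 by apply/eqP; rewrite -(prim_order_dvd wp).
  exact: expr1n.
case ci : (c i) => [z|]; last exact: deform_scaling_None.
apply: deform_scaling; rewrite /= ?mul0r // exprMn.
by rewrite -[LHS]mul1r -u4; ring.
Qed.

Let c0 (i : 'I_5) : S2 := nth None [:: Some 0; Some 1; Some (- 1); Some a; Some (- a)] i.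

Let c0_inj : injective c0.
Proof.
apply: nth5_inj => //.
have -> : [:: Some 0; Some 1; Some (- 1); Some a; Some (- a)] =
  map Some [:: 0; 1; - 1; a; - a] by [].
by rewrite map_inj_uniq ?sym_uniq // => x y /Some_inj.
Qed.

Let c0_range : range c = range c0.
Proof. by rewrite range_chart psiS range_nth5. Qed.

Let v1_neq0 : (velocity (@origin_field R) c)^T != 0.
Proof.
rewrite trmx_eq0; apply/eqP; apply: velocity_relabel c0_inj c0_range _; first exact: chart_inj.
have [/eqP a0 /eqP a1 /eqP aN1] := ga.
apply: (velocity_neq0 (p := Some 0) (q := Some 1) (r := Some (- 1)) (x := Some a)) => //;
  rewrite /c0 ?inordK //.
rewrite /dwedge /wedge /= eqxx oner_eq0 oppr_eq0 oner_eq0 (negPf a0) /=.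
rewrite (_ : _ - _ = 2 * (a - 1) * (a + 1)); last by ring.
by rewrite !mulf_neq0 ?pnatr_eq0 // ?subr_eq0 // addr_eq0.
Qed.

Let v2_neq0 : (velocity (@cubic_field R) c)^T != 0.
Proof.
rewrite trmx_eq0; apply/eqP; apply: velocity_relabel c0_inj c0_range _; first exact: chart_inj.
have [/eqP a0 /eqP a1 /eqP aN1] := ga.
apply: (velocity_neq0 (p := Some 0) (q := Some 1) (r := Some (- 1)) (x := Some a)) => //;
  rewrite /c0 ?inordK //.
rewrite /dwedge /wedge /=.
rewrite (_ : _ - _ = 2 * a * (a - 1) * (a + 1)); last by ring.
by rewrite !mulf_neq0 ?pnatr_eq0 // ?subr_eq0 // addr_eq0.
Qed.

Lemma power_mx_repr j : mx_repr G (fun x => (u x ^+ j)%:M : 'M[C]_1).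
Proof.
split=> [|x y xG yG]; first by rewrite u1 expr1n.
by rewrite uM // exprMn scalar_mxM.
Qed.

Let X j : representation C G := Representation (MxRepresentation (power_mx_repr j)).

Let w_neq1 : w != 1. Proof. exact: omega_neq1. Qed.

Lemma cyclic_decomposes : decomposes X ([:: 1, 1 & nseq (p - 2) 0])%N.
Proof.
pose T1 : 'cV[C]_2 := (velocity (@origin_field R) c)^T.
pose T2 : 'cV[C]_2 := (velocity (@cubic_field R) c)^T.
pose B : 'M[C]_2 := (row_mx T1 T2 : 'M[C]_(2, 1 + 1)).
have [r rG ur] := gen_exists.
apply: (decomposes_basis (B := B) (r2 := dadd_grepr (X 1%N) (X 2%N))).
- apply: (eigen_unit v1_neq0 v2_neq0 _ (Xmx1 rG) (Xmx2 rG)).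
  rewrite ur expr2 -subr_eq0 -[X in X - _]mulr1 -mulrBr mulf_neq0 ?(omega_neq0 R (ltnW p1)) //.
  by rewrite subr_eq0 eq_sym.
- move=> x xG; rewrite /= -[X in block_mx _ X _ _](raddf0 (@scalar_mx C 1)).
  rewrite -[X in block_mx _ _ X _](raddf0 (@scalar_mx C 1)) expr1.
  apply: (mul_row_mx2 (t1 := T1) (t2 := T2)); rewrite scale0r ?addr0 ?add0r.
    exact: Xmx1.
  exact: Xmx2.
exact: (rsim_sum11 X (p - 2)).
Qed.

(** The coordinate [psi'] of the cyclic data may differ from [psi], but both send
    the same point to [0]. By [conj_scaling] the element [rho] acts by the same
    rotation in both. *)
Lemma mult_cyclic_sym : mult_cyclic p l ([:: 1, 1 & nseq (p - 2) 0])%N.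
Proof.
have [r rG ur] := gen_exists.
have rE : chart_action l psi r = scaling w by rewrite (uP rG).1 ur.
have S0 : symset a (Some 0) by apply: mem_symset; rewrite inE eqxx.
have c_sym i : symset a (c i) by rewrite -psiS; exists (zpt l i) => //; exists i.
have cinj : injective c by exact: chart_inj.
have [i0 ci0] : exists i, c i = Some 0.
  have : range c (Some 0) by rewrite range_chart psiS.
  by case=> i _ ci; exists i.
have fix0 s : gmap s l = l -> s i0 = i0.
  move=> sl; have xG : Gof R s \in G by rewrite in_stab GofK; apply/eqP.
  apply: cinj; have := action_chart Kl Lpsi i0 xG.
  by rewrite GofK (uP xG).1 ci0 scaling_Some mulr0.
split=> //.
- exact: cyclic_stab_isog.
- exists [set b | symset a (Some b) /\ b <> 0]; first by case.
  exists psi; split=> //; rewrite psiS; apply/seteqP; split=> z.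
    move=> Sz; have /symsetP[t _ zE] := Sz; rewrite zE in Sz *.
    have [->|t0] := eqVneq t 0; first by left.
    right; exists 0%N => //; exists t; first by split=> //; apply/eqP.
    by rewrite expr0 mul1r.
  case=> [->//|[k _ [b [Sb b0] <-]]].
  elim: k => [|k IHk]; first by rewrite expr0 mul1r.
  by rewrite exprS -mulrA -scaling_Some; apply: autgrp_mem Mw IHk.
- by rewrite /= size_nseq -addn2 subnK.
split.
  exists i0, psi, r; split=> //.
  rewrite -(cyclic_gens Mgen Mw); apply/seteqP; split=> [_ [x xG <-]|f fM].
    by rewrite -psiS; apply: action_autgrp.
  have [|x xG xE] := action_surj Kl Lpsi (f := f); first by rewrite psiS.
  by exists x.
move=> i psi' rho [ifix Lpsi' psi'i _ [rhoG rhoE]].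
have ci : c i = Some 0.
  have sr : Gperm r i = i by apply: ifix; apply/eqP; rewrite -in_stab.
  have := action_chart Kl Lpsi i rG; rewrite sr rE.
  have /symsetP[t _ ->] := c_sym i; rewrite scaling_Some => /Some_inj/eqP.
  rewrite -subr_eq0 -[X in _ - X]mul1r -mulrBl mulf_eq0 subr_eq0 (negPf w_neq1) /=.
  by move/eqP->.
have urho : u rho = w.
  have [Lk K K'] := is_lft_linv Lpsi; have [Lk' k k'] := is_lft_linv Lpsi'.
  have [||[]//|[]] := @conj_scaling (psi' \o linv psi) (u rho) w _ w_neq1.
  - exact: is_lft_comp.
  - rewrite -(uP rhoG).1 -rhoE; apply: funext => z; rewrite /chart_action /=.
    by rewrite K k.
  by rewrite /= -ci /= K psi'i.
exists X; split=> [j _|j _|].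
- by apply: mx_abs_irrW; apply: linear_mx_abs_irr.
- by split=> // k; rewrite /= uX // urho -exprM.
- exact: cyclic_decomposes.
Qed.

End Cyclic.

End Decompositions.

(** * Multiplicities for dihedral stabilizers *)

Section DihedralMult.
Variable R : realType.
Local Notation C := R[i].
Local Notation S2 := (sphere R).
Variables (p : nat) (l : 'rV[C]_2) (M : set S2) (psi : S2 -> S2).
Local Notation w := (omega R p).
Local Notation G := (stab_group l).
Local Notation c := (psi \o zpt l).
Hypotheses (Kl : K5 l) (Lpsi : is_lft psi) (psiM : psi @` zset l = M)
  (pp : prime p) (podd : odd p)
  (Mw : autgrp M (scaling w)) (MV : autgrp M (@inversion R))
  (Mgen : forall f, autgrp M f -> exists k,
     f = iter k (scaling w) \/ f = iter k (scaling w) \o @inversion R)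
  (Mpts : forall z, M z -> [\/ z = None, z = Some 0 | exists2 b, z = Some b & b ^+ p = 1]).

Let p1 : (1 < p)%N := prime_gt1 pp.
Let wp : p.-primitive_root w := omega_prim R pp.
Let Fx x := chart_action l psi x.
(* Since the inversion fixes 1 and exchanges 0 with oo, these are the multiplier
   and the orientation of the rotation or reflection induced by x. *)
Let u (x : Gtype R) : C := odflt 1 (Fx x (Some 1)).
Let e (x : Gtype R) : bool := Fx x (Some 0) == None.

Let FxE x : x \in G -> Fx x = (if e x then scaling (u x) \o @inversion R else scaling (u x))
  /\ exists k, u x = w ^+ k.
Proof.
move=> xG; have [|k [] xE] := Mgen (f := Fx x).
- by rewrite -psiM; apply: action_autgrp.
- rewrite /u /e xE scalingX !scaling_Some mulr1 mulr0 /=; split=> //; by exists k.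
- rewrite /u /e xE scalingX /= !inversion_Some eqxx oner_eq0 invr1 scaling_None eqxx.
  by rewrite scaling_Some mulr1 /=; split=> //; exists k.
Qed.

Let up : {in G, forall x, u x ^+ p = 1}.
Proof.
move=> x /FxE[_ [k ->]].
by rewrite exprAC (prim_expr_order wp) expr1n.
Qed.

Let u0 x : x \in G -> u x != 0.
Proof. by move=> /FxE[_ [k ->]]; rewrite expf_neq0 // omega_neq0 // ltnW. Qed.

Let Fx1 x : x \in G -> Fx x (Some 1) = Some (u x).
Proof.
move=> xG; have [-> _] := FxE xG; case: (e x); rewrite /= ?inversion_Some ?oner_eq0 ?invr1;
  by rewrite scaling_Some mulr1.
Qed.

Let Fx0 x : x \in G -> Fx x (Some 0) = if e x then None else Some 0.
Proof.
move=> xG; have [-> _] := FxE xG; case: (e x); rewrite /= ?inversion_Some ?eqxx;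
  by rewrite ?scaling_None ?scaling_Some ?mulr0.
Qed.

Let FxM : {in G &, forall x y, Fx (x * y)%g = Fx x \o Fx y}.
Proof. exact: actionM. Qed.

Let uM : {in G &, forall x y, u (x * y)%g = u x * (if e x then (u y)^-1 else u y)}.
Proof.
move=> x y xG yG; rewrite {1}/u FxM //= Fx1 //; have [-> _] := FxE xG.
by case: (e x); rewrite /= ?inversion_Some ?(negPf (u0 yG)) scaling_Some.
Qed.

Let eM : {in G &, forall x y, e (x * y)%g = e x (+) e y}.
Proof.
move=> x y xG yG; rewrite {1}/e FxM //= Fx0 //; have [-> _] := FxE xG.
by case: (e x); case: (e y);
  rewrite /= ?inversion_Some ?inversion_None ?eqxx ?scaling_None ?scaling_Some ?mulr0.
Qed.

Let ue_inj : {in G, forall x, u x = 1 -> e x = false -> x = 1%g}.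
Proof.
move=> x xG ux ex; have [] := FxE xG; rewrite ux ex scaling1 => xid _.
apply: (mulgI x); rewrite mulg1; apply: (action_inj Kl Lpsi); rewrite ?groupM //.
by rewrite -!/(Fx _) FxM // xid.
Qed.

Let dih_generators : exists r t, [/\ r \in G, t \in G, u r = w /\ e r = false & u t = 1 /\ e t = true].
Proof.
have [|r rG rE] := action_surj Kl Lpsi (f := scaling w); first by rewrite psiM.
have [|t tG tE] := action_surj Kl Lpsi (f := @inversion R); first by rewrite psiM.
exists r, t; split=> //; rewrite /u /e /Fx ?rE ?tE.
  by rewrite !scaling_Some mulr1 mulr0.
by rewrite !inversion_Some eqxx oner_eq0 invr1.
Qed.

Let m := p./2.
Let pE : p = m.*2.+1. Proof. by rewrite -[LHS]odd_double_half podd. Qed.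
Let pm1 : ((p - 1)./2 = m)%N. Proof. by rewrite pE subn1 /= doubleK. Qed.
Let pp1 : ((p + 1)./2 = m.+1)%N. Proof. by rewrite [in LHS]pE addn1 -doubleS doubleK. Qed.
Let pp3 : ((p + 3)./2 = m.+2)%N.
Proof. by rewrite [in LHS]pE addn3 -!doubleS doubleK. Qed.

Let w_double_neq1 k : (0 < k <= m)%N -> (w ^+ k) ^+ 2 != 1.
Proof.
move=> /andP[k0 km]; rewrite -exprM -(prim_order_dvd wp).
rewrite gtnNdvd ?muln_gt0 ?k0 // pE ltnS muln2 leq_double //.
Qed.

Let X (j : nat) : representation C G :=
  if (j <= m)%N then dih_rep p1 uM eM up j
  else if j == m.+1 then triv_rep C G else sign_rep C eM.

Let rotationE k : rotation p k = scaling (w ^+ k) :> (S2 -> S2).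
Proof.
rewrite /rotation /omega cisX; congr (scaling (cis _)).
by rewrite -[RHS]mulr_natr mulrAC.
Qed.

Let trace_value k j :
  (w ^+ k) ^+ j + (w ^+ k) ^- j = (2 * cos (2 * k%:R * j%:R * pi / p%:R))%:C%C.
Proof.
rewrite -cisDN -exprM /omega cisX cisN; congr (cis _ + (cis _)^-1);
by rewrite -[LHS]mulr_natr natrM; ring.
Qed.

(* In another coordinate psi' the rotation has multiplier w ^+ k or its inverse, and
   both give the same trace. *)
Let trace_rotation x k j (psi' : S2 -> S2) : x \in G -> (0 < k <= m)%N -> is_lft psi' ->
  psi' \o Phi l x \o linv psi' = rotation p k ->
  \tr (dih_mx u e j x) = (2 * cos (2 * k%:R * j%:R * pi / p%:R))%:C%C.
Proof.
move=> xG km Lpsi' psi'E; have [Lk K K'] := is_lft_linv Lpsi.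
have [Lk' k' kk'] := is_lft_linv Lpsi'.
pose chi := psi' \o linv psi.
have Lchi : is_lft chi by exact: is_lft_comp.
have chiE : chi \o Fx x = scaling (w ^+ k) \o chi.
  rewrite -rotationE -psi'E /chi /Fx /chart_action; apply: funext => z /=.
  by rewrite K k'.
have wk2 := w_double_neq1 km.
have wk1 : w ^+ k != 1 by apply: contraNneq wk2 => ->; rewrite expr1n.
rewrite -trace_value /dih_mx; case ex : (e x).
  exfalso; move/eqP: wk2; apply.
  have xx : Fx x \o Fx x = id.
    rewrite -FxM // (dih_involution p1 uM eM up ue_inj xG) //.
    by have [] := FxE (group1 G); rewrite (dih_e1 eM) (dih_u1 p1 uM eM up) scaling1.
  have : chi = scaling ((w ^+ k) ^+ 2) \o chi.
    rewrite expr2 -scalingM; apply: funext => z /=.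
    have Ez z' : chi (Fx x z') = scaling (w ^+ k) (chi z') := congr1 (@^~ z') chiE.
    by rewrite -!Ez -[Fx x (Fx x z)]/((Fx x \o Fx x) z) xx.
  move=> /(congr1 (@^~ (linv chi (Some 1)))) /=.
  have [_ _ ->] := is_lft_linv Lchi.
  by rewrite scaling_Some mulr1 => /Some_inj <-.
rewrite mx2_tr; have [FE _] := FxE xG; rewrite ex in FE; rewrite FE in chiE.
have [[_ ->]//|[_ uw]] := conj_scaling Lchi wk1 chiE.
have -> : u x = (w ^+ k)^-1.
  have wk0 : w ^+ k != 0 by rewrite expf_neq0 // omega_neq0 // ltnW.
  by apply: (mulIf wk0); rewrite uw mulVf.
by rewrite exprVn invrK addrC.
Qed.

Let Mc i : [\/ c i = None, c i = Some 0 | exists2 b, c i = Some b & b ^+ p = 1].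
Proof. by apply: Mpts; rewrite -psiM; exists (zpt l i) => //; exists i. Qed.

Let T k : 'cV[C]_2 := (velocity (@rot_field R k) c)^T.

Let XmxT_rot x k : x \in G -> e x = false -> (0 < k < p)%N ->
  Xmx l x *m T k = u x ^+ (p - k) *: T k.
Proof.
move=> xG ex kp; apply: Xmx_velocity => // t i; rewrite -/(Fx x).
by have [-> _] := FxE xG; rewrite ex; apply: rot_field_scaling (up xG) kp.
Qed.

Let XmxT_ref x k : x \in G -> e x = true -> (0 < k < p)%N ->
  Xmx l x *m T k = - u x ^+ k *: T (p - k).
Proof.
move=> xG ex kp; apply: Xmx_velocity => // t i; rewrite -/(Fx x).
have [-> _] := FxE xG; rewrite ex /= (rot_field_inversion _ kp (Mc i)).
have /andP[k0 kp'] := kp.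
rewrite (rot_field_scaling _ _ (up xG)); last by rewrite subn_gt0 kp' ltn_subrL k0 (ltnW p1).
by rewrite subKn 1?ltnW // mulrA mulrN1.
Qed.

(** The basis consists of the velocity of [rot_field (p - j)] and the opposite of
    that of [rot_field j]; the sign makes up for the one in
    [rot_field_inversion]. *)
Lemma dihedral_decomposes j : (0 < j <= m)%N -> velocity (@rot_field R j) c <> 0 ->
  exists2 B : 'M[C]_2, B \in unitmx &
    forall x, x \in G -> Xmx l x *m B = B *m dih_mx u e j x.
Proof.
move=> jm vj; have /andP[j0 jm'] := jm.
have jp : (0 < j < p)%N by rewrite j0 pE ltnS (leq_trans jm') // -addnn leq_addr.
have /andP[_ jp'] := jp.
have pjp : (0 < p - j < p)%N by rewrite subn_gt0 jp' ltn_subrL j0 (ltnW p1).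
have upj x : x \in G -> u x ^+ (p - j) = u x ^- j.
  move=> xG; apply: (mulIf (expf_neq0 j (u0 xG))).
  by rewrite mulVf ?expf_neq0 ?u0 // -exprD subnK ?up // ltnW.
have [r [t [rG tG [ur er] [ut et]]]] := dih_generators.
have Tj0 : T j != 0 by rewrite trmx_eq0; apply/eqP.
have AR := XmxT_rot; have AV := XmxT_ref.
move: (T) Tj0 AR AV => S Tj0 AR AV.
have Tpj0 : S (p - j)%N != 0.
  apply: contraNneq Tj0 => T0; have := AV _ _ tG et pjp.
  rewrite T0 mulmx0 ut expr1n subKn 1?ltnW // scaleN1r => /esym/eqP.
  by rewrite oppr_eq0.
exists (row_mx (S (p - j)%N) (- S j) : 'M[C]_(2, 1 + 1)).
  apply: (@eigen_unit C (Xmx l r) _ _ (w ^+ j) (w ^- j)) => //.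
  - by rewrite oppr_eq0.
  - have := w_double_neq1 jm; apply: contraNneq => wE.
    by rewrite expr2 {1}wE mulVf // expf_neq0 // omega_neq0 // ltnW.
  - by rewrite AR // subKn 1?ltnW // ur.
  - by rewrite mulmxN AR // upj // ur scalerN.
move=> x xG; rewrite /dih_mx; case ex : (e x);
  apply: mul_row_mx2; rewrite ?scale0r ?addr0 ?add0r.
- by rewrite AV // subKn 1?ltnW // upj // scaleNr scalerN.
- by rewrite mulmxN AV // scaleNr opprK.
- by rewrite AR // subKn 1?ltnW.
- by rewrite mulmxN AR // upj // scalerN.
Qed.

Lemma mult_dihedral_model j : (0 < j <= m)%N -> velocity (@rot_field R j) c <> 0 ->
  mult_dihedral p l (nseq j.-1 0 ++ 1 :: nseq (m.+2 - j) 0)%N.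
Proof.
move=> jm vj; have /andP[j0 jm'] := jm.
have [r [t [rG tG [ur er] [ut et]]]] := dih_generators.
split=> //.
- exact: (dih_isog p1 wp uM eM up ue_inj rG tG ur er ut et).
- rewrite size_cat /= !size_nseq pp3 addnS -addSn prednK // subnKC //.
  exact: leq_trans jm' (leqW (leqnSn m)).
have Xlow i : (i <= m)%N -> X i = dih_rep p1 uM eM up i by rewrite /X => ->.
have X1 : X m.+1 = triv_rep C G by rewrite /X ltnn eqxx.
have X2 : X m.+2 = sign_rep C eM.
  by rewrite /X ltnNge leqnSn /= gtn_eqF.
exists X; rewrite pm1 pp1 pp3; split.
- move=> i /andP[i0 im2].
  case: (leqP i m) => [im|mi].
    by rewrite Xlow //; apply: (dih_rep_irr p1 uM eM up rG tG ur er ut et); rewrite w_double_neq1 // i0.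
  apply: mx_abs_irrW; apply: linear_mx_abs_irr.
  by rewrite /X leqNgt mi /=; case: ifP.
- move=> i /andP[i0 im]; rewrite Xlow //; split=> // x xG; split=> [k psi' km Lpsi' psi'E|x2].
    exact: trace_rotation psi'E.
  have ex : e x by rewrite -(dih_order2 podd p1 uM eM up ue_inj (x := x) xG) x2.
  by rewrite /= /dih_mx ex mx2_tr addr0.
- by rewrite X1.
- rewrite X2; split=> // x xG /=.
  by rewrite (dih_order2 podd p1 uM eM up ue_inj (x := x) xG).
have [B uB BE] := dihedral_decomposes jm vj.
apply: (decomposes_basis (r2 := dih_rep p1 uM eM up j) uB BE).
by have := rsim_sum1 X j.-1 (m.+2 - j); rewrite prednK // Xlow.
Qed.

End DihedralMult.

(** * The special configurations of five points *)

Section FivePoints.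
Variable R : realType.
Local Notation C := R[i].
Local Notation S2 := (sphere R).
Local Notation w5 := (omega R 5).
Local Notation w3 := (omega R 3).
Local Notation I := (Complex 0 1 : C).

(** Along [rot_field 2] the logarithmic derivative of [wedge] at [y], [z] is
    [(y + z) ^+ 2], and the four terms of the cross-ratio add up to
    [2 (q - x) (r - p)]. *)
Lemma pentagon_velocity (c : 'I_5 -> S2) : injective c -> range c = @pentagon R ->
  velocity (@rot_field R 2) c <> 0.
Proof.
move=> ci rc; have ne := @w5_neq R.
pose c0 (i : 'I_5) : S2 :=
  nth None (map Some [:: 1; w5; w5 ^+ 2; w5 ^+ 3; w5 ^+ 4]) i.
have c0i : injective c0.
  apply: nth5_inj => //; rewrite map_inj_uniq; last by move=> x y /Some_inj.
  rewrite /= !inE !negb_or -[X in X != w5]/(w5 ^+ 0) -{1 3 4 5}[w5]expr1.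
  rewrite (ne 0 1)%N // (ne 0 2)%N // (ne 0 3)%N // (ne 0 4)%N //.
  rewrite (ne 1 2)%N // (ne 1 3)%N // (ne 1 4)%N //.
  by rewrite (ne 2 3)%N // (ne 2 4)%N // (ne 3 4)%N.
have rc0 : range c = range c0 by rewrite rc range_nth5.
apply: (velocity_relabel ci c0i rc0).
apply: (velocity_neq0 c0i (p := Some 1) (q := Some w5) (r := Some (w5 ^+ 2))
  (x := Some (w5 ^+ 3))) => //; rewrite /c0 ?inordK //.
have e01 : 1 - w5 != 0 by rewrite subr_eq0 (ne 0 1)%N.
have e12 : w5 - w5 ^+ 2 != 0 by rewrite subr_eq0 -{1}[w5]expr1 (ne 1 2)%N.
have e02 : w5 ^+ 2 - 1 != 0 by rewrite subr_eq0 eq_sym (ne 0 2)%N.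
have e13 : w5 - w5 ^+ 3 != 0 by rewrite subr_eq0 -{1}[w5]expr1 (ne 1 3)%N.
have e03 : w5 ^+ 3 - 1 != 0 by rewrite subr_eq0 eq_sym (ne 0 3)%N.
have e23 : w5 ^+ 3 - w5 ^+ 2 != 0 by rewrite subr_eq0 (ne 3 2)%N.
rewrite /dwedge /wedge /=.
rewrite (_ : _ - _ = 2 * (w5 - w5 ^+ 3) * (w5 ^+ 2 - 1) *
  ((w5 - w5 ^+ 2) * (w5 ^+ 3 - 1)) * ((- (1 - w5)) * (w5 ^+ 3 - w5 ^+ 2))); last by ring.
by rewrite !mulf_neq0 // ?oppr_eq0 // pnatr_eq0.
Qed.

Lemma triangle_velocity (c : 'I_5 -> S2) : injective c -> range c = @triangle R ->
  velocity (@rot_field R 1) c <> 0.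
Proof.
move=> ci rc.
have w31 : w3 != 1 by exact: omega_neq1.
have w30 : w3 != 0 by exact: omega_neq0.
pose c0 (i : 'I_5) : S2 := nth None [:: Some 0; Some 1; None; Some w3; Some (w3 ^+ 2)] i.
have c0i : injective c0.
  apply: nth5_inj => //; rewrite /= !inE !negb_or !(inj_eq Some_inj) /=.
  have w32 : w3 ^+ 2 != 1.
    apply/eqP => e; have := omegaXp R (isT : 0 < 3)%N.
    by rewrite exprS e mulr1 => /eqP; rewrite (negPf w31).
  have w33 : w3 ^+ 2 != w3.
    rewrite -subr_eq0 (_ : _ - _ = w3 * (w3 - 1)); last by ring.
    by rewrite mulf_neq0 // subr_eq0.
  rewrite ![0 == _]eq_sym oner_eq0 w30 expf_eq0 /= w30.
  by rewrite ![1 == _]eq_sym w31 w32 eq_sym w33.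
have rc0 : range c = range c0.
  by rewrite rc range_nth5; apply/seteqP; split=> x; rewrite /triangle /=; tauto.
apply: (velocity_relabel ci c0i rc0).
apply: (velocity_neq0 c0i (p := Some 0) (q := Some 1) (r := None) (x := Some w3)) => //;
  rewrite /c0 ?inordK //.
rewrite /dwedge /wedge /=.
rewrite (_ : _ - _ = 2 * w3 * (w3 - 1)); last by ring.
by rewrite !mulf_neq0 // ?subr_eq0 // pnatr_eq0.
Qed.

Lemma mult_pentagon (l : 'rV[C]_2) : K5 l -> equivalent (zset l) (@pentagon R) ->
  mult_dihedral 5 l [:: 0; 1; 0; 0]%N.
Proof.
move=> Kl [psi [Lpsi psiM]].
have Mpts z : @pentagon R z -> [\/ z = None, z = Some 0 | exists2 b, z = Some b & b ^+ 5 = 1].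
  move=> /pentagonP[k _ ->]; constructor 3; exists (w5 ^+ k) => //.
  by rewrite exprAC omegaXp // expr1n.
apply: (@mult_dihedral_model R 5 l _ psi Kl Lpsi psiM isT isT (pentagon_rotation R)
  (pentagon_inversion R) (@autgrp_pentagon R) Mpts 2 isT).
apply: pentagon_velocity; first exact: chart_inj.
by rewrite range_chart.
Qed.

Lemma mult_triangle (l : 'rV[C]_2) : K5 l -> equivalent (zset l) (@triangle R) ->
  mult_dihedral 3 l [:: 1; 0; 0]%N.
Proof.
move=> Kl [psi [Lpsi psiM]].
have w3p : w3 ^+ 3 = 1 by exact: omegaXp.
have Mpts z : @triangle R z -> [\/ z = None, z = Some 0 | exists2 b, z = Some b & b ^+ 3 = 1].
  rewrite /triangle /=; case=> [[[[]|]|]|] ->; [constructor 2|constructor 1|constructor 3..] => //.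
  - by exists 1; rewrite ?expr1n.
  - by exists w3.
  - by exists (w3 ^+ 2); rewrite // exprAC w3p expr1n.
apply: (@mult_dihedral_model R 3 l _ psi Kl Lpsi psiM isT isT (triangle_rotation R)
  (triangle_inversion R) (@autgrp_triangle R) Mpts 1 isT).
apply: triangle_velocity; first exact: chart_inj.
by rewrite range_chart.
Qed.

Lemma omega4_prim : 4.-primitive_root (omega R 4).
Proof.
have i2 : I ^+ 2 = -1 := imaginary_sqr R.
have [k km k4] := prim_order_exists (isT : 0 < 4)%N (omegaXp R (isT : 0 < 4)%N).
move: k4 km; rewrite omega4; case: k => [|[|[|[|[|k]]]]] //.
- by move=> _ /prim_expr_order/eqP; rewrite expr1 => /eqP e; move: i2; rewrite e expr1n
    => /esym/eqP; rewrite eqNr oner_eq0.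
- by move=> _ /prim_expr_order; rewrite i2 => /eqP; rewrite eqNr oner_eq0.
Qed.

Lemma mult_square (l : 'rV[C]_2) : K5 l -> equivalent (zset l) (symset I) ->
  mult_cyclic 4 l [:: 1; 1; 0; 0]%N.
Proof.
move=> Kl [psi [Lpsi psiM]].
apply: (mult_cyclic_sym (p := 4) Kl Lpsi psiM (generic_I R) isT isT omega4_prim).
  by rewrite omega4; exact: square_rotation.
by move=> f /autgrp_square[u -> /root4[k ->]]; exists k; rewrite omega4.
Qed.

Lemma mult_symset (a : C) (l : 'rV[C]_2) : generic a -> ~ golden_eq a ->
  3 * a ^+ 2 <> - 1 -> a ^+ 2 <> - 3 -> a ^+ 2 <> - 1 ->
  K5 l -> equivalent (zset l) (symset a) -> mult_cyclic 2 l [:: 1; 1]%N.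
Proof.
move=> ga n1 n2 n3 n4 Kl [psi [Lpsi psiM]].
apply: (mult_cyclic_sym (p := 2) Kl Lpsi psiM ga isT isT (omega_prim R (isT : prime 2))).
  by rewrite omega2; exact: sym_scaling_N1.
move=> f /(autgrp_half_turn ga n1 n2 n3 n4)[u -> /eqP]; rewrite sqrf_eq1 omega2.
by case/orP => /eqP->; [exists 0%N|exists 1%N].
Qed.

(** A point of K5 equivalent to the five given points exists, and the isomorphism
    class of the automorphism group can be read off from its stabilizer. *)
Lemma mult_package (z : 'I_5 -> S2) (M : set S2) (mult : 'rV[C]_2 -> seq nat -> Prop)
    (gT : finGroupType) (H : {group gT}) (a : seq nat) :
  injective z -> equivalent (range z) M ->
  (forall l, K5 l -> equivalent (zset l) M -> mult l a) ->
  (forall l, mult l a -> stab_group l \isog H) ->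
  iso_fingroup (autgrp (range z)) H /\ mult_of mult (range z) a.
Proof.
move=> zi zM multM multH.
have multz l : K5 l -> equivalent (zset l) (range z) -> mult l a.
  by move=> Kl lz; apply: multM => //; apply: equivalent_trans lz zM.
have [l Kl lz] := exists_modulus zi; split.
  exact: (iso_fingroup_stab Kl lz (multH l (multz l Kl lz))).
by split=> //; exists l.
Qed.

Lemma sqrt_complex (n : nat) : ((Num.sqrt (n%:R : R))%:C%C) ^+ 2 = n%:R :> C.
Proof. by rewrite -rmorphXn /= sqr_sqrtr ?ler0n // rmorph_nat. Qed.

Lemma golden_eqP (a : C) : (a \in [:: (Num.sqrt 5 + 2)%:C%C; - (Num.sqrt 5 + 2)%:C%C;
              (Num.sqrt 5 - 2)%:C%C; - (Num.sqrt 5 - 2)%:C%C]) <-> golden_eq a.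
Proof.
have s5 : ((Num.sqrt (5 : R))%:C%C) ^+ 2 = 5 :> C := sqrt_complex 5.
set s : C := (Num.sqrt 5)%:C%C in s5.
have -> : ((Num.sqrt 5 + 2)%:C%C : C) = s + 2 by rewrite rmorphD /= rmorph_nat.
have -> : ((Num.sqrt 5 - 2)%:C%C : C) = s - 2 by rewrite rmorphB /= rmorph_nat.
have E : a ^+ 4 - 18 * a ^+ 2 + 1 =
    (a - (s + 2)) * (a - (- (s + 2))) * ((a - (s - 2)) * (a - (- (s - 2)))).
  transitivity (a ^+ 4 - (2 * s ^+ 2 + 8) * a ^+ 2 + (s ^+ 2 - 4) ^+ 2); last by ring.
  by rewrite s5; ring.
rewrite /golden_eq E !inE; split.
  by case/or4P => /eqP->; rewrite subrr !(mul0r, mulr0).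
by move/eqP; rewrite !mulf_eq0 !subr_eq0 -!orbA.
Qed.

Lemma equianharmonicP (a : C) : (a \in [:: (Num.sqrt 3)%:C%C * I; - ((Num.sqrt 3)%:C%C * I);
              (Num.sqrt 3)^-1%:C%C * I; - ((Num.sqrt 3)^-1%:C%C * I)]) <->
  3 * a ^+ 2 = - 1 \/ a ^+ 2 = - 3.
Proof.
have i2 := imaginary_sqr R.
have s3 : ((Num.sqrt (3 : R))%:C%C) ^+ 2 = 3 :> C := sqrt_complex 3.
have -> : (((Num.sqrt 3)^-1)%:C%C : C) = ((Num.sqrt 3)%:C%C)^-1 by rewrite fmorphV.
set s : C := (Num.sqrt 3)%:C%C in s3 *.
have n3 : (3 : C) != 0 by rewrite pnatr_eq0.
have s0 : s != 0 by apply: contraNneq n3 => s0; rewrite -s3 s0 expr0n.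
have e1 : (s * I) ^+ 2 = - 3 by rewrite exprMn s3 i2 mulrN1.
have e2 : 3 * (s^-1 * I) ^+ 2 = - 1 by rewrite exprMn exprVn s3 i2 mulrA mulfV ?mul1r.
rewrite !inE; split=> [|[aE|aE]].
- by case/or4P => /eqP->; rewrite ?sqrrN; [right|right|left|left].
- have : a ^+ 2 = (s^-1 * I) ^+ 2 by apply: (mulfI n3); rewrite aE e2.
  by move/eqP; rewrite eqf_sqr => /orP[]->; rewrite ?orbT.
- have : a ^+ 2 = (s * I) ^+ 2 by rewrite aE e1.
  by move/eqP; rewrite eqf_sqr => /orP[]->; rewrite ?orbT.
Qed.

Lemma imaginaryP (a : C) : a \in [:: I; - I] <-> a ^+ 2 = - 1.
Proof.
rewrite !inE -eqf_sqr imaginary_sqr; split=> [/eqP//|->]; exact: eqxx.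
Qed.

Lemma square_symset :
  [set Some 0; Some 1; Some I; Some (- 1); Some (- I)] = symset I.
Proof. by apply/seteqP; split=> x; rewrite /symset /=; tauto. Qed.

End FivePoints.

Theorem theorem22 (R : realType) (z : 'I_5 -> sphere R) (z_inj : injective z) :
  let alpha : set (sphere R) := range z in
  let w5 : R[i] := omega R 5 in
  let w3 : R[i] := omega R 3 in
  let I : R[i] := Complex 0 1 in
  let pentagon : set (sphere R) :=
    [set Some 1; Some w5; Some (w5 ^+ 2); Some (w5 ^+ 3); Some (w5 ^+ 4)] in
  let square : set (sphere R) :=
    [set Some 0; Some 1; Some I; Some (- 1); Some (- I)] in
  let triangle : set (sphere R) :=
    [set Some 0; None; Some 1; Some w3; Some (w3 ^+ 2)] in
  let symmetric (a : R[i]) : set (sphere R) :=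
    [set Some 0; Some 1; Some (- 1); Some a; Some (- a)] in
  let generic (a : R[i]) : Prop := [/\ a <> 0, a <> 1 & a <> - 1] in
  let golden (a : R[i]) : Prop :=
    a \in [:: (Num.sqrt 5 + 2)%:C%C; - (Num.sqrt 5 + 2)%:C%C;
              (Num.sqrt 5 - 2)%:C%C; - (Num.sqrt 5 - 2)%:C%C] in
  let imaginary_unit (a : R[i]) : Prop := a \in [:: I; - I] in
  let equianharmonic (a : R[i]) : Prop :=
    a \in [:: (Num.sqrt 3)%:C%C * I; - ((Num.sqrt 3)%:C%C * I);
              (Num.sqrt 3)^-1%:C%C * I; - ((Num.sqrt 3)^-1%:C%C * I)] in
  [/\ (* 1 *)
      forall psi, is_lft psi -> psi @` alpha = pentagon ->
        [/\ autgrp alpha =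
              lft_conj psi (lft_gen [set scaling w5; @inversion R]),
            iso_fingroup (autgrp alpha) [set: dihedral_gtype 10]%G
          & mult_of (@mult_dihedral R 5) alpha [:: 0; 1; 0; 0]%N],
      (* 2 *)
      forall psi, is_lft psi -> psi @` alpha = square ->
        [/\ autgrp alpha = lft_conj psi (lft_gen [set scaling I]),
            iso_fingroup (autgrp alpha) (Zp 4)
          & mult_of (@mult_cyclic R 4) alpha [:: 1; 1; 0; 0]%N],
      (* 3 *)
      forall psi, is_lft psi -> psi @` alpha = triangle ->
        [/\ autgrp alpha =
              lft_conj psi (lft_gen [set scaling w3; @inversion R]),
            iso_fingroup (autgrp alpha) [set: dihedral_gtype 6]%G
          & mult_of (@mult_dihedral R 3) alpha [:: 1; 0; 0]%N],
      (* 4 *)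
      forall psi a, is_lft psi -> generic a -> psi @` alpha = symmetric a ->
        [/\ golden a -> exists phi, is_lft phi /\ phi @` alpha = pentagon,
            imaginary_unit a -> psi @` alpha = square,
            equianharmonic a -> exists phi, is_lft phi /\ phi @` alpha = triangle
          & ~ golden a -> ~ imaginary_unit a -> ~ equianharmonic a ->
            [/\ autgrp alpha = lft_conj psi (lft_gen [set scaling (- 1)]),
                iso_fingroup (autgrp alpha) (Zp 2)
              & mult_of (@mult_cyclic R 2) alpha [:: 1; 1]%N]]
    & (* 5 *)
      ~ (exists psi, is_lft psi /\ psi @` alpha = pentagon) ->
      ~ (exists psi, is_lft psi /\ psi @` alpha = square) ->
      ~ (exists psi, is_lft psi /\ psi @` alpha = triangle) ->
      ~ (exists psi a, [/\ is_lft psi, generic a & psi @` alpha = symmetric a]) ->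
      autgrp alpha = [set id]].

Proof.
move=> alpha w5 w3 I pentagon square triangle symmetric generic golden imaginary_unit
  equianharmonic.
split.
- move=> psi Lpsi psiE.
  have eq_alpha : equivalent alpha pentagon by exists psi.
  have [iso mult] := mult_package z_inj eq_alpha (@mult_pentagon R)
    (fun l (h : mult_dihedral 5 l _) => let: And5 _ _ iso _ _ := h in iso).
  split=> //; rewrite (autgrp_conj Lpsi psiE); congr lft_conj.
  exact: dihedral_gens (pentagon_rotation R) (pentagon_inversion R) (@autgrp_pentagon R).
- move=> psi Lpsi; rewrite /square square_symset => psiE.
  have eq_alpha : equivalent alpha (symset I) by exists psi.
  have [iso mult] := mult_package z_inj eq_alpha (@mult_square R)
    (fun l (h : mult_cyclic 4 l _) => let: And5 _ iso _ _ _ := h in iso).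
  split=> //; rewrite (autgrp_conj Lpsi psiE); congr lft_conj.
  apply: cyclic_gens (square_rotation R).
  by move=> f /autgrp_square[u -> /root4[k ->]]; exists k.
- move=> psi Lpsi psiE.
  have eq_alpha : equivalent alpha triangle by exists psi.
  have [iso mult] := mult_package z_inj eq_alpha (@mult_triangle R)
    (fun l (h : mult_dihedral 3 l _) => let: And5 _ _ iso _ _ := h in iso).
  split=> //; rewrite (autgrp_conj Lpsi psiE); congr lft_conj.
  exact: dihedral_gens (triangle_rotation R) (triangle_inversion R) (@autgrp_triangle R).
- move=> psi a Lpsi ga psiE.
  have eq_alpha : equivalent alpha (symset a) by exists psi.
  split=> [/golden_eqP ea|/imaginaryP ea|/equianharmonicP ea|n1 n2 n3].
  + exact: equivalent_trans eq_alpha (golden_pentagon ea).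
  + rewrite psiE /square square_symset; apply: symset_sqr.
    by rewrite ea imaginary_sqr.
  + exact: equivalent_trans eq_alpha (equianharmonic_triangle ea).
  have m1 : ~ golden_eq a by move=> /golden_eqP.
  have m2 : 3 * a ^+ 2 <> - 1 by move=> e; apply/n3/equianharmonicP; left.
  have m3 : a ^+ 2 <> - 3 by move=> e; apply/n3/equianharmonicP; right.
  have m4 : a ^+ 2 <> - 1 by move=> /imaginaryP.
  have [iso mult] := mult_package z_inj eq_alpha
    (fun l => @mult_symset R a l ga m1 m2 m3 m4)
    (fun l (h : mult_cyclic 2 l _) => let: And5 _ iso _ _ _ := h in iso).
  split=> //; rewrite (autgrp_conj Lpsi psiE); congr lft_conj.
  apply: cyclic_gens (sym_scaling_N1 a).
  move=> f /(autgrp_half_turn ga m1 m2 m3 m4)[u -> /eqP]; rewrite sqrf_eq1.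
  by case/orP => /eqP->; [exists 0%N|exists 1%N].
move=> _ _ n3 n4; apply/seteqP; split=> [f fA|_ ->]; last exact: autgrp_id.
apply: contrapT => fid; case: (automorphism_shape z_inj fA fid).
  by case=> psi Lpsi psiE; apply: n3; exists psi.
by case=> psi [a [Lpsi ga psiE]]; apply: n4; exists psi, a.
Qed.
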